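(* Let $G$ be a sequentially complete Hausdorff topological Abelian group such that $G^\omega$ is minimal. Then there exists a compact subgroup $N$ of $G$ such that $G/N$ is topologically isomorphic to $\prod_{p\in\mathbb P} B_p$, where for every prime $p$ the group $B_p$ is a bounded $p$-torsion minimal topological group.
   Context: $\mathbb P$ is the set of primes. A Hausdorff topological group is minimal if there is no strictly coarser Hausdorff group topology on it. A topological Abelian group $G$ is sequentially complete if it is sequentially closed in its completion (equivalently, every Cauchy sequence in $G$ converges). A group is bounded if $nB=0$ for some positive integer $n$; $p$-torsion means every element has order a power of $p$. *)

(* Defs.v *)
From HB Require Import structures.
From mathcomp Require Import all_boot all_algebra.
From mathcomp Require Import all_classical all_reals all_analysis.

Set Implicit Arguments.
Unset Strict Implicit.
Unset Printing Implicit Defensive.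

Import GRing.Theory.

Local Open Scope classical_set_scope.
Local Open Scope ring_scope.

Section ProductGroup.
Context {I : Type} (T : I -> topologicalZmodType).

Local Notation P := (prod_topology T).

Let prod_zero : P := fun=> 0.
Let prod_opp (f : P) : P := fun i => - f i.
Let prod_add (f g : P) : P := fun i => f i + g i.

Let prod_addA : associative prod_add.
Proof.
by move=> f g h; apply: functional_extensionality_dep => i; exact: addrA.
Qed.

Let prod_addC : commutative prod_add.
Proof.
by move=> f g; apply: functional_extensionality_dep => i; exact: addrC.
Qed.

Let prod_add0 : left_id prod_zero prod_add.
Proof.
by move=> f; apply: functional_extensionality_dep => i; exact: add0r.
Qed.

Let prod_addN : left_inverse prod_zero prod_opp prod_add.
Proof.
by move=> f; apply: functional_extensionality_dep => i; exact: addNr.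
Qed.

HB.instance Definition _ := GRing.isZmodule.Build P
  prod_addA prod_addC prod_add0 prod_addN.

Let prod_sub_continuous : continuous (fun x : P * P => x.1 - x.2).
Proof.
move=> x; apply/cvg_sup => i A; rewrite nbhsE => -[_ [[B oB <-] Bx] BA].
have fi : continuous (fun f : P => f i).
  move=> f C Cf.
  have /cvg_sup/(_ i) : nbhs f --> (f : P) by exact: cvg_id.
  by apply; exact: (@initial_continuous _ _ (fun g : P => g i)).
have sub_i : (fun z : P * P => z.1 i - z.2 i) @ x --> x.1 i - x.2 i.
  apply: (@continuous2_cvg _ _ _ _ _ _ (fun z : P * P => z.1 i)
    (fun z => z.2 i) (fun a b => a - b)).
  - exact: (@sub_continuous (T i) (x.1 i, x.2 i)).
  - apply: (@cvg_comp _ _ _ fst (fun f : P => f i)); last exact: fi.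
    exact: cvg_fst.
  - apply: (@cvg_comp _ _ _ snd (fun f : P => f i)); last exact: fi.
    exact: cvg_snd.
by apply: (filterS BA); apply: sub_i; apply: open_nbhs_nbhs.
Qed.

HB.instance Definition _ :=
  PreTopologicalNmodule_isTopologicalZmodule.Build P prod_sub_continuous.

End ProductGroup.

Section QuotientGroup.
Context (G : topologicalZmodType) (N : zmodClosed G).

Definition quotient_group : Type := quotient_topology (Quotient.quot N).

HB.instance Definition _ := Topological.on quotient_group.
HB.instance Definition _ := GRing.isZmodule.Build quotient_group
  (@Quotient.addqA G N) (@Quotient.addqC G N)
  (@Quotient.add0q G N) (@Quotient.addNq G N).

Local Notation Q := quotient_group.

Let pi (x : G) : Q := (\pi_(Quotient.quot N) x)%qT.

Let pi_eq x y : pi x = pi y <-> x - y \in N.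
Proof. by rewrite Quotient.idealrBE; split=> [e|/eqP//]; exact/eqP. Qed.

Let pi_surj (q : Q) : exists x, pi x = q.
Proof. by exists (repr (q : Quotient.quot N)); exact: reprK. Qed.

Let pi_sub x y : pi (x - y) = pi x - pi y.
Proof. by rewrite /pi Quotient.pi_add Quotient.pi_opp. Qed.

Let pi_nbhs x (U : set G) : nbhs x U -> nbhs (pi x) (pi @` U).
Proof.
rewrite nbhsE => -[V [oV Vx] VU]; rewrite nbhsE; exists (pi @` V); last first.
  exact: image_subset.
split; last by exists x.
rewrite /open/= /quotient_open openE => y [u Vu /pi_eq uyN].
have : (fun z : G => z - (y - u)) @ y --> y - (y - u).
  apply: (@continuous2_cvg _ _ _ _ _ _ id (fun=> y - u) (fun a b => a - b)).
  - exact: (@sub_continuous G (y, y - u)).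
  - exact: cvg_id.
  - exact: cvg_cst.
rewrite subKr => /(_ V) H.
have : nbhs y [set z | V (z - (y - u))] by apply: H; exact: open_nbhs_nbhs.
apply: filterS => z Vz; exists (z - (y - u)) => //.
by apply/pi_eq; rewrite addrAC subrr sub0r opprB.
Qed.

Let quotient_sub_continuous : continuous (fun x : Q * Q => x.1 - x.2).
Proof.
move=> [a b] W /=.
have [x <-] := pi_surj a; have [y <-] := pi_surj b.
rewrite -pi_sub => /(pi_continuous (Q0 := Quotient.quot N)).
move=> /(@sub_continuous G (x, y)) [[U V] /= [Ux Vy] UVW].
exists (pi @` U, pi @` V) => /=; first by split; exact: pi_nbhs.
move=> [_ _] /= [[u Uu <-] [v Vv <-]] /=.
by rewrite -pi_sub; exact: (UVW (u, v)).
Qed.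

HB.instance Definition _ :=
  PreTopologicalNmodule_isTopologicalZmodule.Build quotient_group
    quotient_sub_continuous.
End QuotientGroup.

(* [Topological G] is the type of all topologies on the carrier of G; below, tau
   is unrelated to the topology G may already carry. *)
Definition group_topology (G : zmodType) (tau : Topological G) : Prop :=
  let T : topologicalType := Topological.Pack tau in
  continuous (fun x : T * T => ((x.1 : G) + (x.2 : G) : T)) /\
  continuous (fun x : T => (- (x : G) : T)).

Definition minimal_group (G : topologicalZmodType) : Prop :=
  hausdorff_space G /\
  ~ exists tau : Topological G,
      [/\ group_topology tau,
          hausdorff_space (Topological.Pack tau) &
          @open (Topological.Pack tau) `<` @open G].

Definition cauchy_sequence (G : topologicalZmodType) (x : nat -> G) : Prop :=
  forall U : set G, nbhs 0 U ->
    exists k : nat, forall m n : nat,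
      (k <= m)%N -> (k <= n)%N -> U (x m - x n).

Definition sequentially_complete (G : topologicalZmodType) : Prop :=
  forall x : nat -> G, cauchy_sequence x -> exists l : G, x @ \oo --> l.

Definition topologically_isomorphic (G H : topologicalZmodType) : Prop :=
  exists (f : {additive G -> H}) (g : H -> G),
    [/\ cancel f g, cancel g f, continuous f & continuous g].

Definition bounded_group (G : zmodType) : Prop :=
  exists2 n : nat, (0 < n)%N & forall x : G, x *+ n = 0.

Definition has_order (G : zmodType) (x : G) (n : nat) : Prop :=
  [/\ (0 < n)%N, x *+ n = 0 &
      forall m : nat, (0 < m)%N -> x *+ m = 0 -> (n <= m)%N].

Definition p_torsion (p : nat) (G : zmodType) : Prop :=
  forall x : G, exists k : nat, has_order x (p ^ k)%N.

Definition prime_type : Type := {p : nat | prime p}.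

(* Main.v *)
(** Let [K] be the completion of [G]. Minimality of the power of [G] passes to the power
    of [K], and it forces [K] to be compact. Indeed minimality first gives, for each
    neighbourhood [U] of zero, a multiple [k K] covered by finitely many translates of
    [U], so that the multiples of [K] shrink to a compact divisible subgroup [D]. It then
    shows that each primary part of [K], whose multiples by powers of [p] shrink to [D],
    is totally bounded: otherwise the Bohr topology of some subgroup would yield a strictly
    coarser Hausdorff group topology on the power of [K]. Finally [K] is approximated by
    finite sums of its primary parts.

    The dense subgroup [G] of [K] meets every nonzero closed subgroup. Applied to closed
    monothetic subgroups of the power of [K], and with sequential completeness, this gives
    for each prime [p] an exponent [k] such that [G] contains [p ^ k x] for every
    topologically [p]-torsion [x] in [K], and also the [p]-torsion elements of [K].
    Put [m = k + 1] and let [N] be the intersection over [p] of the subgroups [p ^ m K].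
    By duality every point of [K] is the limit of a sequence of topologically torsion
    points that agree with it on torsion characters, and these are sums of their primary
    components; hence [N] is a compact subgroup of [G], and the Chinese remainder theorem
    in [K] identifies [G / N] with the product of the groups [B_p = G / (G /\ p ^ m K)].
    The choice [m = k + 1] makes [B_p] essential in [K / p ^ m K], whence its minimality. *)
Require Import Defs.
From HB Require Import structures.
From mathcomp Require Import all_boot all_order all_algebra.
From mathcomp Require Import Rstruct.
From mathcomp Require Import all_classical all_reals all_analysis.
From mathcomp Require Import zify ring lra.

Set Implicit Arguments.
Unset Strict Implicit.
Unset Printing Implicit Defensive.

Import Order.TTheory GRing.Theory Num.Theory.
Import numFieldNormedType.Exports.

Local Open Scope classical_set_scope.
Local Open Scope ring_scope.

(** The completion need not be metrizable, while [G] is closed only under limits of sequences. Hence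
    every point that has to be placed in [G] must be reached by a sequence from [G]: multiples of
    one element, or finite sums cut off at factorials. This is why topologically torsion points, and
    approximation by sequences of them, carry the second half of the proof.

    The infinite power serves twice for a diagonal. One list of integers acts in all coordinates at
    once, so placing a sequence independent at level [p ^ v] in coordinate [v] makes smallness in
    the first [a] coordinates force, modulo a compact group, divisibility of the coefficients by
    [p ^ a]. And points violating the exponents 0, 1, 2, ... become the coordinates of a single
    point, which yields one exponent for all topologically [p]-torsion points; this uniformity is
    what bounds [B_p].

    Invariant means on bounded functions replace Haar measure, both for separating points by
    characters and for straightening approximate homomorphisms. *)

(* [zmodule] decides equalities in abelian groups by comparing the integer
   coefficients of the atoms. *)
Inductive zexpr : Type :=
  | ZVar of nat | ZZero | ZAdd of zexpr & zexpr | ZOpp of zexpr.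

Fixpoint zeval (G : zmodType) (env : seq G) (e : zexpr) : G :=
  match e with
  | ZVar n => nth 0 env n
  | ZZero => 0
  | ZAdd a b => zeval env a + zeval env b
  | ZOpp a => - zeval env a
  end.

Fixpoint zcoef (e : zexpr) (i : nat) : int :=
  match e with
  | ZVar n => if n == i then 1 else 0
  | ZZero => 0
  | ZAdd a b => zcoef a i + zcoef b i
  | ZOpp a => - zcoef a i
  end.

Lemma zevalE (G : zmodType) (env : seq G) (e : zexpr) :
  zeval env e = \sum_(i < size env) nth 0 env i *~ zcoef e i.
Proof.
elim: e => [n||a IHa b IHb|a IHa] /=; rewrite ?IHa ?IHb.
- have [nlt|nge] := ltnP n (size env).
    rewrite (bigD1 (Ordinal nlt)) //= eqxx mulr1z big1 ?addr0// => i.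
    by rewrite -val_eqE /= eq_sym => /negPf ->; rewrite mulr0z.
  rewrite nth_default// big1// => i _.
  by rewrite gtn_eqF ?mulr0z// (leq_trans (ltn_ord i)).
- by rewrite big1// => i _; rewrite mulr0z.
- by rewrite -big_split; apply: eq_bigr => i _; rewrite mulrzDr.
- by rewrite -sumrN; apply: eq_bigr => i _; rewrite mulrNz.
Qed.

(** Reflection: on concrete expressions the hypothesis is a closed boolean, so [zmodule] proves it
    by computation with [isT]. *)
Lemma zeval_eq (G : zmodType) (env : seq G) (e1 e2 : zexpr) :
  all (fun i => zcoef e1 i == zcoef e2 i) (iota 0 (size env)) ->
  zeval env e1 = zeval env e2.
Proof.
move=> /allP h; rewrite !zevalE; apply: eq_bigr => i _.
by rewrite (eqP (h i _))// mem_iota add0n ltn_ord.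
Qed.

(** Two occurrences of [x *+ m] can differ in the inferred structure alone, so such atoms are
    compared by [x] and [m] only. *)
Ltac zmod_same a b :=
  match a with
  | b => true
  | (?x *+ ?m)%R => match b with (x *+ m)%R => true end
  | (?x *~ ?m)%R => match b with (x *~ m)%R => true end
  | _ => false
  end.
Ltac zmod_mem a l :=
  match l with
  | nil => false
  | ?b :: ?l' => match zmod_same a b with true => true | false => zmod_mem a l' end
  end.
Ltac zmod_index a l :=
  match l with
  | ?b :: ?l' => match zmod_same a b with
    | true => constr:(O)
    | false => let n := zmod_index a l' in constr:(S n)
    end
  end.
Ltac zmod_atoms t l :=
  match t with
  | (?a + ?b)%R => let l' := zmod_atoms a l in zmod_atoms b l'
  | (- ?a)%R => zmod_atoms a l
  | (0)%R => l
  | _ => match zmod_mem t l with true => l | false => constr:(t :: l) end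
  end.
Ltac zmod_reify t l :=
  match t with
  | (?a + ?b)%R => let x := zmod_reify a l in let y := zmod_reify b l in constr:(ZAdd x y)
  | (- ?a)%R => let x := zmod_reify a l in constr:(ZOpp x)
  | (0)%R => constr:(ZZero)
  | _ => let n := zmod_index t l in constr:(ZVar n)
  end.
Ltac zmodule :=
  cbv beta; lazymatch goal with
  | |- @eq ?T ?a ?b =>
    let l := zmod_atoms a (@nil T) in
    let l := zmod_atoms b l in
    let x := zmod_reify a l in
    let y := zmod_reify b l in
    exact: (@zeval_eq _ l x y isT)
  end.

(** * Subgroups, and group topologies given by a base at zero *)

Definition subgroup (G : zmodType) (S : set G) : Prop :=
  S 0 /\ forall x y, S x -> S y -> S (x - y).

Section Subgroup.
Context (G : zmodType) (S : set G) (sS : subgroup S).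

Lemma subgroup0 : S 0. Proof. exact: sS.1. Qed.

Lemma subgroupB x y : S x -> S y -> S (x - y). Proof. exact: sS.2. Qed.

Lemma subgroupN x : S x -> S (- x).
Proof. by move=> Sx; rewrite -sub0r; apply: subgroupB => //; exact: subgroup0. Qed.

Lemma subgroupD x y : S x -> S y -> S (x + y).
Proof. by move=> Sx /subgroupN Sy; rewrite -[y]opprK; exact: subgroupB. Qed.

Lemma subgroupMn x n : S x -> S (x *+ n).
Proof.
by move=> Sx; elim: n => [|n IH]; rewrite ?mulr0n ?mulrS; [exact: subgroup0|exact: subgroupD].
Qed.

Lemma subgroupMz x (n : int) : S x -> S (x *~ n).
Proof.
by case: n => n Sx; [exact: subgroupMn|rewrite NegzE mulrNz; apply/subgroupN/subgroupMn].
Qed.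

Lemma subgroup_sum I (r : seq I) (P : pred I) (F : I -> G) :
  (forall i, P i -> S (F i)) -> S (\sum_(i <- r | P i) F i).
Proof.
move=> SF; elim/big_ind : _ => //; [exact: subgroup0|exact: subgroupD].
Qed.

End Subgroup.

Lemma subgroup_setT (G : zmodType) : subgroup [set: G]. Proof. by []. Qed.

(** The axioms of a base at zero. The one clause on differences stands for those on sums and
    inverses; separation is always stated apart. *)
Definition group_base (G : zmodType) (B : set (set G)) : Prop :=
  [/\ exists V, B V,
      forall U V, B U -> B V -> exists2 W, B W & W `<=` U `&` V,
      forall U, B U -> U 0
    & forall U, B U -> exists2 V, B V & forall x y, V x -> V y -> U (x - y)].

(** A copy of [G] tagged by [hB], so that it can carry the topology of [B] beside any topology that
    [G] already has. *)
Definition gtop (G : zmodType) (B : set (set G)) (hB : group_base B) : Type := G.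

Section GroupTopology.
Context (G : zmodType) (B : set (set G)) (hB : group_base B).
Local Notation T := (gtop hB).

HB.instance Definition _ := GRing.Zmodule.on T.

Definition gtop_nbhs (x : T) : set (set T) :=
  [set A | exists2 V, B V & forall y : G, V (y - x) -> A y].

HB.instance Definition _ := hasNbhs.Build T gtop_nbhs.

Let gtop_filter (x : T) : ProperFilter (gtop_nbhs x).
Proof.
have [[V0 BV0] BI B0 _] := hB; apply: Build_ProperFilter_ex => [A [V BV VA]|].
  by exists x; apply: VA; rewrite subrr; exact: B0.
split => [|A A' [V BV VA] [V' BV' VA']|A A' AA' [V BV VA]].
- by exists V0.
- have [W BW WV] := BI _ _ BV BV'.
  by exists W => // y /WV[Vy V'y]; split; [exact: VA|exact: VA'].
- by exists V => // y /VA/AA'.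
Qed.

Let gtop_singleton (x : T) (A : set T) : gtop_nbhs x A -> A x.
Proof. by case=> V BV VA; apply: VA; rewrite subrr; have [_ _ + _] := hB; exact. Qed.

Let gtop_nbhs_nbhs (x : T) (A : set T) :
  gtop_nbhs x A -> gtop_nbhs x (gtop_nbhs^~ A).
Proof.
case=> U BU UA; have [_ _ _ /(_ _ BU)[V BV VU]] := hB.
have [_ _ _ /(_ _ BV)[W BW WV]] := hB.
have B0 : forall U, B U -> U 0 by have [] := hB.
exists V => // y Vy; exists W => // z Wz; apply: UA.
have -> : z - x = (y - x) - (0 - (z - y)) by zmodule.
by apply: VU => //; apply: WV => //; exact: B0.
Qed.

HB.instance Definition _ :=
  Nbhs_isNbhsTopological.Build T gtop_filter gtop_singleton gtop_nbhs_nbhs.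

Let gtop_sub_continuous : continuous (fun x : T * T => x.1 - x.2).
Proof.
move=> [a b] A [U BU UA]; have [_ _ _ /(_ _ BU)[V BV VU]] := hB.
exists ([set y | V (y - a)], [set y | V (y - b)]) => /=.
  by split; exists V.
move=> [c d] /= [Vc Vd]; apply: UA => /=.
have -> : c - d - (a - b) = (c - a) - (d - b) by zmodule.
exact: VU.
Qed.

HB.instance Definition _ :=
  PreTopologicalNmodule_isTopologicalZmodule.Build T gtop_sub_continuous.

Lemma gtop_nbhs0 (A : set T) : nbhs (0 : T) A <-> exists2 V, B V & V `<=` A.
Proof.
by split=> -[V BV VA]; exists V => // y; [have := VA y|]; rewrite subr0; auto.
Qed.

End GroupTopology.

(** * Neighbourhoods of zero in a topological group *)

Section Neighborhoods.
Context (G : topologicalZmodType).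
Implicit Types (U V A : set G) (x y : G).

Lemma nbhs0_sub U : nbhs 0 U ->
  exists2 V, nbhs 0 V & forall x y, V x -> V y -> U (x - y).
Proof.
move=> U0; have : nbhs (0 - 0 : G) U by rewrite subr0.
move=> /(@sub_continuous G (0, 0)) [[V W] /= [V0 W0] VWU].
exists (V `&` W); first exact: filterI.
by move=> x y [Vx _] [_ Wy]; exact: (VWU (x, y)).
Qed.

Lemma nbhs0_0 U : nbhs 0 U -> U 0. Proof. exact: nbhs_singleton. Qed.

Lemma nbhs_shift x A : nbhs x A <-> nbhs 0 [set v | A (v + x)].
Proof.
split.
  rewrite -{1}[x]add0r => /(@add_continuous G (0, x)) [[V W] /= [V0 Wx] VWA].
  by apply: filterS V0 => v Vv; apply: (VWA (v, x)); split=> //; exact: nbhs_singleton.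
rewrite -{1}[0](subrr x) => /(@sub_continuous G (x, x)) [[V W] /= [Vx Wx] VWA].
apply: filterS Vx => v Vv; have := VWA (v, x) (conj Vv (nbhs_singleton Wx)).
by rewrite /= subrK.
Qed.

Lemma nbhs_subx x U : nbhs 0 U -> nbhs x [set y | U (y - x)].
Proof. by move=> U0; apply/nbhs_shift; apply: filterS U0 => v /=; rewrite addrK. Qed.

Lemma nbhs_xsub x U : nbhs 0 U -> nbhs x [set y | U (x - y)].
Proof.
move=> /nbhs0_sub[V V0 VU]; apply: filterS (nbhs_subx x V0) => y Vy.
by rewrite /= -opprB -sub0r; apply: VU => //; exact: nbhs0_0.
Qed.

Lemma nbhs0_add U : nbhs 0 U -> exists V,
  [/\ nbhs 0 V, forall x, V x -> V (- x), V `<=` U &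
      forall x y, V x -> V y -> U (x + y) /\ U (x - y)].
Proof.
move=> /nbhs0_sub[V V0 VU].
exists (V `&` [set x | V (- x)]); split.
- apply: filterI => //.
  by have := nbhs_xsub 0 V0; apply: filterS => y /=; rewrite sub0r.
- by move=> x [] ? ?; split=> //=; rewrite opprK.
- by move=> x [Vx _]; rewrite -[x]subr0; apply: VU => //; exact: nbhs0_0.
- move=> x y [Vx _] [Vy VNy]; split; first by rewrite -[y]opprK; exact: VU.
  exact: VU.
Qed.

Lemma nbhs0_sums U n : nbhs 0 U -> exists V,
  [/\ nbhs 0 V, forall x, V x -> V (- x), V `<=` U &
      forall f : nat -> G, (forall i, V (f i)) ->
      forall m, (m <= n)%N -> U (\sum_(i < m) f i)].
Proof.
elim: n U => [|n IH] U U0.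
  have [V [V0 VN VU _]] := nbhs0_add U0; exists V; split=> // f _ m.
  by rewrite leqn0 => /eqP ->; rewrite big_ord0; exact: nbhs0_0.
have [W [W0 WN WU WD]] := nbhs0_add U0; have [V [V0 VN VW Vs]] := IH _ W0.
exists V; split=> //; first by move=> x /VW/WU.
move=> f Vf [|m] mn; first by rewrite big_ord0; exact: nbhs0_0.
by rewrite big_ord_recr /=; apply: (WD _ _ _ _).1; [exact: Vs|exact: VW].
Qed.

Lemma nbhs0_muln U n : nbhs 0 U -> exists V,
  [/\ nbhs 0 V, forall x, V x -> V (- x), V `<=` U &
      forall x m, V x -> (m <= n)%N -> U (x *+ m)].
Proof.
move=> /(nbhs0_sums n)[V [V0 VN VU Vs]]; exists V; split=> // x m Vx mn.
by rewrite -[m in x *+ m]card_ord -sumr_const; apply: (Vs (fun=> x)).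
Qed.

Lemma closure_sub A x :
  closure A x <-> forall U, nbhs 0 U -> exists2 a, A a & U (a - x).
Proof.
split=> [clA U U0|h U Ux].
  by have [a [Aa Ua]] := clA _ (nbhs_subx x U0); exists a.
by have [a Aa Ua] := h _ ((nbhs_shift _ _).1 Ux); exists a; split=> //; move: Ua => /=; rewrite subrK.
Qed.

Lemma closure_sub' A x :
  closure A x <-> forall U, nbhs 0 U -> exists2 a, A a & U (x - a).
Proof.
split=> [/closure_sub clA U /nbhs0_add[V [V0 VN VU _]]|h].
  by have [a Aa /VN] := clA _ V0; rewrite opprB => /VU ?; exists a.
apply/closure_sub => U /nbhs0_add[V [V0 VN VU _]].
by have [a Aa /VN] := h _ V0; rewrite opprB => /VU ?; exists a.
Qed.

Lemma closure_subgroup A : subgroup A -> subgroup (closure A).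
Proof.
move=> sA; split; first by apply: subset_closure; exact: subgroup0.
move=> x y /closure_sub clx /closure_sub cly; apply/closure_sub => U /nbhs0_sub[V V0 VU].
have [a Aa Va] := clx _ V0; have [b Ab Vb] := cly _ V0.
exists (a - b); first exact: subgroupB.
have -> : a - b - (x - y) = (a - x) - (b - y) :> G by zmodule.
exact: VU.
Qed.

Lemma hausdorff_sep0 :
  hausdorff_space G <-> forall x, (forall U, nbhs 0 U -> U x) -> x = 0.
Proof.
split=> [hG x Ux|h x y].
  apply/esym/hG => A C A0 Cx; exists x; split; first exact: Ux.
  exact: nbhs_singleton.
move=> clxy; apply/eqP; rewrite -subr_eq0; apply/eqP/h => U /nbhs0_sub[V V0 VU].
have [z [Vz Vz']] := clxy _ _ (nbhs_xsub x V0) (nbhs_xsub y V0).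
have -> : x - y = (x - z) - (y - z) by zmodule.
exact: VU.
Qed.

Lemma nbhs0_neq x : hausdorff_space G -> x <> 0 -> exists2 U, nbhs 0 U & ~ U x.
Proof.
move=> /hausdorff_sep0 hG x0; apply: contrapT => nU; apply/x0/hG => U U0.
by apply: contrapT => nUx; apply: nU; exists U.
Qed.

Lemma cvg0P {T} (F : set_system T) {FF : Filter F} (f : T -> G) (l : G) :
  f @ F --> l <-> forall U, nbhs 0 U -> F [set t | U (f t - l)].
Proof.
split=> [fl U U0|h A /nbhs_shift/h FA]; first exact: (fl _ (nbhs_subx l U0)).
by apply: (@filterS _ F _ _ _ _ FA) => t /=; rewrite subrK.
Qed.

Lemma addl_open x A : open A -> open [set y | A (y + x)].
Proof.
rewrite !openE => oA y /= Ay; have /nbhs_shift h := oA _ Ay; apply/nbhs_shift.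
by apply: filterS h => v /=; rewrite addrA.
Qed.

End Neighborhoods.

(** * Covering by finitely many translates, total boundedness, completeness *)

Definition big (G : zmodType) (S U : set G) : Prop :=
  exists F : seq G, forall x, S x -> exists2 f, f \in F & U (x - f).

Section Big.
Context (G : zmodType).
Implicit Types S U V : set G.

Lemma bigW S S' U : S' `<=` S -> big S U -> big S' U.
Proof. by move=> SS [F h]; exists F => x /SS/h. Qed.

Lemma big_add S S' U V W :
  (forall u v, U u -> V v -> W (u + v)) -> big S U -> big S' V ->
  big [set x + y | x in S & y in S'] W.
Proof.
move=> UVW [F hF] [F' hF']; exists [seq f + g | f <- F, g <- F'].
move=> _ [x Sx [y Sy <-]]; have [f fF Uf] := hF _ Sx; have [g gF Vg] := hF' _ Sy.
exists (f + g); first exact: allpairs_f.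
have -> : x + y - (f + g) = (x - f) + (y - g) by zmodule.
exact: UVW.
Qed.

(* Moves the centres of the translates into [S]. *)
Lemma big_inside S U V : (forall x y, U x -> U y -> V (x - y)) -> big S U ->
  exists F : seq G, (forall f, f \in F -> S f) /\
    forall x, S x -> exists2 f, f \in F & V (x - f).
Proof.
move=> UV [F h].
suff [F' [F'S hF']] : exists F' : seq G, (forall f, f \in F' -> S f) /\
    forall x f, S x -> f \in F -> U (x - f) -> exists2 g, g \in F' & V (x - g).
  exists F'; split=> // x Sx; have [f fF Uf] := h _ Sx.
  exact: hF' Sx fF Uf.
elim: F {h} => [|f F [F' [F'S hF']]]; first by exists [::].
have [[y [Sy Uy]]|nex] := pselect (exists y, S y /\ U (y - f)).
  exists (y :: F'); split.
    by move=> z; rewrite inE => /predU1P[->//|/F'S].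
  move=> x g Sx; rewrite inE => /predU1P[-> Ux|gF Ux].
    exists y; first by rewrite inE eqxx.
    have -> : x - y = (x - f) - (y - f) by zmodule.
    exact: UV.
  by have [z zF Vz] := hF' _ _ Sx gF Ux; exists z => //; rewrite inE zF orbT.
exists F'; split=> // x g Sx; rewrite inE => /predU1P[-> Ux|].
  by exfalso; apply: nex; exists x.
by move=> gF Ux; exact: hF' Sx gF Ux.
Qed.

Lemma big_pigeonhole S U V (f : nat -> G) :
  (forall x y, U x -> U y -> V (x - y)) -> big S U -> (forall n, S (f n)) ->
  exists i j, (i < j)%N /\ V (f j - f i).
Proof.
move=> UV [F h] Sf; apply: contrapT => nex.
have /choice[g hg] : forall n, exists k, (k < size F)%N /\ U (f n - nth 0 F k).
  move=> n; have [z zF Uz] := h _ (Sf n); exists (index z F).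
  by rewrite index_mem nth_index.
pose g' (n : 'I_(size F).+1) : 'I_(size F) := Ordinal (hg n).1.
have /leq_card : injective g'.
  move=> i j gij; apply/eqP/negP => /negP nij; apply: nex.
  have {}gij : g i = g j by have /= := congr1 val gij.
  have VV i' j' : g i' = g j' -> V (f j' - f i').
    move=> e; have -> : f j' - f i' = (f j' - nth 0 F (g j')) - (f i' - nth 0 F (g i')).
      by rewrite e; zmodule.
    by apply: UV; exact: (hg _).2.
  have [ij|ji|/val_inj e] := ltngtP i j; last by rewrite e eqxx in nij.
    by exists i, j; split=> //; exact: VV.
  by exists j, i; split=> //; exact: VV.
by rewrite !card_ord ltnn.
Qed.

End Big.

Definition totally_bounded (G : topologicalZmodType) (S : set G) : Prop :=
  forall U, nbhs 0 U -> big S U.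

Section TotallyBounded.
Context (G : topologicalZmodType).
Implicit Types S U V : set G.

Lemma totally_boundedW S S' : S' `<=` S -> totally_bounded S -> totally_bounded S'.
Proof. by move=> SS h U U0; exact: bigW SS (h _ U0). Qed.

Lemma totally_bounded_add S S' : totally_bounded S -> totally_bounded S' ->
  totally_bounded [set x + y | x in S & y in S'].
Proof.
move=> hS hS' U /nbhs0_add[V [V0 _ _ VD]].
apply: (@big_add _ _ _ V V) (hS _ V0) (hS' _ V0) => u v Vu Vv.
exact: (VD _ _ Vu Vv).1.
Qed.

Lemma big_closure S U V : nbhs 0 V -> (forall x y, V x -> V y -> U (x + y)) ->
  big S V -> big (closure S) U.
Proof.
move=> V0 VU [F h]; exists F => x /closure_sub'/(_ _ V0)[a /h[f fF Vf] Va].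
exists f => //; have -> : x - f = (x - a) + (a - f) by zmodule.
exact: VU.
Qed.

Lemma totally_bounded_closure S : totally_bounded S -> totally_bounded (closure S).
Proof.
move=> hS U /nbhs0_add[V [V0 _ _ VD]].
by apply: (big_closure V0 _ (hS _ V0)) => u v Vu Vv; exact: (VD _ _ Vu Vv).1.
Qed.

Lemma totally_bounded_approx S :
  (forall U, nbhs 0 U -> exists2 S', totally_bounded S' &
     forall x, S x -> exists2 y, S' y & U (x - y)) -> totally_bounded S.
Proof.
move=> h U /nbhs0_add[V [V0 _ _ VD]]; have [S' bS' SS'] := h _ V0.
have [F hF] := bS' _ V0; exists F => x /SS'[y /hF[f fF Vf] Vy].
exists f => //; have -> : x - f = (x - y) + (y - f) by zmodule.
exact: (VD _ _ Vy Vf).1.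
Qed.

(** An ultrafilter that contains a finite union of translates contains one of them. *)
Lemma ultra_big S U V (F : set_system G) : (forall x y, U x -> U y -> V (x - y)) ->
  big S U -> UltraFilter F -> F S -> exists2 A, F A & forall x y, A x -> A y -> V (x - y).
Proof.
move=> UV [L hL] FU FS.
suff [f _ Ff] : exists2 f, f \in L & F [set x | U (x - f)].
  exists [set x | U (x - f)] => // x y Ux Uy.
  have -> : x - y = (x - f) - (y - f) by zmodule.
  exact: UV.
have : F [set x | exists2 f, f \in L & U (x - f)] by apply: filterS FS => x /hL.
elim: L {hL} => [|f L IH] FL.
  by exfalso; apply: (@filter_not_empty _ F); apply: filterS FL => x [].
have [Ff|Fn] := in_ultra_setVsetC [set x | U (x - f)] FU.
  by exists f; rewrite ?inE ?eqxx.
have [|g gL Fg] := IH.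
  apply: filterS (filterI FL Fn) => x [[g]]; rewrite inE => /predU1P[->//|gL Ug _].
  by exists g.
by exists g => //; rewrite inE gL orbT.
Qed.

Lemma ultra_totally_bounded S (F : set_system G) : totally_bounded S ->
  UltraFilter F -> F S -> forall U, nbhs 0 U -> exists2 A, F A & forall x y, A x -> A y -> U (x - y).
Proof.
by move=> bS FU FS U /nbhs0_sub[V V0 VU]; exact: ultra_big VU (bS _ V0) FU FS.
Qed.

Lemma compact_totally_bounded S : compact S -> totally_bounded S.
Proof.
move=> cS U U0; have [V [V0 VN VU VD]] := nbhs0_add U0.
apply: contrapT => nb.
pose D (F : seq G) := S `&` [set x | forall f, f \in F -> ~ U (x - f)].
have FF : ProperFilter (filter_from setT D).
  apply: filter_from_proper.
    apply: filter_fromT_filter; first by exists [::].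
    move=> F F'; exists (F ++ F') => x [Sx hx]; split; split=> // f fF;
    by apply: hx; rewrite mem_cat fF ?orbT.
  move=> F _; apply: contrapT => nD; apply: nb; exists F => x Sx.
  apply: contrapT => nU; apply: nD; exists x; split=> // f fF Uf.
  by apply: nU; exists f.
have [|x [Sx clx]] := cS _ FF; first by exists [::] => // y [].
have [|y [[_ /(_ x)]]] := clx (D [:: x]) _ _ (nbhs_subx x U0); first by exists [:: x].
by rewrite inE eqxx => /(_ isT).
Qed.

End TotallyBounded.

Definition complete_group (G : topologicalZmodType) : Prop :=
  forall F : set_system G, ProperFilter F ->
    (forall U, nbhs 0 U -> exists2 A, F A & forall x y, A x -> A y -> U (x - y)) ->
    exists l : G, F --> l.

Lemma closed_totally_bounded_compact (G : topologicalZmodType) (S : set G) :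
  complete_group G -> closed S -> totally_bounded S -> compact S.
Proof.
move=> cG clS bS; rewrite compact_ultra => F FU FS.
have [l Fl] := cG _ _ (ultra_totally_bounded bS FU FS).
exists l; split=> //; apply: clS => A Al.
have FA : F (S `&` A) by apply: filterI => //; exact: Fl.
by have [x [? ?]] := filter_ex FA; exists x.
Qed.

Lemma nbhs0S (G : topologicalZmodType) (U V : set G) :
  U `<=` V -> nbhs (0 : G) U -> nbhs (0 : G) V.
Proof. exact: filterS. Qed.

Lemma nbhs0I (G : topologicalZmodType) (U V : set G) :
  nbhs (0 : G) U -> nbhs (0 : G) V -> nbhs (0 : G) (U `&` V).
Proof. exact: filterI. Qed.

(* Every Hausdorff group topology coarser than that of [G], given by a base of
   neighbourhoods of zero, is that of [G]. *)
Definition minprop (G : topologicalZmodType) : Prop :=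
  forall B : set (set G), group_base B -> (forall V, B V -> nbhs (0 : G) V) ->
  (forall x, (forall V, B V -> V x) -> x = 0) ->
  forall U, nbhs (0 : G) U -> exists2 V, B V & V `<=` U.

Lemma minimal_minprop (G : topologicalZmodType) : minimal_group G -> minprop G.
Proof.
move=> [_ minG] B hB BG B0 U U0; apply: contrapT => nV; apply: minG.
exists (Topological.class (gtop hB)); split.
- by split; [exact: (@add_continuous (gtop hB))|exact: (@opp_continuous (gtop hB))].
- apply: (iffRL (hausdorff_sep0 (gtop hB))) => x Ux; apply: B0 => V BV; apply: Ux.
  by apply/gtop_nbhs0; exists V.
- split=> [A|h].
    rewrite (@openE (gtop hB)) (@openE G) => oA x /oA[V BV VA].
    by apply: filterS (nbhs_subx x (BG _ BV)) => y /VA.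
  have := h _ (open_interior U); rewrite (@openE (gtop hB)) => /(_ 0) h'.
  have /gtop_nbhs0[V BV VU] : nbhs (0 : gtop hB) U^° by apply: h'.
  by apply: nV; exists V => // x /VU/nbhs_singleton.
Qed.

(** * Minimality of powers and of dense extensions *)

Section Power.
Context (G : topologicalZmodType).
Local Notation P := (prod_topology (fun _ : nat => G)).

Lemma prod_proj_nbhs {I : Type} (T : I -> topologicalZmodType) (i : I) (U : set (T i)) :
  nbhs 0 U -> nbhs (0 : prod_topology T) [set x | U (x i)].
Proof.
move=> U0; have /cvg_sup/(_ i) : nbhs (0 : prod_topology T) --> (0 : prod_topology T) by exact: cvg_id.
by apply; apply: (@initial_continuous _ _ (fun g : prod_topology T => g i)).
Qed.

Lemma power_nbhs n (U : set G) : nbhs 0 U ->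
  nbhs (0 : P) [set x | forall i, (i < n)%N -> U (x i)].
Proof.
move=> U0; elim: n => [|n IH]; first by apply: (@filterS _ (nbhs (0 : P)) _ setT) => //; exact: filterT.
apply: (nbhs0S _ (nbhs0I IH (@prod_proj_nbhs nat (fun=> G) n U U0))) => x [h Ux] i; rewrite ltnS leq_eqVlt => /predU1P[->//|]; exact: h.
Qed.

Lemma power_nbhsP (A : set P) : nbhs (0 : P) A ->
  exists n (U : set G), nbhs 0 U /\ forall x : P, (forall i, (i < n)%N -> U (x i)) -> A x.
Proof.
pose D (nU : nat * set G) : set P := [set x | forall i, (i < nU.1)%N -> nU.2 (x i)].
pose F : set_system P := filter_from [set nU | nbhs (0 : G) nU.2] D.
have FF : Filter F.
  apply: filter_from_filter; first by exists (0%N, setT); exact: filterT.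
  move=> [n U] [m V] /= U0 V0; exists (maxn n m, U `&` V); first exact: filterI.
  move=> x Dx; split=> i /= ii;
  by have [] := Dx i _; rewrite // leq_max /= ii ?orbT.
have : F --> (0 : P).
  apply/cvg_sup => i C; rewrite nbhsE => -[_ [[W oW <-] Wx] WC].
  exists (i.+1, W); first exact: open_nbhs_nbhs.
  by move=> x Dx; apply: WC; exact: Dx (ltnSn i).
by move=> h /h[[n U] /= U0 UA]; exists n, U; split.
Qed.

(** A coarser topology on [G] induces a coarser product topology on the power. Minimality there is
    applied to coordinate 0, and constant sequences bring the result back to [G]. *)
Lemma minprop_power : minprop P -> minprop G.
Proof.
move=> mP B hB BG B0 U U0.
have [[V0 BV0] BI Bz Bs] := hB.
pose D n V : set P := [set x | forall i, (i < n)%N -> V (x i)].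
pose B' : set (set P) := [set A | exists n V, B V /\ A = D n V].
have hB' : group_base B'.
  split.
  - by exists (D 0%N V0), 0%N, V0.
  - move=> _ _ [n [V [BV ->]]] [m [W [BW ->]]]; have [X BX XVW] := BI _ _ BV BW.
    exists (D (maxn n m) X); first by exists (maxn n m), X.
    by move=> x Dx; split=> i ii; have [|] := XVW _ (Dx i _); rewrite ?leq_max ?ii ?orbT.
  - by move=> _ [n [V [BV ->]]] i _; exact: Bz.
  - move=> _ [n [V [BV ->]]]; have [W BW WV] := Bs _ BV.
    exists (D n W); first by exists n, W.
    by move=> x y Dx Dy i ii; apply: WV; [exact: Dx|exact: Dy].
have [|x Vx|_ [n [V [BV ->]]] VU] := mP B' hB' _ _ _ (@prod_proj_nbhs nat (fun=> G) 0%N U U0).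
- by move=> _ [n [V [BV ->]]]; apply: power_nbhs; exact: BG.
- apply: functional_extensionality_dep => i; apply: B0 => V BV.
  by apply: (Vx (D i.+1 V)) => //; exists i.+1, V.
- by exists V => // v Vv; apply: (VU (fun=> v)).
Qed.

End Power.

Section Dense.
Context (G H : topologicalZmodType) (f : {additive G -> H}).

Definition dense_embedding : Prop :=
  [/\ injective f,
      forall W, nbhs (0 : H) W -> nbhs (0 : G) [set x | W (f x)],
      forall U, nbhs (0 : G) U ->
        exists2 W, nbhs (0 : H) W & forall x, W (f x) -> U x
    & forall h W, nbhs (0 : H) W -> exists g, W (h - f g)].

Hypothesis df : dense_embedding.

(** A coarser topology on [H] restricts along [f] to one on [G], where it is the original one. To
    return to [H], a point is approximated by some [f g] in the original topology, hence in both. *)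
Lemma minprop_dense : minprop G -> minprop H.
Proof.
have [fI fc fo fd] := df; move=> mG B hB BH B0 U U0.
have [U1 [U10 _ _ U1U]] := nbhs0_add U0; have [[V0 BV0] BI Bz Bs] := hB.
pose D V := [set x : G | V (f x)].
have hB' : group_base [set A | exists2 V, B V & A = D V].
  split.
  - by exists (D V0), V0.
  - move=> _ _ [V BV ->] [W BW ->]; have [X BX XVW] := BI _ _ BV BW.
    by exists (D X); [exists X|move=> x /XVW].
  - by move=> _ [V BV ->]; rewrite /D /= raddf0; exact: Bz.
  - move=> _ [V BV ->]; have [W BW WV] := Bs _ BV.
    by exists (D W); [exists W|move=> x y Wx Wy; rewrite /D /= raddfB; exact: WV].
have [|x Vx|_ [V BV ->] VU] := mG _ hB' _ _ _ (fc _ U10).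
- by move=> _ [V BV ->]; apply: fc; exact: BH.
- by apply: fI; rewrite raddf0; apply: B0 => V BV; apply: (Vx (D V)); exists V.
have [W BW WV] := Bs _ BV; exists W => // x Wx.
have [g [Wg Ug]] := fd x _ (filterI (BH _ BW) U10).
have -> : x = (x - f g) + f g by zmodule.
apply: (U1U _ _ Ug _).1; apply: VU; rewrite /D /=.
have -> : f g = x - (x - f g) by zmodule.
exact: WV.
Qed.

Local Notation PG := (prod_topology (fun _ : nat => G)).
Local Notation PH := (prod_topology (fun _ : nat => H)).

Definition power_map (x : PG) : PH := fun i => f (x i).

Lemma power_map_is_additive : zmod_morphism power_map.
Proof. by move=> x y; apply: functional_extensionality_dep => i; exact: raddfB. Qed.

HB.instance Definition _ := GRing.isZmodMorphism.Build PG PH power_map power_map_is_additive.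

End Dense.

Lemma dense_embedding_power (G H : topologicalZmodType) (f : {additive G -> H}) :
  dense_embedding f -> dense_embedding (power_map f).
Proof.
case=> fI fc fo fd; split.
- move=> x y xy; apply: functional_extensionality_dep => i; apply: fI.
  exact: (congr1 (fun z => z i) xy).
- move=> W /power_nbhsP[n [U [U0 UW]]]; apply: (nbhs0S _ (power_nbhs n (fc _ U0))) => x h.
  by apply: UW => i /h.
- move=> U /power_nbhsP[n [V [V0 VU]]]; have [W W0 WV] := fo _ V0.
  exists [set x | forall i, (i < n)%N -> W (x i)]; first exact: power_nbhs.
  by move=> x h; apply: VU => i /h/WV.
- move=> h W /power_nbhsP[n [U [U0 UW]]].
  have /choice[g hg] : forall i, exists g, U (h i - f g) by move=> i; exact: fd.
  by exists g; apply: UW => i _; exact: hg.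
Qed.

(** * Minimality makes multiples nearly totally bounded *)

Lemma seq_recursive_choice (T : Type) (Q : seq T -> T -> Prop) :
  (forall s, exists t, Q s t) -> exists x : nat -> T, forall n, Q (mkseq x n) (x n).
Proof.
move=> /choice[c hc].
pose s := fix s n := if n is m.+1 then rcons (s m) (c (s m)) else [::].
exists (fun n => c (s n)) => n.
suff -> : mkseq (fun n => c (s n)) n = s n by exact: hc.
by elim: n => // n IH; rewrite mkseqS IH.
Qed.

(** In the spirit of B. H. Neumann's lemma on coverings by cosets. If the differences of [A n] are
    not big, some [g] avoids their translates by all [f' - f]; then [x] and [x + g] cannot both be
    covered through [A n], so the sets of smaller index cover once [g] has been used to enlarge the
    list of centres. *)
Lemma big_cover (G : zmodType) (A : nat -> set G) (n : nat) (F : seq G) :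
  (forall x, exists2 f, f \in F & exists2 i, (i < n)%N & A i (x - f)) ->
  exists2 i, (i < n)%N & big setT [set a - b | a in A i & b in A i].
Proof.
elim: n F => [|n IH] F cov; first by have [f _ [i]] := cov 0.
have [bn|nbn] := pselect (big setT [set a - b | a in A n & b in A n]); first by exists n.
have [g hg] : exists g, forall f, f \in [seq f - f' | f <- F, f' <- F] ->
    ~ [set a - b | a in A n & b in A n] (g - f).
  apply: contrapT => ng; apply: nbn; exists [seq f - f' | f <- F, f' <- F] => x _.
  apply: contrapT => nx; apply: ng; exists x => f fF hf; apply: nx; by exists f.
have [|i ilt bi] := IH (F ++ [seq f - g | f <- F]); last by exists i => //; exact: ltnW.
move=> x; have [f fF [i ilt Af]] := cov x.
move: ilt; rewrite ltnS leq_eqVlt => /predU1P[ei|ilt]; last first.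
  by exists f; [rewrite mem_cat fF|exists i].
have [f' f'F [j jlt Af']] := cov (x + g).
move: jlt; rewrite ltnS leq_eqVlt => /predU1P[ej|jlt].
  exfalso; apply: (hg (f' - f)); first exact: allpairs_f.
  rewrite ej in Af'; rewrite ei in Af.
  by exists (x + g - f') => //; exists (x - f) => //; zmodule.
exists (f' - g); first by rewrite mem_cat; apply/orP; right; apply/mapP; exists f'.
by exists j => //; have -> : x - (f' - g) = x + g - f' by zmodule.
Qed.

Section BoundedCombinations.
Context (G : zmodType).

(** The coefficient [c - 2 ^ n] runs over all integers of absolute value at most [2 ^ n]; thus
    [bcomb x n] lists the combinations of the first [n] terms with [i]-th coefficient bounded by
    [2 ^ i]. *)
Definition bcomb_step (s : seq G) (x : G) (n : nat) : seq G :=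
  [seq f + x *~ (c%:Z - (2 ^ n)%:Z) | f <- s, c <- iota 0 (2 ^ n.+1).+1].

Fixpoint bcomb (x : nat -> G) (n : nat) : seq G :=
  if n is m.+1 then bcomb_step (bcomb x m) (x m) m else [:: 0].

Lemma bcombP (x : nat -> G) n (c : nat -> int) :
  (forall i, (`|c i| <= 2 ^ i)%N) -> \sum_(i < n) x i *~ c i \in bcomb x n.
Proof.
move=> hc; elim: n => [|n IH]; first by rewrite big_ord0 inE.
rewrite big_ord_recr /=.
have -> : c n = (absz (c n + (2 ^ n)%:Z))%:Z - (2 ^ n)%:Z by have := hc n; lia.
apply: allpairs_f => //; rewrite mem_iota /= add0n expnS; have := hc n; lia.
Qed.

Lemma eq_bcomb (x y : nat -> G) n : (forall i, (i < n)%N -> x i = y i) -> bcomb x n = bcomb y n.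
Proof.
elim: n => //= n IH xy; rewrite IH ?xy// => i ilt; apply: xy; exact: ltnW.
Qed.

End BoundedCombinations.

Section MinimalMultiples.
Context (G : topologicalZmodType) (hG : hausdorff_space G) (mG : minprop G).

(** Combinations of the terms from index [m] on. The bound on coefficients doubles when [m] drops by
    one, which makes [W x m.+1 - W x m.+1] lie in [W x m]; and [x m] itself belongs to [W x m], so
    these sets force [x] to tend to zero. *)
Let W (x : nat -> G) (m : nat) : set G :=
  [set v | exists n (c : nat -> int), [/\ forall i, (i < m)%N || (n <= i)%N -> c i = 0,
     forall i, (`|c i| <= 2 ^ (i - m))%N & v = \sum_(i < n) x i *~ c i]].

Let sum_widen (x : nat -> G) (c : nat -> int) n N : (n <= N)%N ->
  (forall i, (n <= i)%N -> c i = 0) -> \sum_(i < n) x i *~ c i = \sum_(i < N) x i *~ c i.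
Proof.
move=> nN c0; rewrite (big_ord_widen N (fun i => x i *~ c i)) // [RHS](bigID (fun i : 'I_N => (i < n)%N)) /=.
by rewrite [X in _ = _ + X]big1 ?addr0// => i; rewrite -leqNgt => /c0 ->; rewrite mulr0z.
Qed.

Let W_sub x m u v : W x m.+1 u -> W x m.+1 v -> W x m (u - v).
Proof.
move=> [n [c [c0 cb ->]]] [n' [c' [c'0 c'b ->]]].
have c0n i : (n <= i)%N -> c i = 0 by move=> h; rewrite c0 ?h ?orbT.
have c0n' i : (n' <= i)%N -> c' i = 0 by move=> h; rewrite c'0 ?h ?orbT.
exists (n + n')%N, (fun i => c i - c' i); split.
- move=> i /orP[im|ni]; first by rewrite c0 ?c'0 ?subr0 // (ltn_trans im).
  by rewrite c0n ?c0n' ?subr0; lia.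
- move=> i; have := cb i; have := c'b i.
  have [im|mi] := ltnP i m.+1; first by rewrite c0 ?c'0 ?im.
  have -> : (i - m = (i - m.+1).+1)%N by lia.
  rewrite expnS; lia.
- rewrite (sum_widen x (leq_addr n' n) c0n) (sum_widen x (leq_addl n n') c0n') -sumrB.
  by apply: eq_bigr => i _; rewrite mulrzBr.
Qed.

Let W_le x m m' : (m <= m')%N -> W x m' `<=` W x m.
Proof.
move=> mm _ [n [c [c0 cb ->]]]; exists n, c; split=> // i.
  by move=> h; apply: c0; case/orP: h => [im|->]; rewrite ?orbT // (leq_trans im mm).
by apply: (leq_trans (cb i)); rewrite leq_exp2l// leq_sub2l.
Qed.

Let W0 x m : W x m 0.
Proof. by exists 0%N, (fun=> 0); split=> //; rewrite big_ord0. Qed.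

(* Otherwise one can force a sequence [x n] that stays away from zero to converge
   to zero in a coarser Hausdorff group topology. *)
Lemma minprop_multiples_big U : nbhs 0 U ->
  exists2 k, (0 < k)%N & big [set x *+ k | x in [set: G]] U.
Proof.
move=> U0; apply: contrapT => nbig.
have [U1 U10 U1U] := nbhs0_sub U0.
pose Q (s : seq G) (t : G) := forall c : int, c <> 0 -> (`|c| <= 2 ^ size s)%N ->
  forall f, f \in bcomb (nth 0 s) (size s) -> ~ U1 (t *~ c - f).
(* If every [t] failed, [G] would be the union of the finitely many sets of [t] with [t *~ c - f] in
   [U1]. By [big_cover] one of their difference sets is big, and multiplying by [c] gives a big set
   of multiples. *)
have exQ s : exists t, Q s t.
  apply: contrapT => nex.
  set F := bcomb (nth 0 s) (size s); set N := (2 ^ size s)%N.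
  pose cs := [seq (c.+1%:Z : int) | c <- iota 0 N] ++ [seq - (c.+1%:Z : int) | c <- iota 0 N].
  pose L := [seq (c, f) | c <- cs, f <- F].
  pose A i := let cf := nth (0, 0) L i in [set t : G | U1 (t *~ cf.1 - cf.2)].
  have [|i ilt bA] := @big_cover G A (size L) [:: 0].
    move=> t; exists 0; first by rewrite inE.
    apply: contrapT => nt; apply: nex; exists t => c c0 cN f fF Ut; apply: nt.
    have cL : (c, f) \in L.
      apply: allpairs_f => //; rewrite mem_cat; apply/orP.
      case: c c0 cN {Ut} => [[|c]|c] // _ cN; [left|right; rewrite NegzE];
        by apply/mapP; exists c => //; rewrite mem_iota.
    exists (index (c, f) L); first by rewrite index_mem.
    by rewrite /A /= nth_index// subr0.
  have : nth (0, 0) L i \in L by rewrite mem_nth.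
  move: bA; rewrite /A; case: (nth _ _ _) => c f /= [F' hF'] /allpairsP[[c' f'] /= [c'cs _ [ec _]]].
  have c0 : c <> 0.
    by rewrite ec; move: c'cs; rewrite mem_cat => /orP[] /mapP[d _ ->]; lia.
  apply: nbig; exists `|c|%N; first by lia.
  have hc (x : G) : x *+ `|c| = x *~ c \/ x *+ `|c| = - (x *~ c).
    case: (c) => n; [by left|right]; by rewrite NegzE mulrNz opprK.
  have U1U' (x y : G) : U1 (x *~ c - f) -> U1 (y *~ c - f) -> U ((x - y) *+ `|c|).
    move=> Ux Uy; have [->|->] := hc (x - y).
      have -> : (x - y) *~ c = (x *~ c - f) - (y *~ c - f) by rewrite mulrzBl; zmodule.
      exact: U1U.
    have -> : - ((x - y) *~ c) = (y *~ c - f) - (x *~ c - f) by rewrite mulrzBl; zmodule.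
    exact: U1U.
  exists [seq f *+ `|c| | f <- F'] => _ [x _ <-].
  have [g gF [a Aa [b Ab eab]]] := hF' x I; exists (g *+ `|c|); first exact: map_f.
  by rewrite -mulrnBl -eab; exact: U1U'.
have [x hx] := seq_recursive_choice exQ.
have {}hx n (c : int) f : c <> 0 -> (`|c| <= 2 ^ n)%N -> f \in bcomb x n -> ~ U1 (x n *~ c - f).
  move=> c0 cn fn; have := hx n c c0; rewrite size_mkseq => /(_ cn f); apply.
  by rewrite (@eq_bcomb _ _ x)// => i ilt; rewrite nth_mkseq.
pose B : set (set G) := [set A | exists V m, nbhs (0 : G) V /\ A = [set u + v | u in V & v in W x m]].
have hB : group_base B.
  split.
  - by exists [set u + v | u in setT & v in W x 0], setT, 0%N; split=> //; exact: filterT.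
  - move=> _ _ [V [m [V0 ->]]] [V' [m' [V'0 ->]]].
    exists [set u + v | u in V `&` V' & v in W x (maxn m m')].
      by exists (V `&` V'), (maxn m m'); split=> //; exact: filterI.
    move=> _ [u [Vu V'u] [v Wv <-]]; split; exists u => //; exists v => //;
    by apply: W_le Wv; rewrite ?leq_maxl ?leq_maxr.
  - move=> _ [V [m [V0 ->]]]; exists 0; first exact: nbhs0_0.
    by exists 0; rewrite ?addr0.
  - move=> _ [V [m [V0 ->]]]; have [V' V'0 V'V] := nbhs0_sub V0.
    exists [set u + v | u in V' & v in W x m.+1]; first by exists V', m.+1.
    move=> _ _ [u V'u [v Wv <-]] [u' V'u' [v' Wv' <-]].
    exists (u - u'); first exact: V'V.
    by exists (v - v'); [exact: W_sub|zmodule].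
have BG V : B V -> nbhs 0 V.
  by move=> [V' [m [V'0 ->]]]; apply: filterS V'0 => u V'u; exists u => //; exists 0; rewrite ?addr0.
(* The base set [V' + W x m] contains [x m], which [hx] with coefficient 1 and [f = 0] keeps out of
   [U1]. What then remains is the Hausdorff property. *)
have [|V [V' [m [V'0 ->]]] VU1] := mG hB BG _ U10; last first.
  apply: (hx m 1 0) => //; first by rewrite absz1 expn_gt0.
    by have := @bcombP G x m (fun=> 0); rewrite big1 => [|i _]; [apply|rewrite mulr0z].
  rewrite mulr1z subr0; apply: VU1; exists 0; first exact: nbhs0_0.
  exists (x m); last by rewrite add0r.
  exists m.+1, (fun i => if i == m then 1 else 0); split.
  - by move=> i; case: eqP => // ->; lia.
  - by move=> i; case: eqP => // ->; rewrite subnn.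
  - rewrite big_ord_recr /= eqxx mulr1z big1 ?add0r// => i _.
    by rewrite ltn_eqF ?mulr0z//; exact: ltn_ord.
move=> g Bg; apply: contrapT => g0.
have [V V0 ngV] := nbhs0_neq hG g0.
have [V1 V10 V1U] := nbhs0_sub U10.
have VV1 : nbhs 0 (V `&` V1) by exact: filterI.
(* Two representations of [g], the second using only terms beyond those of the first. Since [g] is
   not in [V], the second has a last nonzero coefficient, at [t]; subtracting the two puts a
   multiple of [x t] within [U1] of a combination of earlier terms. *)
have [|u [Vu V1u] [_ [n [c [c0 cb ->]]] eg]] := Bg [set u + v | u in V `&` V1 & v in W x 0].
  by exists (V `&` V1), 0%N.
have [|u' [Vu' V1u'] [_ [n' [c' [c'0 c'b ->]]] eg']] := Bg [set u + v | u in V `&` V1 & v in W x n].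
  by exists (V `&` V1), n.
have [[i0 hi0]|nex] := pselect (exists i, (i < n')%N && (c' i != 0)); last first.
  apply: ngV; rewrite -eg' big1 ?addr0// => i _.
  have -> : c' i = 0 by apply/eqP/negPn/negP => ci; apply: nex; exists i; rewrite ltn_ord.
  by rewrite mulr0z.
have [t /andP[tn' /eqP ct] tmax] := @ex_maxnP (fun i => (i < n')%N && (c' i != 0)) n'
  (ex_intro _ i0 hi0) (fun i h => ltnW (proj1 (andP h))).
have c't i : (t < i)%N -> c' i = 0.
  move=> ti; have [ni|ni] := leqP n' i; first by rewrite c'0 ?ni ?orbT.
  by apply/eqP/negPn/negP => ci; have := tmax i; rewrite ni ci => /(_ isT); lia.
have nt : (n <= t)%N by rewrite leqNgt; apply/negP => tn; apply: ct; rewrite c'0 ?tn.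
have c0n i : (n <= i)%N -> c i = 0 by move=> h; rewrite c0 ?h.
apply: (hx t (c' t) (\sum_(i < t) x i *~ (c i - c' i))) => //.
- by apply: leq_trans (c'b t) _; rewrite leq_exp2l// leq_subr.
- apply: (@bcombP G x t (fun i => c i - c' i)) => i; have := cb i; have := c'b i; rewrite subn0.
  have [ni|ni] := leqP n i; last by rewrite (c'0 i) ?ni// subr0.
  rewrite (c0n _ ni) sub0r abszN => h _; apply: leq_trans h _.
  by rewrite leq_exp2l// leq_subr.
have := congr2 (fun a b => a - b) eg eg'; rewrite subrr.
rewrite (sum_widen x nt c0n) -(@sum_widen x c' t.+1 n' tn' c't) big_ord_recr /= => e.
have -> : x t *~ c' t - \sum_(i < t) x i *~ (c i - c' i) = u - u'.
  have -> : \sum_(i < t) x i *~ (c i - c' i) = \sum_(i < t) x i *~ c i - \sum_(i < t) x i *~ c' i.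
    by rewrite -sumrB; apply: eq_bigr => i _; rewrite mulrzBr.
  move: e; set a := \sum_(i < t) x i *~ c i; set b := \sum_(i < t) x i *~ c' i.
  set y := x t *~ c' t => e.
  have -> : u = (u + a - (u' + (b + y))) + (u' + b + y - a) by zmodule.
  by rewrite e; zmodule.
exact: V1U.
Qed.

End MinimalMultiples.

(** * Quotients and the completion *)

Lemma sub_setI (T : Type) (A B C : set T) : A `<=` B `&` C -> A `<=` B /\ A `<=` C.
Proof. by rewrite subsetI. Qed.

Section QuotientTheory.
Context (G : topologicalZmodType) (N : zmodClosed G).
Local Notation Q := (quotient_group N).

Definition qpi (x : G) : Q := (\pi_(Quotient.quot N) x)%qT.

Lemma qpi_eq x y : qpi x = qpi y <-> x - y \in N.
Proof. by rewrite Quotient.idealrBE; split=> [e|/eqP//]; exact/eqP. Qed.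

Lemma qpi_surj (q : Q) : exists x, qpi x = q.
Proof. by exists (repr (q : Quotient.quot N)); exact: reprK. Qed.

Lemma qpi_is_additive : zmod_morphism qpi.
Proof. by move=> x y; rewrite /qpi Quotient.pi_add Quotient.pi_opp. Qed.

HB.instance Definition _ := GRing.isZmodMorphism.Build G Q qpi qpi_is_additive.

Lemma qpi0 x : qpi x = 0 <-> x \in N.
Proof. by rewrite -[X in _ = X](raddf0 qpi) qpi_eq subr0. Qed.

Lemma qpi_nbhs (A : set Q) : nbhs (0 : Q) A <-> nbhs (0 : G) [set x | A (qpi x)].
Proof.
split=> [|U0].
  by rewrite -[in X in X -> _](raddf0 qpi) => /(pi_continuous (Q0 := Quotient.quot N)).
suff : nbhs (0 : Q) (qpi @` [set x | A (qpi x)]).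
  by apply: filterS => _ [x Ax <-].
rewrite nbhsE; exists (qpi @` [set x | A (qpi x)]°) => //; last first.
  by move=> _ [x /nbhs_singleton Ax <-]; exists x.
split; last by exists 0; rewrite ?raddf0//; exact: nbhs_interior.
rewrite /open/= /quotient_open.
have -> : \pi_(Quotient.quot N)%qT @^-1` (qpi @` [set x | A (qpi x)]°) =
    \bigcup_(n in [set n | n \in N]) [set y | [set x | A (qpi x)]° (y + n)].
  apply/seteqP; split=> [y [x Ax /qpi_eq xyN]|y [n nN An]].
    by exists (x - y) => //=; rewrite addrC subrK.
  by exists (y + n) => //; apply/qpi_eq; rewrite addrAC subrr add0r.
by apply: bigcup_open => n _; apply: addl_open; exact: open_interior.
Qed.

Lemma quotient_hausdorff : closed [set x : G | x \in N] -> hausdorff_space Q.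
Proof.
move=> clN; apply/hausdorff_sep0 => q Uq; have [x xq] := qpi_surj q.
rewrite -xq; apply/qpi0; apply: clN; apply/closure_sub' => U U0.
have [|u Uu uq] := Uq (qpi @` U); first by apply/qpi_nbhs; apply: filterS U0 => u; exists u.
exists (x - u); last by have -> : x - (x - u) = u by zmodule.
by apply/qpi_eq; rewrite xq uq.
Qed.

End QuotientTheory.

Section Completion.
Context (G : topologicalZmodType).
Implicit Types (U V W : set G).

(** Nets indexed by subsets of [G], of which only the neighbourhoods of zero count, directed by
    reverse inclusion. One index set suffices for completeness, as a Cauchy filter needs one chosen
    point for each neighbourhood. *)
Definition eventually_in W (x : set G -> G) : Prop :=
  exists2 U0, nbhs (0 : G) U0 & forall U, nbhs (0 : G) U -> U `<=` U0 -> W (x U).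

Definition cauchy_net (x : set G -> G) : Prop := forall W, nbhs (0 : G) W ->
  exists2 U0, nbhs (0 : G) U0 & forall U V, nbhs (0 : G) U -> nbhs (0 : G) V ->
    U `<=` U0 -> V `<=` U0 -> W (x U - x V).

Definition cauchy_pred : {pred (set G -> G)} := fun x => `[< cauchy_net x >].

Fact cauchy_pred_closed : zmod_closed cauchy_pred.
Proof.
split=> [|x y /asboolP cx /asboolP cy]; apply/asboolP => W W0.
  by exists W => // U V _ _ _ _; rewrite subr0; exact: nbhs0_0.
have [V V0 VW] := nbhs0_sub W0; have [U1 U10 h1] := cx _ V0; have [U2 U20 h2] := cy _ V0.
exists (U1 `&` U2); first exact: filterI.
move=> U U' U0 U'0 /sub_setI[UU1 UU2] /sub_setI[UU1' UU2'].
have -> : (x - y) U - (x - y) U' = (x U - x U') - (y U - y U').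
  by rewrite !fctE; zmodule.
by apply: VW; [exact: h1|exact: h2].
Qed.

HB.instance Definition _ := GRing.isZmodClosed.Build _ cauchy_pred cauchy_pred_closed.

Definition cnet : Type := {x : set G -> G | x \in cauchy_pred}.
HB.instance Definition _ := SubChoice.on cnet.
HB.instance Definition _ := [SubChoice_isSubZmodule of cnet by <:].

Definition cnet_base : set (set cnet) :=
  [set A | exists2 W, nbhs (0 : G) W & A = [set x | eventually_in W (val x)]].

Lemma cnet_group_base : group_base cnet_base.
Proof.
split.
- by exists [set x | eventually_in setT (val x)], setT => //; exact: filterT.
- move=> _ _ [W W0 ->] [W' W'0 ->].
  exists [set x | eventually_in (W `&` W') (val x)]; first by exists (W `&` W') => //; exact: filterI.
  by move=> x [U0 nU0 h]; split; exists U0 => // U nU UU; have [] := h _ nU UU.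
- move=> _ [W W0 ->]; exists setT; first exact: filterT.
  by move=> U _ _; rewrite raddf0; exact: nbhs0_0.
- move=> _ [W W0 ->]; have [V V0 VW] := nbhs0_sub W0.
  exists [set x | eventually_in V (val x)]; first by exists V.
  move=> x y [U1 U10 h1] [U2 U20 h2]; exists (U1 `&` U2); first exact: filterI.
  move=> U U0 /sub_setI[UU1 UU2]; rewrite raddfB !fctE.
  by apply: VW; [exact: h1|exact: h2].
Qed.

Local Notation net := (gtop cnet_group_base).

Definition null_pred : {pred net} :=
  fun x => `[< forall W, nbhs (0 : G) W -> eventually_in W (val (x : cnet)) >].

Fact null_pred_closed : zmod_closed null_pred.
Proof.
split=> [|x y /asboolP cx /asboolP cy]; apply/asboolP => W W0.
  exists setT; first exact: filterT.
  by move=> U _ _; rewrite raddf0; exact: nbhs0_0.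
have [V V0 VW] := nbhs0_sub W0; have [U1 U10 h1] := cx _ V0; have [U2 U20 h2] := cy _ V0.
exists (U1 `&` U2); first exact: filterI.
move=> U U0 /sub_setI[UU1 UU2]; rewrite (raddfB (val : cnet -> _)) !fctE.
by apply: VW; [exact: h1|exact: h2].
Qed.

HB.instance Definition _ := GRing.isZmodClosed.Build _ null_pred null_pred_closed.

Definition completion : topologicalZmodType := quotient_group null_pred.
Local Notation K := completion.
Local Notation pi := (@qpi net null_pred : net -> K).

Lemma completion_nbhs (A : set K) : nbhs (0 : K) A <->
  exists2 W, nbhs (0 : G) W & forall x : net, eventually_in W (val (x : cnet)) -> A (pi x).
Proof.
rewrite qpi_nbhs gtop_nbhs0; split=> [[_ [W W0 ->] WA]|[W W0 WA]].
  by exists W => // x /WA.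
by exists [set x | eventually_in W (val x)]; [exists W|move=> x /WA].
Qed.

Lemma completion_hausdorff : hausdorff_space K.
Proof.
apply: quotient_hausdorff => x /closure_sub' clx; apply/asboolP => W W0.
have [V [V0 _ _ VD]] := nbhs0_add W0.
have [|a /asboolP na [U1 U10 h1]] := clx [set y | eventually_in V (val (y : cnet))].
  by apply/gtop_nbhs0; exists [set x | eventually_in V (val x)] => //; exists V.
have [U2 U20 h2] := na _ V0; exists (U1 `&` U2); first exact: filterI.
move=> U U0 /sub_setI[UU1 UU2]; have := VD _ _ (h1 _ U0 UU1) (h2 _ U0 UU2).
by rewrite (raddfB (val : cnet -> _)) !fctE subrK => -[].
Qed.

Fact cst_cauchy (g : G) : (fun=> g) \in cauchy_pred.
Proof. by apply/asboolP => W W0; exists W => // *; rewrite subrr; exact: nbhs0_0. Qed.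

Definition cst_net (g : G) : net := exist _ (fun=> g) (cst_cauchy g).

Definition to_completion (g : G) : K := pi (cst_net g).

Fact to_completion_is_additive : zmod_morphism to_completion.
Proof.
move=> x y; rewrite /to_completion -raddfB; congr (pi _).
by apply: val_inj; rewrite (raddfB (val : cnet -> _)).
Qed.

HB.instance Definition _ :=
  GRing.isZmodMorphism.Build G K to_completion to_completion_is_additive.

Lemma eventually_in_cst W g : eventually_in W (fun=> g) <-> W g.
Proof.
split=> [[U0 nU0 h]|Wg]; first exact: (h U0).
by exists setT; first exact: filterT.
Qed.

Lemma to_completion_nbhs W g : nbhs (0 : G) W ->
  [set y | exists x : net, eventually_in W (val (x : cnet)) /\ pi x = y] (to_completion g) ->
  forall V, nbhs (0 : G) V -> exists2 v, V v & W (g + v).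
Proof.
move=> W0 [x [[U1 U10 h1] /qpi_eq/asboolP h]] V V0; have [U2 U20 h2] := h _ V0.
exists (val (x : cnet) (U1 `&` U2) - g).
  have := h2 (U1 `&` U2); rewrite (raddfB (val : cnet -> _)) !fctE; apply; first exact: filterI.
  exact: subIsetr.
by rewrite addrC subrK; apply: h1; [exact: filterI|exact: subIsetl].
Qed.

Lemma completion_dense_embedding : hausdorff_space G -> dense_embedding to_completion.
Proof.
move=> hG; split.
- move=> x y /qpi_eq/asboolP h; apply/eqP; rewrite -subr_eq0; apply/eqP.
  apply: (iffLR (hausdorff_sep0 G) hG) => U U0; apply/eventually_in_cst.
  by have := h _ U0; rewrite (raddfB (val : cnet -> _)).
- move=> A /completion_nbhs[W W0 WA]; apply: filterS W0 => g Wg.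
  by apply: WA; apply/eventually_in_cst.
- move=> U U0; have [V [V0 _ _ VD]] := nbhs0_add U0.
  exists [set y | exists x : net, eventually_in V (val (x : cnet)) /\ pi x = y].
    by apply/completion_nbhs; exists V => // x hx; exists x.
  move=> g /(to_completion_nbhs V0)/(_ _ V0)[v Vv Vgv].
  by rewrite -[g](addrK v); exact: (VD _ _ Vgv Vv).2.
- move=> h A /completion_nbhs[W W0 WA]; have [x <-] := qpi_surj h.
  have /asboolP cx := valP (x : cnet); have [U0 nU0 hU0] := cx _ W0.
  exists (val (x : cnet) U0); rewrite -raddfB; apply: WA.
  exists U0 => // U nU UU; rewrite (raddfB (val : cnet -> _)) !fctE.
  exact: hU0.
Qed.

(** For every [U] a [U]-small member of the filter is approximated up to [U] by a point [g U] of the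
    group. The net [g] is Cauchy, and its class is the limit. *)
Lemma completion_complete : hausdorff_space G -> complete_group K.
Proof.
move=> hG F FF cF.
have [iI ic io id] := completion_dense_embedding hG.
pose L U := [set y : K | exists x : net, eventually_in U (val (x : cnet)) /\ pi x = y].
have LU U : nbhs 0 U -> nbhs (0 : K) (L U).
  by move=> U0; apply/completion_nbhs; exists U => // x hx; exists x.
have LS U V : U `<=` V -> L U `<=` L V.
  by move=> UV y [x [[U0 nU0 h] <-]]; exists x; split=> //; exists U0 => // W nW /(h _ nW)/UV.
have /choice[A hA] : forall U, exists A, nbhs (0 : G) U -> F A /\ forall x y, A x -> A y -> L U (x - y).
  move=> U; have [U0|nU] := pselect (nbhs (0 : G) U); last by exists setT.
  by have [A FA h] := cF _ (LU _ U0); exists A.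
have /choice[g hg] : forall U, exists g, nbhs (0 : G) U -> exists2 a, A U a & L U (a - to_completion g).
  move=> U; have [U0|nU] := pselect (nbhs (0 : G) U); last by exists 0.
  have [FA _] := hA _ U0; have [a Aa] := filter_ex FA.
  by have [g hg] := id a _ (LU _ U0); exists g => _; exists a.
have gU U a : nbhs (0 : G) U -> A U a -> exists b c, [/\ L U b, L U c & a - to_completion (g U) = b + c].
  move=> U0 Aa; have [_ hU] := hA _ U0; have [b Ab Lb] := hg _ U0.
  by exists (a - b), (b - to_completion (g U)); split=> //; [exact: hU|zmodule].
have small (W : set K) : nbhs (0 : K) W -> exists2 U, nbhs (0 : G) U & forall U1 U2, nbhs (0 : G) U1 ->
    nbhs (0 : G) U2 -> U1 `<=` U -> U2 `<=` U -> W (to_completion (g U1) - to_completion (g U2)).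
  move=> W0; have [V [V0 _ _ VD]] := nbhs0_add W0; have [X [X0 _ _ XD]] := nbhs0_add V0.
  have /completion_nbhs[U U0 UX] := X0; exists U => // U1 U2 U10 U20 UU1 UU2.
  have LX y : L U y -> X y by move=> [x [ex <-]]; exact: UX.
  have [a [A1a A2a]] := filter_ex (filterI (hA _ U10).1 (hA _ U20).1).
  have [b [c [Lb Lc e]]] := gU _ _ U10 A1a; have [b' [c' [Lb' Lc' e']]] := gU _ _ U20 A2a.
  have -> : to_completion (g U1) - to_completion (g U2) = (b' + c') - (b + c).
    by rewrite -e -e'; zmodule.
  apply: (VD _ _ (XD _ _ _ _).1 (XD _ _ _ _).1).2; apply: LX;
  [exact: LS Lb'|exact: LS Lc'|exact: LS Lb|exact: LS Lc].
have cg : g \in cauchy_pred.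
  apply/asboolP => W W0; have [W' W'0 W'W] := io _ W0.
  have [U U0 hU] := small _ W'0; exists U => // U1 U2 *.
  by apply: W'W; rewrite raddfB; exact: hU.
pose l : net := exist _ g cg.
exists (pi l) => B /nbhs_shift B0; have [V [V0 _ VB VD]] := nbhs0_add B0.
have [X [X0 _ XV XD]] := nbhs0_add V0.
have /completion_nbhs[W W0 WX] := X0.
have LX y : L W y -> X y by move=> [x [ex <-]]; exact: WX.
have /asboolP/(_ _ W0)[U U0 hU] := cg.
have WU0 : nbhs 0 (W `&` U) by exact: filterI.
apply: filterS (hA _ WU0).1 => a /(gU _ _ WU0)[b [c [Lb Lc e]]].
have -> : a = (b + c) + (to_completion (g (W `&` U)) - pi l) + pi l by rewrite -e; zmodule.
apply: (VD _ _ _ _).1.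
  have WW : L (W `&` U) `<=` L W by apply: LS; exact: subIsetl.
  by apply: (XD _ _ _ _).1; apply: LX; apply: WW.
apply/XV; rewrite /to_completion -(raddfB (@qpi net null_pred)); apply: WX; exists U => // U' U'0 UU'.
rewrite (raddfB (val : cnet -> _)) !fctE; apply: hU => //.
Qed.

End Completion.

(** * Multiples shrink to a compact subgroup *)

Lemma fact_dvdn m n : (m <= n)%N -> (m`! %| n`!)%N.
Proof.
elim: n => [|n IH]; first by rewrite leqn0 => /eqP ->.
by rewrite leq_eqVlt => /predU1P[->//|/IH h]; rewrite factS dvdn_mull.
Qed.

Definition multiples (G : zmodType) (n : nat) : set G := [set x *+ n | x in [set: G]].
Arguments multiples : clear implicits.

Lemma multiples_subgroup (G : zmodType) n : subgroup (multiples G n).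
Proof.
split; first by exists 0; rewrite ?mul0rn.
by move=> _ _ [x _ <-] [y _ <-]; exists (x - y); rewrite ?mulrnBl.
Qed.

Lemma multiples_dvd (G : zmodType) m n : (m %| n)%N -> multiples G n `<=` multiples G m.
Proof. by move=> /dvdnP[q ->] _ [x _ <-]; exists (x *+ q); rewrite // mulrnA. Qed.

Section DivisiblePart.
Context (K : topologicalZmodType) (hK : hausdorff_space K) (cK : complete_group K).
Hypothesis K_big : forall U, nbhs (0 : K) U ->
  exists2 k, (0 < k)%N & big (multiples K k) U.

(** Closures are taken because the groups [n K] are only known to be closed once [K] is compact. *)
Definition divpart : set K := [set x | forall n, (0 < n)%N -> closure (multiples K n) x].
Local Notation D := divpart.

Lemma divpart_subgroup : subgroup D.
Proof.
split=> [n _|x y Dx Dy n n0].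
  exact: subgroup0 (closure_subgroup (multiples_subgroup K n)).
by apply: (subgroupB (closure_subgroup (multiples_subgroup K n))); [exact: Dx|exact: Dy].
Qed.

Lemma divpart_closed : closed D.
Proof.
move=> x clx n n0; apply: (@closed_closure K); apply: closure_subset clx.
by move=> y; exact.
Qed.

Lemma divpart_totally_bounded : totally_bounded D.
Proof.
move=> U /nbhs0_add[V [V0 _ _ VD]]; have [k k0 bk] := K_big V0.
apply: (@bigW _ (closure (multiples K k))) => [x|]; first exact.
by apply: (big_closure V0 _ bk) => x y Vx Vy; exact: (VD _ _ Vx Vy).1.
Qed.

Lemma divpart_compact : compact D.
Proof.
apply: closed_totally_bounded_compact => //; first exact: divpart_closed.
exact: divpart_totally_bounded.
Qed.

Lemma divpart_ultra (F : set_system K) : UltraFilter F ->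
  (forall n, (0 < n)%N -> F (multiples K n)) -> exists2 l, D l & F --> l.
Proof.
move=> FU Fn; have [|l Fl] := cK (F := F).
  move=> U /nbhs0_sub[V V0 VU]; have [k k0 bk] := K_big V0.
  exact: ultra_big VU bk FU (Fn _ k0).
exists l => // n n0 A Al.
by have [x [? ?]] := filter_ex (filterI (Fn _ n0) (Fl _ Al)); exists x.
Qed.

(** Otherwise the parts of [n! K] outside [D + U] generate a proper filter. An ultrafilter above it
    converges to a point of [D] by [divpart_ultra], hence enters [D + U]. *)
Lemma divpart_absorb U : nbhs (0 : K) U ->
  exists2 k, (0 < k)%N & forall x, multiples K k x -> exists2 d, D d & U (x - d).
Proof.
move=> U0; apply: contrapT => nk.
pose S n := multiples K n`! `&` [set y | ~ exists2 d, D d & U (y - d)].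
have FF : ProperFilter (filter_from setT S).
  apply: filter_from_proper.
    apply: filter_fromT_filter; first by exists 0%N.
    move=> m n; exists (maxn m n) => y [my ny]; split; split=> //;
    by apply: multiples_dvd my; apply: fact_dvdn; rewrite ?leq_maxl ?leq_maxr.
  move=> n _; apply: contrapT => nS; apply: nk; exists n`!; first exact: fact_gt0.
  by move=> x nx; apply: contrapT => nd; apply: nS; exists x.
have [F [FU SF]] := ultraFilterLemma FF.
have [n n0|l Dl Fl] := divpart_ultra FU.
  apply: (@filterS _ F _ (S n)); last by apply: SF; exists n.
  by move=> y [+ _]; apply: multiples_dvd; by apply: dvdn_fact; rewrite n0 /=.
have FS : F (S 0%N) by apply: SF; exists 0%N.
have [y [[_ ny] Uy]] := filter_ex (filterI FS (Fl _ (nbhs_subx l U0))).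
by apply: ny; exists l.
Qed.

End DivisiblePart.

(** * Extension of homomorphisms with a prescribed relation *)

Lemma pairB (X Y : zmodType) (a c : X) (b d : Y) : (a, b) - (c, d) = (a - c, b - d).
Proof. by []. Qed.

Lemma pairN (X Y : zmodType) (a : X) (b : Y) : - (a, b) = (- a, - b).
Proof. by []. Qed.

Lemma pairMz (X Y : zmodType) (a : X) (b : Y) (k : int) : (a, b) *~ k = (a *~ k, b *~ k).
Proof.
have pairMn n : (a, b) *+ n = (a *+ n, b *+ n) by elim: n => // n IH; rewrite !mulrS IH.
by case: k => n; rewrite ?NegzE ?mulrNz -!pmulrn pairMn.
Qed.

Section ExtensionOfHomomorphisms.
Context (X Y : zmodType) (Ad : set (X * Y)).
Hypothesis Ad_subgroup : subgroup Ad.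
Hypothesis Ad_div : forall x n y, (0 < n)%N -> Ad (x *+ n, y) ->
  exists2 z, z *+ n = y & Ad (x, z).
Hypothesis Ad_total : forall x, exists y, Ad (x, y).

Let good (A : set (X * Y)) :=
  [/\ subgroup A, forall y, A (0, y) -> y = 0 & A `<=` Ad].

(** A value [y] at [x] is compatible with the graph [A] as soon as it is right on the multiples of
    [x] in the domain. If there are none but zero, any admissible [y] will do; otherwise divide the
    value at the least positive multiple. *)
Let good_extend A x : good A -> exists2 B, good B & A `<=` B /\ exists y, B (x, y).
Proof.
move=> [sA fA AAd].
have uA z y y' : A (z, y) -> A (z, y') -> y = y'.
  move=> h h'; have : A (0, y - y').
    have -> : (0, y - y') = (z, y) - (z, y') by rewrite pairB subrr.
    exact: subgroupB.
  by move=> /fA/eqP; rewrite subr_eq0 => /eqP.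
have [y Adxy hy] : exists2 y, Ad (x, y) & forall (k : int) z, A (x *~ k, z) -> z = y *~ k.
  have [hn0|nex] := pselect (exists n, (0 < n)%N && `[< exists z, A (x *+ n, z) >]); last first.
    have [y Adxy] := Ad_total x; exists y => // k z Akz.
    have [k0|k0] := eqVneq k 0; first by move: Akz; rewrite k0 !mulr0z => /fA.
    exfalso; apply: nex; exists `|k|%N; apply/andP; split; first by rewrite absz_gt0.
    apply/asboolP; case: (k) Akz => m; first by exists z.
    rewrite NegzE mulrNz => Akz; exists (- z).
    have -> : (x *+ m.+1, - z) = - (- (x *~ m.+1%:Z), z) by rewrite pairN opprK.
    exact: subgroupN.
  (* Minimality of [n] makes it divide every [k] such that [x *~ k] is in the domain: the remainder
     [rho] would be a smaller multiple there. *)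
  have [n /andP[n_gt0 /asboolP[r An]] nmin] := ex_minnP hn0.
  have [y yn Adxy] := Ad_div n_gt0 (AAd _ An); exists y => // k z Akz.
  have ek := divz_eq k n%:Z.
  have n0' : (n%:Z != 0 :> int) by lia.
  have r0 := modz_ge0 k n0'; have rlt := ltz_pmod k (n_gt0 : (0 < n%:Z)%R).
  set q := (k %/ n%:Z)%Z in ek *; set rho := (k %% n%:Z)%Z in ek r0 rlt *.
  have Aq : A (x *~ (q * n%:Z), r *~ q).
    have -> : (x *~ (q * n%:Z), r *~ q) = (x *+ n, r) *~ q.
      by rewrite pairMz mulrC mulrzA.
    exact: subgroupMz.
  have rho0 : rho = 0.
    apply/eqP/negPn/negP => rho0.
    have : (n <= `|rho|)%N; last by lia.
    apply: nmin; apply/andP; split; first by rewrite absz_gt0.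
    apply/asboolP; exists (z - r *~ q).
    have -> : x *+ `|rho| = x *~ k - x *~ (q * n%:Z).
      rewrite -mulrzBr; have -> : k - q * n%:Z = rho by rewrite {1}ek addrC addKr.
      by case: (rho) r0.
    have -> : (x *~ k - x *~ (q * n%:Z), z - r *~ q) = (x *~ k, z) - (x *~ (q * n%:Z), r *~ q) by [].
    exact: subgroupB.
  have kq : k = q * n%:Z by rewrite {1}ek rho0 addr0.
  rewrite (uA _ _ _ Akz (_ : A (x *~ k, r *~ q))); last by rewrite kq.
  by rewrite kq -yn mulrC mulrzA.
pose B : set (X * Y) := [set w | exists u (k : int), A u /\ w = (u.1 + x *~ k, u.2 + y *~ k)].
exists B.
  split.
  - split; first by exists 0, 0; rewrite !mulr0z !addr0; split=> //; exact: subgroup0.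
    move=> _ _ [u [k [Au ->]]] [v [l [Av ->]]]; exists (u - v), (k - l).
    split; first exact: subgroupB.
    by rewrite !mulrzBr; congr (_, _); rewrite /=; zmodule.
  - move=> w [u [k [Au [e1 e2]]]]; rewrite e2.
    have : A (x *~ k, - u.2).
      have -> : (x *~ k, - u.2) = - u.
        have -> : x *~ k = - u.1 by apply/eqP; rewrite -addr_eq0 addrC -e1.
        by case: (u).
      exact: subgroupN.
    by move=> /hy <-; rewrite subrr.
  - move=> _ [u [k [Au ->]]].
    have -> : (u.1 + x *~ k, u.2 + y *~ k) = u + (x, y) *~ k.
      have -> : (x, y) *~ k = (x *~ k, y *~ k); last by case: (u).
      exact: pairMz.
    by apply: subgroupD => //; [exact: AAd|exact: subgroupMz].
split; first by move=> u Au; exists u, 0; split=> //; rewrite !mulr0z !addr0; case: (u).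
by exists y, 0, 1; rewrite !mulr1z !add0r; split=> //; exact: subgroup0.
Qed.

(** Baer's argument by Zorn's lemma, with graphs confined to the relation [Ad]. For [Ad] full this
    is injectivity of divisible groups; a smaller [Ad] lets the extension keep a property of its
    values, such as convergence in [torsion_approx]. *)
Lemma extend_hom (g0 : set (X * Y)) : subgroup g0 -> (forall y, g0 (0, y) -> y = 0) ->
  g0 `<=` Ad -> exists F : X -> Y, [/\ forall x y, F (x - y) = F x - F y,
    forall x, Ad (x, F x) & forall x y, g0 (x, y) -> F x = y].
Proof.
move=> sg0 fg0 g0Ad.
(* The disjunct [A = set0] is there for the empty chain, whose union is empty. *)
pose P (A : set (X * Y)) := A = set0 \/ good A /\ g0 `<=` A.
have [|A [PA Amax]] := @Zorn_bigcup _ P.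
  move=> C CP totC.
  have [[A0 [CA0 nA0]]|nex] := pselect (exists A, C A /\ A <> set0); last first.
    left; apply: bigcup0 => A CA; apply: contrapT => nA; apply: nex; by exists A.
  have Cgood A u : C A -> A u -> good A /\ g0 `<=` A.
    by move=> CA Au; have [A0'|//] := CP _ CA; rewrite A0' in Au.
  have [gA0 g0A0] : good A0 /\ g0 `<=` A0 by have [|] := CP _ CA0.
  right; split; last by move=> u /g0A0; exists A0.
  split.
  - split; first by exists A0 => //; have [sA0 _ _] := gA0; exact: (subgroup0 sA0).
    move=> u v [A CA Au] [A' CA' A'v].
    have [[sA _ _] _] := Cgood _ _ CA Au; have [[sA' _ _] _] := Cgood _ _ CA' A'v.
    have [AA'|A'A] := totC _ _ CA CA'.
      by exists A' => //; apply: subgroupB => //; exact: AA'.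
    by exists A => //; apply: subgroupB => //; exact: A'A.
  - by move=> y [A CA Ay]; have [[_ h _] _] := Cgood _ _ CA Ay; exact: h.
  - by move=> u [A CA Au]; have [[_ _ h] _] := Cgood _ _ CA Au; exact: h.
have [gA g0A] : good A /\ g0 `<=` A.
  have [A0|//] := PA; exfalso; apply: (Amax g0); last by right; split=> //; split.
  rewrite A0; split; first exact: sub0set.
  by move=> /(_ 0 (subgroup0 sg0)).
have totA x : exists y, A (x, y).
  have [B gB [AB [y Bxy]]] := good_extend x gA; apply: contrapT => nA.
  apply: (Amax B); last by right; split=> // u /g0A/AB.
  by split=> // BA; apply: nA; exists y; exact: BA.
have [sA fA AAd] := gA.
have uA z y y' : A (z, y) -> A (z, y') -> y = y'.
  move=> h h'; have : A (0, y - y') by rewrite -(subrr z) -pairB; exact: subgroupB.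
  by move=> /fA/eqP; rewrite subr_eq0 => /eqP.
have /choice[F hF] := totA; exists F; split.
- move=> x y; apply: (uA (x - y)) => //.
  by rewrite -pairB; exact: subgroupB.
- by move=> x; exact: AAd.
- by move=> x y /g0A Axy; exact: uA (hF x) Axy.
Qed.

End ExtensionOfHomomorphisms.

(** * Translation invariant means *)

Section Mean.
Context (R : realType) (Z : zmodType) (S : set Z).
Hypothesis sS : subgroup S.
Implicit Types (f g : Z -> R) (w : seq (Z * nat)).

(** A pair [(a, n)] averages over the progression [x, x + a, ..., x + n a]; the list iterates such
    averages. Counting [n + 1] terms keeps the denominator nonzero. *)
Fixpoint average w f (x : Z) : R :=
  if w is an :: w' then
    (an.2.+1%:R)^-1 * \sum_(i < an.2.+1) average w' f (x + an.1 *+ i)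
  else f x.

Definition bounded_fun f : Prop := exists M, forall x, `|f x| <= M.

Let in_S w := forall an, an \in w -> S an.1.

Lemma average_le w f g : in_S w -> (forall x, S x -> f x <= g x) ->
  forall x, S x -> average w f x <= average w g x.
Proof.
move=> + fg; elim: w => [|[a n] w IH] Sw x Sx /=; first exact: fg.
rewrite ler_wpM2l ?invr_ge0// ler_sum// => i _; apply: IH.
  by move=> an anw; apply: Sw; rewrite inE anw orbT.
apply: subgroupD => //; apply: subgroupMn => //.
by apply: (Sw (a, n)); rewrite inE eqxx.
Qed.

Lemma average_cst w (c : R) x : average w (fun=> c) x = c.
Proof.
elim: w x => //= -[a n] w IH x /=; under eq_bigr do rewrite IH.
by rewrite sumr_const card_ord -[c *+ _]mulr_natl mulKf// pnatr_eq0.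
Qed.

Lemma averageD w f g x : average w (fun x => f x + g x) x = average w f x + average w g x.
Proof.
elim: w x => //= -[a n] w IH x /=; under eq_bigr do rewrite IH.
by rewrite big_split mulrDr.
Qed.

Lemma averageZ w c f x : average w (fun x => c * f x) x = c * average w f x.
Proof.
elim: w x => //= -[a n] w IH x /=; under eq_bigr do rewrite IH.
by rewrite -mulr_sumr mulrCA.
Qed.

Lemma average_shift w f a x : average w (fun x => f (x + a)) x = average w f (x + a).
Proof.
elim: w x => //= -[b n] w IH x /=; congr (_ * _); apply: eq_bigr => i _.
by rewrite IH addrAC.
Qed.

Lemma average_norm w f M x : (forall x, `|f x| <= M) -> `|average w f x| <= M.
Proof.
move=> fM; elim: w x => //= -[b n] w IH x /=.
rewrite normrM ger0_norm ?invr_ge0// ler_pdivrMl ?ltr0n//.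
apply: le_trans (ler_norm_sum _ _ _) _.
have -> : n.+1%:R * M = \sum_(i < n.+1) M by rewrite sumr_const card_ord mulr_natl.
by apply: ler_sum => i _; exact: IH.
Qed.

(** Along the progression of step [a] the differences telescope to two values of size at most [M],
    divided by [n + 1]; the remaining averages do not increase the bound. *)
Lemma average_telescope w f M a n x : (forall x, `|f x| <= M) -> (a, n) \in w ->
  `|average w (fun x => f (x + a) - f x) x| <= 2 * M / n.+1%:R.
Proof.
move=> fM; elim: w x => //= -[b k] w IH x; rewrite inE => /predU1P[[<- <-]|anw] /=.
  rewrite normrM ger0_norm ?invr_ge0// mulrC ler_wpM2r ?invr_ge0//.
  have -> : \sum_(i < n.+1) average w (fun x => f (x + a) - f x) (x + a *+ i) =
            average w f (x + a *+ n.+1) - average w f x.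
    have h y : average w (fun x => f (x + a) - f x) y = average w f (y + a) - average w f y.
      rewrite (_ : (fun _ => _) = (fun x => f (x + a) + (-1) * f x)); last first.
        by apply/funext => z; rewrite mulN1r.
      by rewrite averageD average_shift averageZ mulN1r.
    under eq_bigr do rewrite h -addrA -mulrSr.
    rewrite -(big_mkord xpredT (fun i => average w f (x + a *+ i.+1) - average w f (x + a *+ i))).
    by rewrite telescope_sumr// mulr0n addr0.
  apply: le_trans (ler_normB _ _) _; rewrite mulr2n mulrDl mul1r.
  by apply: lerD; exact: average_norm.
rewrite normrM ger0_norm ?invr_ge0// ler_pdivrMl ?ltr0n//.
apply: le_trans (ler_norm_sum _ _ _) _.
have -> : k.+1%:R * (2 * M / n.+1%:R) = \sum_(i < k.+1) (2 * M / n.+1%:R).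
  by rewrite sumr_const card_ord mulr_natl.
by apply: ler_sum => i _; exact: IH.
Qed.

(* A translation invariant mean is a limit, along an ultrafilter, of iterated
   averages over longer and longer arithmetic progressions. *)
Lemma exists_shift_mean : exists m : (Z -> R) -> R, [/\
  forall f g, bounded_fun f -> bounded_fun g -> m (fun x => f x + g x) = m f + m g,
  forall c f, bounded_fun f -> m (fun x => c * f x) = c * m f,
  forall f g, bounded_fun f -> bounded_fun g -> (forall x, S x -> f x <= g x) -> m f <= m g,
  m (fun=> 1) = 1
  & forall f a, bounded_fun f -> S a -> m (fun x => f (x + a)) = m f].
Proof.
(* Lists with steps in [S] are directed by inclusion, so every progression is eventually used.
   Averages taken at 0 with such steps see only values on [S], whence the order clause compares
   functions on [S] alone. *)
pose W (l : seq (Z * nat)) := [set w | in_S w /\ forall an, an \in l -> an \in w].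
have FF : ProperFilter (filter_from in_S W).
  apply: filter_from_proper.
    apply: filter_from_filter; first by exists [::].
    move=> l l' Sl Sl'; exists (l ++ l').
      by move=> an; rewrite mem_cat => /orP[/Sl|/Sl'].
    by move=> w [Sw h]; split; split=> // an anl; apply: h; rewrite mem_cat anl ?orbT.
  by move=> l Sl; exists l.
have [F [FU WF]] := ultraFilterLemma FF.
have FS : F in_S by apply: WF; exists [::] => // w [].
have /choice[m hm] : forall f, exists r : R, bounded_fun f -> (fun w => average w f 0) @ F --> r.
  move=> f; have [bf|nbf] := pselect (bounded_fun f); last by exists 0.
  have [M fM] := bf.
  have [|r [_ clr]] := @segment_compact R (- M) M ((fun w => average w f 0) @ F) _.
    by apply: (@filterE _ F) => w; rewrite /= in_itv /= -ler_norml average_norm.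
  exists r => _ A Ar; have [//|Fn] := in_ultra_setVsetC [set w | A (average w f 0)] FU.
  by have [x [nAx Ax]] := clr (~` A) A Fn Ar.
have uniq (u : seq (Z * nat) -> R) (a b : R) : u @ F --> a -> u @ F --> b -> a = b.
  exact: cvg_unique.
exists m; split.
- move=> f g bf bg.
  have bfg : bounded_fun (fun x => f x + g x).
    have [M hM] := bf; have [M' hM'] := bg; exists (M + M') => x.
    by apply: le_trans (ler_normD _ _) _; exact: lerD.
  apply: (uniq _ _ _ (hm _ bfg)).
  rewrite (_ : (fun w => _) = (fun w => average w f 0 + average w g 0)); last first.
    by apply/funext => w; exact: averageD.
  by apply: (@cvgD R R^o); exact: hm.
- move=> c f bf.
  have bcf : bounded_fun (fun x => c * f x).
    have [M hM] := bf; exists (`|c| * M) => x.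
    by rewrite normrM ler_wpM2l.
  apply: (uniq _ _ _ (hm _ bcf)).
  rewrite (_ : (fun w => _) = (fun w => c * average w f 0)); last first.
    by apply/funext => w; exact: averageZ.
  by apply: cvgMr; exact: hm.
- move=> f g bf bg fg.
  rewrite leNgt; apply/negP => lt; pose z := (m f + m g) / 2.
  have zf : z < m f by rewrite /z; lra.
  have gz : m g < z by rewrite /z; lra.
  have Ff : F [set w | z < average w f 0] by exact: (cvgr_gt _ (hm _ bf) _ zf).
  have Fg : F [set w | average w g 0 < z] by exact: (cvgr_lt _ (hm _ bg) _ gz).
  have [w [[Sw fw] gw]] := filter_ex (filterI (filterI FS Ff) Fg).
  have := average_le Sw fg (subgroup0 sS); move: fw gw => /= fw gw; lra.
- have b1 : bounded_fun (fun=> 1) by exists 1 => x; rewrite normr1.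
  apply: (uniq _ _ _ (hm _ b1)).
  rewrite (_ : (fun w => _) = (fun=> 1)); first exact: cvg_cst.
  by apply/funext => w; exact: average_cst.
- move=> f a bf Sa.
  have bfa : bounded_fun (fun x => f (x + a)) by have [M hM] := bf; exists M => x.
  have [M hM] := bf.
  apply: (uniq _ _ _ (hm _ bfa)).
  rewrite (_ : (fun w => _) =
    (fun w => average w f 0 + average w (fun x => f (x + a) - f x) 0)); last first.
    by apply/funext => w; rewrite -averageD; congr (average _ _ _); apply/funext => x; ring.
  rewrite -[X in _ --> X]addr0; apply: (@cvgD R R^o); first exact: hm.
  apply/cvgr0Pnorm_le => e e0.
  have M0 : 0 <= M by apply: le_trans (hM 0).
  have [n hn] : exists n : nat, 2 * M / n.+1%:R <= e.
    exists (Num.trunc (2 * M / e)).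
    rewrite ler_pdivrMr ?ltr0n// -ler_pdivrMl// [leLHS]mulrC.
    by apply: ltW; apply: truncnS_gt.
  have : F (W [:: (a, n)]).
    by apply: WF; exists [:: (a, n)] => // an; rewrite inE => /eqP ->.
  apply: filterS => w [_ /(_ (a, n))]; rewrite inE eqxx => /(_ isT) anw.
  by apply: le_trans hn; exact: average_telescope.
Qed.

End Mean.

(** * The circle group and approximate homomorphisms *)

Section Circle.
Context (R : realType).

Definition integer_pred : {pred R} := fun x => `[< exists k : int, x = k%:~R >].

Fact integer_pred_closed : zmod_closed integer_pred.
Proof.
split=> [|x y /asboolP[k ->] /asboolP[l ->]]; apply/asboolP; first by exists 0.
by exists (k - l); rewrite rmorphB.
Qed.

HB.instance Definition _ := GRing.isZmodClosed.Build R integer_pred integer_pred_closed.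

(** The reals modulo the integers, as a bare group; its topology enters only through [cnorm], the
    distance to zero. *)
Definition circle : zmodType := Quotient.quot integer_pred.

Definition tpi (x : R) : circle := (\pi_(Quotient.quot integer_pred) x)%qT.

Fact tpi_is_additive : zmod_morphism tpi.
Proof. by move=> x y; rewrite /tpi Quotient.pi_add Quotient.pi_opp. Qed.

HB.instance Definition _ := GRing.isZmodMorphism.Build R circle tpi tpi_is_additive.

Lemma tpiD x y : tpi (x + y) = tpi x + tpi y. Proof. exact: raddfD. Qed.

Lemma tpi_eq x y : tpi x = tpi y <-> exists k : int, x - y = k%:~R.
Proof.
have -> : (exists k : int, x - y = k%:~R) <-> x - y \in integer_pred.
  by split=> [h|/asboolP//]; apply/asboolP.
by rewrite Quotient.idealrBE; split=> [e|/eqP//]; exact/eqP.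
Qed.

Definition tlift (t : circle) : R :=
  let r := repr (t : Quotient.quot integer_pred) in r - (Num.floor (r + 2^-1))%:~R.

Lemma tliftK t : tpi (tlift t) = t.
Proof.
rewrite -[RHS](reprK (t : Quotient.quot integer_pred)); apply/tpi_eq.
by exists (- Num.floor (repr (t : Quotient.quot integer_pred) + 2^-1)); rewrite /tlift rmorphN /=; ring.
Qed.

Lemma tlift_bound t : - 2^-1 <= tlift t < 2^-1.
Proof.
rewrite /tlift; set r := repr _.
have := floor_le_tmp (r + 2^-1); have := floorD1_gt (r + 2^-1); rewrite intrD.
by move=> h1 h2; apply/andP; split; lra.
Qed.

Lemma int_small (k : int) : `|k%:~R : R| < 1 -> k = 0.
Proof. by rewrite -intr_norm -[1]/(1%:~R) ltr_int => h; apply/eqP; rewrite -normr_eq0; lia. Qed.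

Lemma tlift_small r : `|r| < 2^-1 -> tlift (tpi r) = r.
Proof.
move=> r2; have /tpi_eq[k hk] := tliftK (tpi r).
have k0 : k = 0.
  apply: int_small; rewrite -hk; have := tlift_bound (tpi r); move: r2.
  by rewrite !ltr_norml => /andP[? ?] /andP[? ?]; apply/andP; split; lra.
by apply/eqP; rewrite -subr_eq0 hk k0.
Qed.

Definition cnorm (t : circle) : R := `|tlift t|.

Lemma cnorm_ge0 t : 0 <= cnorm t. Proof. exact: normr_ge0. Qed.

Lemma cnorm_half t : cnorm t <= 2^-1.
Proof. by rewrite /cnorm ler_norml; have /andP[h1 h2] := tlift_bound t; apply/andP; split; lra. Qed.

Lemma cnorm_tpi r : cnorm (tpi r) <= `|r|.
Proof.
by have [h|h] := ltP `|r| 2^-1; [rewrite /cnorm tlift_small|exact: le_trans (cnorm_half _) h].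
Qed.

Lemma cnorm0 : cnorm 0 = 0.
Proof. by apply/eqP; rewrite eq_le cnorm_ge0 andbT; have := cnorm_tpi 0; rewrite raddf0 normr0. Qed.

Lemma cnorm_eq0 t : cnorm t = 0 -> t = 0.
Proof. by move/normr0_eq0 => h; rewrite -(tliftK t) h raddf0. Qed.

Lemma cnormD s t : cnorm (s + t) <= cnorm s + cnorm t.
Proof.
by rewrite -{1}(tliftK s) -{1}(tliftK t) -raddfD; apply: le_trans (cnorm_tpi _) (ler_normD _ _).
Qed.

Lemma cnormN t : cnorm (- t) = cnorm t.
Proof.
have h s : cnorm (- s) <= cnorm s.
  by rewrite -{1}(tliftK s) -raddfN; apply: le_trans (cnorm_tpi _) _; rewrite normrN.
by apply/eqP; rewrite eq_le h -{1}(opprK t) h.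
Qed.

Lemma cnormB s t : cnorm (s - t) <= cnorm s + cnorm t.
Proof. by rewrite -(cnormN t); exact: cnormD. Qed.

Lemma cnorm_double t : cnorm t < 4^-1 -> cnorm (t *+ 2) = 2 * cnorm t.
Proof.
move=> t4; rewrite -{1}(tliftK t) -raddfMn /cnorm tlift_small.
  by rewrite normrMn mulr_natl.
by rewrite normrMn -mulr_natl; move: t4; rewrite /cnorm; lra.
Qed.

(** Doubling a point doubles its norm as long as the norm is below [1/4]. The constant [1/5] is
    chosen below that threshold. *)
Lemma cnorm_doubles t k : (forall j, (j <= k)%N -> cnorm (t *+ 2 ^ j) <= 5^-1) ->
  2 ^+ k * cnorm t <= 5^-1.
Proof.
move=> h; suff : forall j, (j <= k)%N -> cnorm (t *+ 2 ^ j) = 2 ^+ j * cnorm t.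
  by move=> <-//; exact: h.
elim=> [|j IH] jk; first by rewrite expn0 mulr1n expr0 mul1r.
rewrite expnSr mulrnA cnorm_double ?IH ?exprS ?mulrA//; try exact: ltnW.
have := h j (ltnW jk); rewrite IH; [lra|exact: ltnW].
Qed.

Lemma pow2_large (c e : R) : 0 < e -> exists k : nat, c < 2 ^+ k * e.
Proof.
move=> e0; exists (Num.trunc (c / e)).+1; rewrite -ltr_pdivrMr//.
apply: lt_trans (truncnS_gt _) _; rewrite -natrX ltr_nat; exact: ltn_expl.
Qed.

(** The circle has no small subgroups: repeated doubling drives any nonzero point away from zero. *)
Lemma cnorm_small_multiples t : (forall n, cnorm (t *+ n) <= 5^-1) -> t = 0.
Proof.
move=> h; apply: cnorm_eq0; apply/eqP; rewrite eq_le cnorm_ge0 andbT leNgt; apply/negP => t0.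
have [k hk] := pow2_large 5^-1 t0.
by have := cnorm_doubles (fun j (_ : (j <= k)%N) => h (2 ^ j)%N); lra.
Qed.

Lemma circle_divisible (t : circle) n : (0 < n)%N -> exists s, s *+ n = t.
Proof.
move=> n0; exists (tpi (tlift t / n%:R)).
have nn0 : n%:R != 0 :> R by rewrite pnatr_eq0 -lt0n.
transitivity (tpi ((tlift t / n%:R) *+ n)); first by rewrite raddfMn.
by rewrite -mulr_natr divfK// tliftK.
Qed.

Lemma circle_cells (e : R) : 0 < e ->
  exists C : seq circle, forall t, exists2 c, c \in C & cnorm (t - c) < e.
Proof.
move=> e0; pose N := (Num.trunc (e^-1)).+1.
have N0 : 0 < N%:R :> R by rewrite ltr0n.
have Ne : N%:R^-1 < e by rewrite -[e]invrK ltf_pV2 ?posrE ?invr_gt0//; exact: truncnS_gt.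
exists [seq tpi (i%:R / N%:R - 2^-1) | i <- iota 0 N.+1] => t.
have /andP[t1 t2] := tlift_bound t.
set x := N%:R * (tlift t + 2^-1); have x0 : 0 <= x by apply: mulr_ge0; [exact: ltW|lra].
have := truncn_itv x0; set i := Num.trunc x => /andP[ix xi].
have iN : (i <= N)%N.
  rewrite -(ler_nat R); apply: le_trans ix _; rewrite /x ger_pMr//; lra.
exists (tpi (i%:R / N%:R - 2^-1)); first by apply/mapP; exists i => //; rewrite mem_iota.
rewrite -{1}(tliftK t) -raddfB; apply: le_lt_trans (cnorm_tpi _) _.
have -> : tlift t - (i%:R / N%:R - 2^-1) = (x - i%:R) / N%:R.
  by rewrite /x mulrBl mulrAC divff ?mul1r ?gt_eqF//; ring.
rewrite normrM (ger0_norm (_ : 0 <= N%:R^-1)) ?invr_ge0// (ger0_norm (_ : 0 <= x - i%:R)) ?subr_ge0//.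
apply: le_lt_trans Ne; rewrite -[leRHS]mul1r ler_wpM2r ?invr_ge0//.
by move: xi; rewrite -natr1; lra.
Qed.

Lemma circle_family_big (Z : zmodType) (H : set Z) (L : seq (Z -> circle)) (e : R) :
  0 < e -> exists F : seq Z, (forall f, f \in F -> H f) /\
    forall x, H x -> exists2 f, f \in F & forall i, (i < size L)%N ->
      cnorm (nth 0 L i x - nth 0 L i f) < e.
Proof.
move=> e0; have e2 : 0 < e / 2 by lra.
have [C hC] := circle_cells e2.
pose U n := [set t : nat -> circle | forall i, (i < n)%N -> cnorm (t i) < e / 2].
have bigU n : big setT (U n).
  elim: n => [|n [F hF]]; first by exists [:: 0] => t _; exists 0; rewrite ?inE.
  exists [seq (fun i => if i == n then c else f i) | f <- F, c <- C] => t _.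
  have [f fF Uf] := hF t I; have [c cC tc] := hC (t n).
  exists (fun i => if i == n then c else f i); first exact: (allpairs_f (fun f c i => if i == n then c else f i)).
  move=> i; rewrite ltnS leq_eqVlt => /predU1P[->|ilt]; rewrite !fctE; first by rewrite eqxx.
  by rewrite ltn_eqF//; exact: Uf.
pose pts (x : Z) : nat -> circle := fun i => nth 0 L i x.
have [x y Ux Uy|F [FH hF]] := @big_inside _ (pts @` H) (U (size L))
  [set t | forall i, (i < size L)%N -> cnorm (t i) < e] _ (bigW (@subsetT _ _) (bigU (size L))).
  move=> i ilt; rewrite !fctE; apply: le_lt_trans (cnormB _ _) _.
  by have := Ux i ilt; have := Uy i ilt; lra.
have /choice[g hg] : forall t, exists x, t \in F -> H x /\ pts x = t.
  move=> t; have [tF|_] := boolP (t \in F); last by exists 0.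
  by have [x Hx xt] := FH _ tF; exists x.
exists [seq g t | t <- F]; split.
  by move=> _ /mapP[t tF ->]; have [] := hg _ tF.
move=> x Hx; have [|t tF h] := hF (pts x); first by exists x.
exists (g t); first exact: map_f.
by move=> i ilt; have := h i ilt; rewrite !fctE -{1}(hg _ tF).2.
Qed.

(* Approximate homomorphisms are close to homomorphisms: average the cocycle. *)
Lemma approx_hom (Z : zmodType) (S : set Z) (g : Z -> circle) (e : R) :
  subgroup S -> e < 4^-1 ->
  (forall x y, S x -> S y -> cnorm (g (x + y) - g x - g y) <= e) ->
  exists2 h : Z -> circle, (forall x y, S x -> S y -> h (x + y) = h x + h y) &
    forall x, S x -> cnorm (h x - g x) <= e.
Proof.
move=> sS e4 ge.
have [m [mD mZ mle m1 msh]] := exists_shift_mean R sS.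
pose c x y := tlift (g (x + y) - g x - g y).
have bc x : bounded_fun (c x).
  by exists 2^-1 => y; exact: cnorm_half.
have ce x y : S x -> S y -> `|c x y| <= e by exact: ge.
have b1 : bounded_fun (fun=> 1 : R) by exists 1 => ?; rewrite normr1.
have bcst (r : R) : bounded_fun (fun _ : Z => r) by exists `|r|.
have mcst r : m (fun=> r) = r.
  rewrite (_ : (fun=> r) = (fun x => r * 1)); last by apply/funext => ?; rewrite mulr1.
  by rewrite mZ// m1 mulr1.
have bD f f' : bounded_fun f -> bounded_fun f' -> bounded_fun (fun x : Z => f x + f' x : R).
  move=> [M hM] [M' hM']; exists (M + M') => x.
  by apply: le_trans (ler_normD _ _) _; exact: lerD.
pose b x := m (c x).
have cocycle x y z : S x -> S y -> S z -> c x y + c (x + y) z = c y z + c x (z + y).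
  move=> Sx Sy Sz; have Sxy := subgroupD sS Sx Sy; have Szy := subgroupD sS Sz Sy.
  have /tpi_eq[k hk] : tpi (c x y + c (x + y) z) = tpi (c y z + c x (z + y)).
    rewrite [LHS]tpiD [RHS]tpiD /c !tliftK; have -> : x + (z + y) = x + y + z by zmodule.
    have -> : z + y = y + z by zmodule.
    by zmodule.
  (* Four lifts smaller than [1/4]: the cocycle identity, known modulo the integers, holds in the
     reals. *)
  have k0 : k = 0.
    apply: int_small; rewrite -hk; have := ce _ _ Sx Sy; have := ce _ _ Sxy Sz.
    have := ce _ _ Sy Sz; have := ce _ _ Sx Szy.
    rewrite !ler_norml ltr_norml => /andP[? ?] /andP[? ?] /andP[? ?] /andP[? ?].
    by apply/andP; split; lra.
  by apply/eqP; rewrite -subr_eq0 hk k0.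
have hb x y : S x -> S y -> c x y + b (x + y) = b x + b y.
  move=> Sx Sy.
  have -> : c x y + b (x + y) = m (fun z => c x y + c (x + y) z) by rewrite mD// mcst.
  have -> : b x + b y = m (fun z => c y z + c x (z + y)).
    rewrite mD ?msh// 1?addrC//.
    by have [M hM] := bc x; exists M => z.
  have bs : bounded_fun (fun z => c x (z + y)) by have [M hM] := bc x; exists M => z.
  have b1' := bD _ _ (bcst (c x y)) (bc (x + y)); have b2' := bD _ _ (bc y) bs.
  by apply/eqP; rewrite eq_le; apply/andP; split; apply: mle => // z Sz; rewrite cocycle.
exists (fun x => g x + tpi (b x)).
  move=> x y Sx Sy; have -> : g (x + y) = g x + g y + tpi (c x y) by rewrite tliftK; zmodule.
  by rewrite -addrA -tpiD hb// tpiD; zmodule.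
move=> x Sx; have -> : g x + tpi (b x) - g x = tpi (b x) by zmodule.
apply: le_trans (cnorm_tpi _) _; rewrite ler_norml; apply/andP; split.
  rewrite -[leLHS]mcst; apply: mle => // y Sy.
  by have := ce _ _ Sx Sy; rewrite ler_norml => /andP[].
rewrite -[leRHS]mcst; apply: mle => // y Sy.
by have := ce _ _ Sx Sy; rewrite ler_norml => /andP[].
Qed.

Lemma hom_on_muln (Z : zmodType) (S : set Z) (h : Z -> circle) :
  subgroup S -> (forall x y, S x -> S y -> h (x + y) = h x + h y) ->
  forall x n, S x -> h (x *+ n) = h x *+ n.
Proof.
move=> sS hD x n Sx; have h0 : h 0 = 0.
  have := hD 0 0 (subgroup0 sS) (subgroup0 sS); rewrite addr0 => e.
  by apply: (addrI (h 0)); rewrite -e addr0.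
elim: n => [|n IH]; first by rewrite !mulr0n.
by rewrite !mulrS hD ?IH//; exact: subgroupMn.
Qed.

(** If [x, 2 x, ..., 2 ^ k x] all lie in [O], then [cnorm (h x)] is at most [2 ^ -k / 5] by
    [cnorm_doubles]. *)
Lemma hom_on_continuous (P : topologicalZmodType) (S O : set P) (h : P -> circle) :
  subgroup S -> (forall x y, S x -> S y -> h (x + y) = h x + h y) ->
  nbhs (0 : P) O -> (forall x, S x -> O x -> cnorm (h x) <= 5^-1) ->
  forall e, 0 < e -> exists2 V, nbhs (0 : P) V & forall x, S x -> V x -> cnorm (h x) < e.
Proof.
move=> sS hD O0 hO e e0; have [k hk] := pow2_large 5^-1 e0.
have [V [V0 VN VO VM]] := nbhs0_muln (2 ^ k) O0; exists V => // x Sx Vx.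
have : 2 ^+ k * cnorm (h x) <= 5^-1.
  apply: cnorm_doubles => j jk; rewrite -(hom_on_muln sS)//; apply: hO.
    exact: subgroupMn.
  by apply: VM => //; rewrite leq_exp2l.
have k0 : 0 < 2 ^+ k :> R by rewrite exprn_gt0.
by move=> h'; have := le_lt_trans h' hk; rewrite ltr_pM2l.
Qed.

End Circle.

(** * Uniformly continuous functions, means and convolution *)

Section UniformlyContinuous.
Context (R : realType) (K : topologicalZmodType).
Hypothesis Ktb : totally_bounded [set: K].
Implicit Types f g h : K -> R.

Definition ucont f : Prop := forall e : R, 0 < e ->
  exists2 Q, nbhs (0 : K) Q & forall x y, Q (x - y) -> `|f x - f y| <= e.

Lemma ucont_bounded f : ucont f -> bounded_fun f.
Proof.
move=> uf; have [Q Q0 hO] := uf 1 ltr01; have [F hF] := Ktb Q0.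
exists (\sum_(y <- F) `|f y| + 1) => x; have [y yF /hO fxy] := hF x I.
have -> : f x = f y + (f x - f y) by ring.
apply: le_trans (ler_normD _ _) _; apply: lerD => //.
by rewrite (big_rem y)//= lerDl sumr_ge0.
Qed.

Lemma bounded_funD f g : bounded_fun f -> bounded_fun g -> bounded_fun (fun x => f x + g x).
Proof.
move=> [M hM] [M' hM']; exists (M + M') => x.
by apply: le_trans (ler_normD _ _) _; exact: lerD.
Qed.

Lemma bounded_funM f g : bounded_fun f -> bounded_fun g -> bounded_fun (fun x => f x * g x).
Proof.
move=> [M hM] [M' hM']; exists (M * M') => x; rewrite normrM; exact: ler_pM.
Qed.

Lemma bounded_cst (c : R) : bounded_fun (fun _ : K => c). Proof. by exists `|c|. Qed.

Lemma bounded_comp f (u : K -> K) : bounded_fun f -> bounded_fun (fun x => f (u x)).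
Proof. by move=> [M hM]; exists M. Qed.

Lemma ucontD f g : ucont f -> ucont g -> ucont (fun x => f x + g x).
Proof.
move=> uf ug e e0; have e2 : 0 < e / 2 by lra.
have [Q Q0 hO] := uf _ e2; have [Q' Q'0 hO'] := ug _ e2.
exists (Q `&` Q'); first exact: filterI.
move=> x y [/hO h /hO' h']; have -> : f x + g x - (f y + g y) = (f x - f y) + (g x - g y) by ring.
by apply: le_trans (ler_normD _ _) _; lra.
Qed.

Lemma ucontZ (c : R) f : ucont f -> ucont (fun x => c * f x).
Proof.
move=> uf e e0; have c1 : 0 < `|c| + 1 by rewrite ltr_pwDr.
have [Q Q0 hO] := uf (e / (`|c| + 1)) (divr_gt0 e0 c1).
exists Q => // x y /hO h; rewrite -mulrBr normrM.
apply: (@le_trans _ _ ((`|c| + 1) * (e / (`|c| + 1)))); last by rewrite mulrC divfK ?gt_eqF.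
by apply: ler_pM => //; rewrite lerDl.
Qed.

Lemma ucont_shift f a : ucont f -> ucont (fun x => f (x + a)).
Proof.
move=> uf e e0; have [Q Q0 hO] := uf _ e0; exists Q => // x y h; apply: hO.
by have -> : x + a - (y + a) = x - y by zmodule.
Qed.

Lemma ucont_opp f : ucont f -> ucont (fun x => f (- x)).
Proof.
move=> uf e e0; have [Q Q0 hO] := uf _ e0; have [V [V0 VN VO _]] := nbhs0_add Q0.
exists V => // x y /VN/VO h; apply: hO.
by have -> : - x - - y = - (x - y) by zmodule.
Qed.

Lemma ucont_limit f : (forall e : R, 0 < e -> exists2 g, ucont g & forall x, `|g x - f x| <= e) -> ucont f.
Proof.
move=> h e e0; have e3 : 0 < e / 3 by lra.
have [g ug gf] := h _ e3; have [Q Q0 hO] := ug _ e3; exists Q => // x y /hO gxy.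
have -> : f x - f y = (f x - g x) + (g x - g y) + (g y - f y) by ring.
apply: le_trans (ler_normD _ _) _; have := gf y; have := gf x; rewrite distrC.
by have := ler_normD (f x - g x) (g x - g y); lra.
Qed.

End UniformlyContinuous.

Section InvariantMean.
Context (R : realType) (K : zmodType).

(** A substitute for Haar integration. Being only finitely additive, it gets Fubini's theorem and
    strict positivity from uniform continuity over a totally bounded group, in [mean_fubini] and
    [mean_sqr_eq0]. *)
Record is_mean (m : (K -> R) -> R) : Prop := IsMean {
  meanD : forall f g, bounded_fun f -> bounded_fun g -> m (fun x => f x + g x) = m f + m g;
  meanZ : forall c f, bounded_fun f -> m (fun x => c * f x) = c * m f;
  mean_le : forall f g, bounded_fun f -> bounded_fun g -> (forall x, f x <= g x) -> m f <= m g;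
  mean1 : m (fun=> 1) = 1;
  mean_shift : forall f a, bounded_fun f -> m (fun x => f (x + a)) = m f;
  mean_opp : forall f, bounded_fun f -> m (fun x => f (- x)) = m f }.

Lemma exists_mean : exists m, is_mean m.
Proof.
have [m [mD mZ mle m1 msh]] := exists_shift_mean R (subgroup_setT K).
have bo (f : K -> R) : bounded_fun f -> bounded_fun (fun x => f (- x)) by move=> [M hM]; exists M.
exists (fun f => (m f + m (fun x => f (- x))) / 2); split.
- move=> f g bf bg; rewrite mD// (mD (fun x => f (- x)))//; try exact: bo.
  by field.
- by move=> c f bf; rewrite mZ// (mZ _ (fun x => f (- x)))//; [field|exact: bo].
- move=> f g bf bg fg; rewrite ler_pM2r ?invr_gt0//; apply: lerD; first by apply: mle.
  by apply: mle => //; exact: bo.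
- by rewrite m1; field.
- move=> f a bf; rewrite msh//; congr ((_ + _) / _).
  rewrite -(msh (fun x => f (- x)) (- a))//; last exact: bo.
  by congr m; apply/funext => x; congr f; zmodule.
- move=> f bf; rewrite [X in (_ + X) / _](_ : _ = m f); first by rewrite addrC.
  by congr m; apply/funext => x; rewrite opprK.
Qed.

Context (m : (K -> R) -> R) (hm : is_mean m).
Implicit Types f g : K -> R.

Lemma mean_cst c : m (fun=> c) = c.
Proof.
rewrite (_ : (fun=> c) = (fun x => c * 1)); last by apply/funext => ?; rewrite mulr1.
by rewrite (meanZ hm) ?(mean1 hm) ?mulr1//; exists 1 => ?; rewrite normr1.
Qed.

Lemma mean_norm f M : bounded_fun f -> (forall x, `|f x| <= M) -> `|m f| <= M.
Proof.
move=> bf hM; have bc c : bounded_fun (fun _ : K => c : R) by exists `|c|.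
rewrite ler_norml -{1}(mean_cst (- M)) -{2}(mean_cst M); apply/andP; split;
  by apply: (mean_le hm) => // x; have := hM x; rewrite ler_norml => /andP[].
Qed.

Lemma meanB f g : bounded_fun f -> bounded_fun g -> m (fun x => f x - g x) = m f - m g.
Proof.
move=> bf bg; have -> : (fun x => f x - g x) = (fun x => f x + (-1) * g x).
  by apply/funext => x; rewrite mulN1r.
have [M hM] := bg.
rewrite (meanD hm) ?(meanZ hm) ?mulN1r//.
by exists M => x; rewrite mulN1r normrN.
Qed.

Lemma mean_ge0 f : bounded_fun f -> (forall x, 0 <= f x) -> 0 <= m f.
Proof. by move=> bf f0; rewrite -(mean_cst 0); apply: (mean_le hm) => //; exists 0 => ?; rewrite normr0. Qed.

Lemma mean_sum n (F : nat -> K -> R) : (forall i, bounded_fun (F i)) ->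
  m (fun x => \sum_(i < n) F i x) = \sum_(i < n) m (F i) /\
  bounded_fun (fun x => \sum_(i < n) F i x).
Proof.
move=> bF; elim: n => [|n [IH bn]].
  have -> : (fun x => \sum_(i < 0) F i x) = (fun=> 0) by apply/funext => x; rewrite big_ord0.
  by rewrite big_ord0 mean_cst; split=> //; exists 0 => ?; rewrite normr0.
have -> : (fun x => \sum_(i < n.+1) F i x) = (fun x => \sum_(i < n) F i x + F n x).
  by apply/funext => x; rewrite big_ord_recr.
have [M hM] := bn; have [M' hM'] := bF n.
rewrite big_ord_recr /= -IH; split; first by rewrite (meanD hm).
by exists (M + M') => x; apply: le_trans (ler_normD _ _) _; exact: lerD.
Qed.

Lemma mean_CS f g : bounded_fun f -> bounded_fun g ->
  m (fun x => f x * g x) ^+ 2 <= m (fun x => f x ^+ 2) * m (fun x => g x ^+ 2).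
Proof.
move=> bf bg; have [M hM] := bf; have [M' hM'] := bg.
have bM u v : bounded_fun u -> bounded_fun v -> bounded_fun (fun x : K => u x * v x : R).
  by move=> [N hN] [N' hN']; exists (N * N') => x; rewrite normrM; exact: ler_pM.
have bZ c u : bounded_fun u -> bounded_fun (fun x : K => c * u x : R).
  by move=> [N hN]; exists (`|c| * N) => x; rewrite normrM ler_wpM2l.
have bD u v : bounded_fun u -> bounded_fun v -> bounded_fun (fun x : K => u x + v x : R).
  by move=> [N hN] [N' hN']; exists (N + N') => x; apply: le_trans (ler_normD _ _) _; exact: lerD.
have bff : bounded_fun (fun x => f x ^+ 2) by apply: bM.
have bgg : bounded_fun (fun x => g x ^+ 2) by apply: bM.
have bfg : bounded_fun (fun x => f x * g x) by apply: bM.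
set A := m (fun x => f x ^+ 2); set B := m (fun x => f x * g x); set C := m (fun x => g x ^+ 2).
have quad t : 0 <= A + t * (2 * B) + t ^+ 2 * C.
  have -> : A + t * (2 * B) + t ^+ 2 * C = m (fun x => f x ^+ 2 + (2 * t) * (f x * g x) + t ^+ 2 * g x ^+ 2).
    rewrite (meanD hm) ?(meanD hm) ?(meanZ hm)//; first by rewrite /A /B /C; ring.
    all: try by apply: bZ.
    by apply: bD => //; exact: bZ.
  apply: mean_ge0; first by refine (bD _ _ (bD _ _ bff (bZ _ _ bfg)) (bZ _ _ bgg)).
  move=> x; have -> : f x ^+ 2 + 2 * t * (f x * g x) + t ^+ 2 * g x ^+ 2 = (f x + t * g x) ^+ 2 by ring.
  exact: sqr_ge0.
have C0 : 0 <= C by apply: mean_ge0 => // x; exact: sqr_ge0.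
have [C00|C1] := eqVneq C 0.
  rewrite C00 mulr0; have [->|B0] := eqVneq B 0; first by rewrite expr0n.
  have := quad (- (A + 1) / (2 * B)).
  have -> : A + - (A + 1) / (2 * B) * (2 * B) + (- (A + 1) / (2 * B)) ^+ 2 * C = -1.
    by rewrite C00; field; rewrite B0.
  by lra.
have Cp : 0 < C by rewrite lt_def C1.
have := quad (- B / C); have -> : A + - B / C * (2 * B) + (- B / C) ^+ 2 * C = A - B ^+ 2 / C by field.
by rewrite subr_ge0 ler_pdivrMr.
Qed.

End InvariantMean.

Section Convolution.
Context (R : realType) (K : topologicalZmodType).
Hypothesis Ktb : totally_bounded [set: K].
Context (m : (K -> R) -> R) (hm : is_mean m).
Implicit Types f g h : K -> R.

(** Replacing [y] by the centre of a cell containing it changes [F] by at most [e] and turns it into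
    a finite sum of products, for which linearity exchanges the means. *)
Lemma mean_fubini (F : K -> K -> R) (M : R) :
  (forall x y, `|F x y| <= M) ->
  (forall e, 0 < e -> exists2 Q, nbhs (0 : K) Q &
     forall x y y', Q (y - y') -> `|F x y - F x y'| <= e) ->
  m (fun x => m (F x)) = m (fun y => m (F^~ y)).
Proof.
move=> FM uF.
have bF x : bounded_fun (F x) by exists M.
have bF' y : bounded_fun (F^~ y) by exists M.
have bm : bounded_fun (fun x => m (F x)) by exists M => x; exact: mean_norm.
have bm' : bounded_fun (fun y => m (F^~ y)) by exists M => y; exact: mean_norm.
suff h e : 0 < e -> `|m (fun x => m (F x)) - m (fun y => m (F^~ y))| <= 2 * e.
  apply/eqP; rewrite -subr_eq0 -normr_le0 leNgt; apply/negP => d0.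
  by have := h _ (divr_gt0 d0 (_ : 0 < 4)); lra.
move=> e0; have [Q Q0 hO] := uF _ e0; have [L hL] := Ktb Q0.
have /choice[k hk] : forall y, exists k, (k < size L)%N /\ Q (y - nth 0 L k).
  move=> y; have [z zL Oz] := hL y I; exists (index z L).
  by rewrite index_mem nth_index.
pose p (i : nat) y : R := (k y == i)%:R.
have bp i : bounded_fun (p i) by exists 1 => y; rewrite /p; case: (_ == _); rewrite ?normr1 ?normr0.
pose G x y := \sum_(i < size L) F x (nth 0 L i) * p i y.
have GE x y : G x y = F x (nth 0 L (k y)).
  rewrite /G (bigD1 (Ordinal (hk y).1)) //= /p eqxx mulr1 big1 ?addr0// => i.
  by rewrite -val_eqE /= eq_sym => /negPf ->; rewrite mulr0.
have bG x : bounded_fun (G x) by exists M => y; rewrite GE.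
have bG' y : bounded_fun (G^~ y) by exists M => x; rewrite GE.
have FG x y : `|F x y - G x y| <= e by rewrite GE; apply: hO; exact: (hk y).2.
have bFp i x : bounded_fun (fun y => F x (nth 0 L i) * p i y).
  have [N hN] := bp i; exists (M * N) => y; rewrite normrM; exact: ler_pM.
have bpF i y : bounded_fun (fun x => F x (nth 0 L i) * p i y).
  have [N hN] := bp i; exists (M * N) => x; rewrite normrM; exact: ler_pM.
have mG x : m (G x) = \sum_(i < size L) m (p i) * F x (nth 0 L i).
  rewrite (mean_sum hm (size L) (fun i => bFp i x)).1; apply: eq_bigr => i _.
  by rewrite (meanZ hm)// mulrC.
have mG' y : m (G^~ y) = \sum_(i < size L) m (F^~ (nth 0 L i)) * p i y.
  rewrite (mean_sum hm (size L) (fun i => bpF i y)).1; apply: eq_bigr => i _.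
  have -> : (fun x => F x (nth 0 L i) * p i y) = (fun x => p i y * F x (nth 0 L i)).
    by apply/funext => x; rewrite mulrC.
  by rewrite (meanZ hm)// mulrC.
have bmG : bounded_fun (fun x => m (G x)) by exists M => x; apply: mean_norm => // y; rewrite GE.
have bmG' : bounded_fun (fun y => m (G^~ y)) by exists M => y; apply: mean_norm => // x; rewrite GE.
have bMc (c : R) (u : K -> R) : bounded_fun u -> bounded_fun (fun x => c * u x).
  by move=> [N hN]; exists (`|c| * N) => x; rewrite normrM ler_wpM2l.
have eG : m (fun x => m (G x)) = m (fun y => m (G^~ y)).
  have -> : (fun x => m (G x)) = (fun x => \sum_(i < size L) m (p i) * F x (nth 0 L i)) by apply/funext.
  have -> : (fun y => m (G^~ y)) = (fun y => \sum_(i < size L) m (F^~ (nth 0 L i)) * p i y) by apply/funext.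
  rewrite (mean_sum hm (size L) (fun i => bMc (m (p i)) _ (bF' (nth 0 L i)))).1.
  rewrite (mean_sum hm (size L) (fun i => bMc (m (F^~ (nth 0 L i))) _ (bp i))).1.
  by apply: eq_bigr => i _; rewrite !(meanZ hm)// mulrC.
have d1 : `|m (fun x => m (F x)) - m (fun x => m (G x))| <= e.
  rewrite -(meanB hm)//; apply: (mean_norm hm).
    by have [N hN] := bm; have [N' hN'] := bmG; exists (N + N') => x;
      apply: le_trans (ler_normB _ _) _; exact: lerD.
  move=> x; rewrite -(meanB hm)//; apply: (mean_norm hm) => //.
  by exists e.
have d2 : `|m (fun y => m (F^~ y)) - m (fun y => m (G^~ y))| <= e.
  rewrite -(meanB hm)//; apply: (mean_norm hm).
    by have [N hN] := bm'; have [N' hN'] := bmG'; exists (N + N') => x;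
      apply: le_trans (ler_normB _ _) _; exact: lerD.
  move=> y; rewrite -(meanB hm)//; apply: (mean_norm hm) => //.
  by exists e.
rewrite eG in d1; move: d1 d2; set a := m _; set b := m _; set c := m _.
rewrite !ler_norml => /andP[? ?] /andP[? ?]; apply/andP; split; lra.
Qed.

Definition conv f g (x : K) : R := m (fun y => f y * g (x - y)).

Lemma conv_bounded_aux f g x : ucont f -> ucont g -> bounded_fun (fun y => f y * g (x - y)).
Proof.
move=> /(ucont_bounded Ktb)[M hM] /(ucont_bounded Ktb)[M' hM']; exists (M * M') => y.
by rewrite normrM; exact: ler_pM.
Qed.

Lemma conv_ucont f g : ucont f -> ucont g -> ucont (conv f g).
Proof.
move=> uf ug e e0; have [M hM] := ucont_bounded Ktb uf.
have M1 : 0 < M + 1 by have := le_trans (normr_ge0 _) (hM 0); lra.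
have [Q Q0 hO] := ug _ (divr_gt0 e0 M1); exists Q => // x x' Oxx'.
rewrite /conv -(meanB hm); try exact: conv_bounded_aux.
have bxx' y : `|f y * g (x - y) - f y * g (x' - y)| <= e.
  rewrite -mulrBr normrM; apply: (@le_trans _ _ ((M + 1) * (e / (M + 1)))).
    apply: ler_pM => //; first by have := hM y; lra.
    by apply: hO; have -> : x - y - (x' - y) = x - x' by zmodule.
  by rewrite mulrC divfK ?gt_eqF.
by apply: (mean_norm hm) => //; exists e.
Qed.

Lemma convDl f g h : ucont f -> ucont g -> ucont h ->
  conv (fun x => f x + g x) h = fun x => conv f h x + conv g h x.
Proof.
move=> uf ug uh; apply/funext => x; rewrite /conv -(meanD hm); try exact: conv_bounded_aux.
by congr m; apply/funext => y; rewrite mulrDl.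
Qed.

Lemma convZl c f g : ucont f -> ucont g ->
  conv (fun x => c * f x) g = fun x => c * conv f g x.
Proof.
move=> uf ug; apply/funext => x; rewrite /conv -(meanZ hm); last exact: conv_bounded_aux.
by congr m; apply/funext => y; rewrite mulrA.
Qed.

Lemma convC f g : ucont f -> ucont g -> conv f g = conv g f.
Proof.
move=> uf ug; apply/funext => x; rewrite /conv.
rewrite -(mean_opp hm); last exact: conv_bounded_aux.
rewrite -(mean_shift hm (- x)); last first.
  by have [N hN] := conv_bounded_aux x uf ug; exists N => y.
congr m; apply/funext => y; rewrite mulrC; congr (g _ * f _); zmodule.
Qed.

Lemma convDr f g h : ucont f -> ucont g -> ucont h ->
  conv h (fun x => f x + g x) = fun x => conv h f x + conv h g x.
Proof.
move=> uf ug uh; rewrite convC//; last exact: ucontD.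
by rewrite convDl// !(convC _ uh).
Qed.

Lemma convZr c f g : ucont f -> ucont g ->
  conv f (fun x => c * g x) = fun x => c * conv f g x.
Proof. by move=> uf ug; rewrite convC//; [rewrite convZl// convC|exact: ucontZ]. Qed.

Lemma conv_shift f g a : ucont f -> ucont g ->
  conv (fun x => f (x + a)) g = fun x => conv f g (x + a).
Proof.
move=> uf ug; apply/funext => x; rewrite /conv.
rewrite -(mean_shift hm (- a)); last by apply: conv_bounded_aux => //; exact: ucont_shift.
by congr m; apply/funext => y; congr (f _ * g _); zmodule.
Qed.

Lemma convA f g h : ucont f -> ucont g -> ucont h ->
  conv (conv f g) h = conv f (conv g h).
Proof.
move=> uf ug uh; apply/funext => z.
have [Mf hMf] := ucont_bounded Ktb uf; have [Mg hMg] := ucont_bounded Ktb ug.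
have [Mh hMh] := ucont_bounded Ktb uh.
have Mf0 := le_trans (normr_ge0 _) (hMf 0); have Mg0 := le_trans (normr_ge0 _) (hMg 0).
have Mh0 := le_trans (normr_ge0 _) (hMh 0).
pose F x y := f y * g (x - y) * h (z - x).
transitivity (m (fun x => m (F x))).
  congr m; apply/funext => x; rewrite /conv mulrC -(meanZ hm); last exact: conv_bounded_aux.
  by congr m; apply/funext => y; rewrite /F mulrC.
rewrite (@mean_fubini F (Mf * Mg * Mh)).
- congr m; apply/funext => y; rewrite /conv.
  rewrite -(meanZ hm); last exact: conv_bounded_aux.
  rewrite -[RHS](mean_shift hm (- y)); last first.
    have [N hN] := conv_bounded_aux (z - y) ug uh; exists (`|f y| * N) => w.
    by rewrite normrM; apply: ler_wpM2l => //; exact: hN.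
  congr m; apply/funext => x; rewrite /F -mulrA; congr (_ * (_ * h _)); zmodule.
- by move=> x y; rewrite /F !normrM; apply: ler_pM => //; rewrite ?mulr_ge0//; apply: ler_pM.
move=> e e0.
pose C := Mf + Mg + 1; pose D := (C * C + 1) * (Mh + 1) * 2.
have C1 : 0 < C by rewrite /C; lra.
have e'0 : 0 < e / ((Mf + Mg + 1) * (Mh + 1)) by rewrite divr_gt0// mulr_gt0//; lra.
set e' := e / _ in e'0.
have [Q Q0 hO] := uf _ e'0; have [Q' Q'0 hO'] := ug _ e'0.
have [V [V0 VN VO' _]] := nbhs0_add Q'0.
exists (Q `&` V); first exact: filterI.
move=> x y y' [/hO fyy' /VN/VO' gyy'].
have {}gyy' : `|g (x - y) - g (x - y')| <= e'.
  by apply: hO'; have -> : x - y - (x - y') = - (y - y') by zmodule.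
have -> : F x y - F x y' = ((f y - f y') * g (x - y) + f y' * (g (x - y) - g (x - y'))) * h (z - x).
  by rewrite /F; ring.
rewrite normrM; apply: (@le_trans _ _ ((e' * Mg + Mf * e') * Mh)).
  apply: ler_pM => //; apply: le_trans (ler_normD _ _) _; rewrite !normrM.
  by apply: lerD; apply: ler_pM.
have -> : e = e' * ((Mf + Mg + 1) * (Mh + 1)).
  by rewrite /e' divfK// gt_eqF// mulr_gt0//; lra.
have -> : (e' * Mg + Mf * e') * Mh = e' * ((Mf + Mg) * Mh) by ring.
by rewrite ler_pM2l//; apply: ler_pM; lra.
Qed.

Lemma conv_even f g : ucont f -> ucont g -> (forall x, f (- x) = f x) ->
  (forall x, g (- x) = g x) -> forall x, conv f g (- x) = conv f g x.
Proof.
move=> uf ug ef eg x; rewrite /conv -(mean_opp hm); last exact: conv_bounded_aux.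
congr m; apply/funext => y; rewrite ef -[in RHS]eg; congr (_ * g _); zmodule.
Qed.

Lemma conv_at0 f g : (forall x, g (- x) = g x) -> conv f g 0 = m (fun x => f x * g x).
Proof. by move=> eg; congr m; apply/funext => y; rewrite sub0r eg. Qed.

Lemma mean_sqr_shift g x : ucont g -> m (fun y => g (x - y) ^+ 2) = m (fun y => g y ^+ 2).
Proof.
move=> ug; have [M hM] := ucont_bounded Ktb ug.
have bg2 (u : K -> K) : bounded_fun (fun y => g (u y) ^+ 2).
  by exists (M ^+ 2) => y; rewrite normrX lerXn2r ?nnegrE ?(le_trans (normr_ge0 _) (hM 0)).
rewrite -(mean_opp hm); last exact: bg2.
rewrite -(mean_shift hm (- x)); last exact: (bg2 (fun y => x - - y)).
by congr m; apply/funext => y; congr (g _ ^+ 2); zmodule.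
Qed.

Lemma conv_CS f g x : ucont f -> ucont g ->
  conv f g x ^+ 2 <= m (fun y => f y ^+ 2) * m (fun y => g y ^+ 2).
Proof.
move=> uf ug; rewrite -(mean_sqr_shift x ug); apply: (@mean_CS _ _ _ hm f (fun y => g (x - y))).
  exact: (ucont_bounded Ktb uf).
by have [M hM] := ucont_bounded Ktb ug; exists M.
Qed.

Lemma bounded_sqr f : ucont f -> bounded_fun (fun x => f x ^+ 2).
Proof. by move=> /(ucont_bounded Ktb) bf; exact: bounded_funM. Qed.

(** If [f x] is nonzero, the square of [f] is bounded below by [d] near [x]. Finitely many
    translates of it then add up to at least [d] everywhere, although each has mean zero. *)
Lemma mean_sqr_eq0 f : ucont f -> m (fun x => f x ^+ 2) = 0 -> forall x, f x = 0.
Proof.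
move=> uf m0 x; apply/eqP/negPn/negP => fx0.
have d0 : 0 < `|f x| / 2 by rewrite divr_gt0 ?normr_gt0.
have [Q Q0 hO] := uf _ d0; have [V [V0 VN VO _]] := nbhs0_add Q0.
have [F hF] := Ktb V0; pose d := (`|f x| / 2) ^+ 2.
have dp : 0 < d by rewrite exprn_gt0.
have hs y : exists2 z, z \in F & d <= f (x + y - z) ^+ 2.
  have [z zF /VO Oz] := hF y I; exists z => //.
  have fz : `|f (x + y - z) - f x| <= `|f x| / 2.
    by apply: hO; have -> : x + y - z - x = y - z by zmodule.
  rewrite -[leRHS]real_normK ?num_real// /d ler_pXn2r ?nnegrE ?divr_ge0//.
  have := ler_normD (f x - f (x + y - z)) (f (x + y - z)); rewrite subrK distrC; lra.
pose G (i : nat) (y : K) := f (x + y - nth 0 F i) ^+ 2.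
have bG i : bounded_fun (G i).
  by have [M hM] := bounded_sqr uf; exists M => y; exact: hM.
have mG i : m (G i) = 0.
  rewrite -m0 -[RHS](mean_shift hm (x - nth 0 F i)); last exact: bounded_sqr.
  by congr m; apply/funext => y; congr (f _ ^+ 2); zmodule.
have [ms bs] := mean_sum hm (size F) bG.
have : d <= m (fun y => \sum_(i < size F) G i y).
  rewrite -[leLHS](mean_cst hm); apply: (mean_le hm) => //; first exact: bounded_cst.
  move=> y; have [z zF dz] := hs y; have zi : (index z F < size F)%N by rewrite index_mem.
  rewrite (bigD1 (Ordinal zi)) //= /G nth_index//.
  by apply: le_trans dz _; rewrite lerDl sumr_ge0// => i _; exact: sqr_ge0.
by rewrite ms big1 => [|i _]; [lra|exact: mG].
Qed.

Lemma conv_limit f g (u : nat -> K -> R) : ucont f -> ucont g -> (forall n, ucont (u n)) ->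
  (forall e, 0 < e -> exists N, forall n, (N <= n)%N -> forall x, `|u n x - g x| <= e) ->
  forall e, 0 < e -> exists N, forall n, (N <= n)%N -> forall x, `|conv f (u n) x - conv f g x| <= e.
Proof.
move=> uf ug uu lim e e0; have [M hM] := ucont_bounded Ktb uf.
have M1 : 0 < M + 1 by have := le_trans (normr_ge0 _) (hM 0); lra.
have [N hN] := lim _ (divr_gt0 e0 M1); exists N => n Nn x.
rewrite /conv -(meanB hm); try exact: conv_bounded_aux.
have b y : `|f y * u n (x - y) - f y * g (x - y)| <= e.
  rewrite -mulrBr normrM; apply: (@le_trans _ _ ((M + 1) * (e / (M + 1)))).
    by apply: ler_pM => //; [have := hM y; lra|exact: hN].
  by rewrite mulrC divfK ?gt_eqF.
by apply: (mean_norm hm) => //; exists e.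
Qed.

End Convolution.

(** * Idempotents of the convolution algebra *)

Section RealSequences.
Context (R : realType).

Lemma nondecreasing_sup (u : nat -> R) (M : R) : (forall n, u n <= u n.+1) -> (forall n, u n <= M) ->
  exists l, (forall n, u n <= l) /\ forall e, 0 < e -> exists N, forall n, (N <= n)%N -> l - e < u n.
Proof.
move=> ui uM; have uh i j : (i <= j)%N -> u i <= u j.
  by elim: j => [|j IH]; [rewrite leqn0 => /eqP ->|rewrite leq_eqVlt => /predU1P[->//|/IH h]; exact: le_trans (ui j)].
have hs : has_sup (range u) by split; [exists (u 0%N), 0%N|exists M => _ [n _ <-]].
exists (sup (range u)); split=> [n|e e0]; first by apply: sup_upper_bound => //; exists n.
have [_ [N _ <-] hN] := sup_adherent e0 hs; exists N => n Nn.
exact: lt_le_trans hN (uh _ _ Nn).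
Qed.

Lemma real_cauchy (u : nat -> R) :
  (forall e, 0 < e -> exists N, forall i j, (N <= i)%N -> (N <= j)%N -> `|u i - u j| <= e) ->
  exists l, forall e, 0 < e -> exists N, forall n, (N <= n)%N -> `|u n - l| <= e.
Proof.
move=> h; have cu : cvg (u @ \oo).
  apply/cauchy_cvgP/cauchy_ballP => e e0; have e2 : 0 < e / 2 by lra.
  have [N hN] := h _ e2; rewrite !near_map2.
  exists ([set n | (N <= n)%N], [set n | (N <= n)%N]) => /=; first by split; exists N.
  move=> [i j] /= [Ni Nj]; rewrite /ball/=; apply: le_lt_trans (hN i j Ni Nj) _; lra.
exists (lim (u @ \oo)) => e e0; have /cvgrPdist_le/(_ e e0)[N _ hN] := cu.
by exists N => n Nn; rewrite distrC; exact: hN.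
Qed.

Lemma eq_approx (a b : R) : (forall e, 0 < e -> `|a - b| <= e) -> a = b.
Proof.
move=> h; apply/eqP; rewrite -subr_eq0 -normr_le0 leNgt; apply/negP => d0.
by have := h _ (divr_gt0 d0 (_ : 0 < 2)); lra.
Qed.

End RealSequences.

Section Idempotents.
Context (R : realType) (K : topologicalZmodType).
Hypothesis Ktb : totally_bounded [set: K].
Context (m : (K -> R) -> R) (hm : is_mean m).
Implicit Types f g h : K -> R.
Local Notation "f ** g" := (conv m f g) (at level 40, left associativity).

(** Evenness makes convolution by [f] self-adjoint and turns [(f ** g) 0] into the inner product of
    [f] and [g]. *)
Definition evenuc f : Prop := ucont f /\ forall x, f (- x) = f x.

Lemma evenuc_conv f g : evenuc f -> evenuc g -> evenuc (f ** g).
Proof.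
by move=> [uf ef] [ug eg]; split; [exact: (conv_ucont Ktb hm)|exact: (conv_even Ktb hm)].
Qed.

Lemma evenucD f g : evenuc f -> evenuc g -> evenuc (fun x => f x + g x).
Proof. by move=> [uf ef] [ug eg]; split; [exact: ucontD|move=> x; rewrite ef eg]. Qed.

Lemma evenucZ c f : evenuc f -> evenuc (fun x => c * f x).
Proof. by move=> [uf ef]; split; [exact: ucontZ|move=> x; rewrite ef]. Qed.

(** The convolution power with [n + 1] factors, since there is no unit; hence the successor in
    [cpow_add]. *)
Fixpoint cpow f n : K -> R := if n is k.+1 then f ** cpow f k else f.

Lemma cpow_evenuc f n : evenuc f -> evenuc (cpow f n).
Proof. by move=> ef; elim: n => //= n IH; exact: evenuc_conv. Qed.

Lemma cpow_add f i j : evenuc f -> cpow f i ** cpow f j = cpow f (i + j).+1.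
Proof.
move=> ef; have uf n := (cpow_evenuc n ef).1.
elim: i => [|i IH] //=; rewrite (convA Ktb hm) ?IH//; exact: ef.1.
Qed.

Lemma cpow_inner f i j : evenuc f -> m (fun x => cpow f i x * cpow f j x) = cpow f (i + j).+1 0.
Proof. by move=> ef; rewrite -cpow_add// conv_at0//; exact: (cpow_evenuc j ef).2. Qed.

Lemma idem_bound (e : K -> R) : evenuc e -> e ** e = e -> forall x, `|e x| <= e 0.
Proof.
move=> [ue ee] eI x; have e0 : e 0 = m (fun y => e y ^+ 2) by rewrite -{1}eI conv_at0.
have e00 : 0 <= e 0 by rewrite e0; apply: (mean_ge0 hm) => [|y]; [exact: (bounded_sqr Ktb)|exact: sqr_ge0].
rewrite -(@ler_pXn2r _ 2) ?nnegrE// real_normK ?num_real//.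
by rewrite -{1}eI; apply: le_trans (conv_CS Ktb hm x ue ue) _; rewrite -e0.
Qed.

(** Idempotence makes [e 0] the mean of [e ^+ 2], and [idem_bound] bounds this mean by
    [(e 0) ^+ 2]. *)
Lemma idem_ge1 (e : K -> R) : evenuc e -> e ** e = e -> (exists x, e x <> 0) -> 1 <= e 0.
Proof.
move=> ee eI [x ex]; have [ue ev] := ee.
have e0 : e 0 = m (fun y => e y ^+ 2) by rewrite -{1}eI conv_at0.
have e00 : 0 <= e 0 by rewrite e0; apply: (mean_ge0 hm) => [|y]; [exact: (bounded_sqr Ktb)|exact: sqr_ge0].
have e0p : 0 < e 0.
  rewrite lt_def e00 andbT; apply/eqP => e0'; apply: ex.
  by apply: (mean_sqr_eq0 Ktb hm ue); rewrite -e0.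
have : e 0 <= e 0 ^+ 2.
  rewrite {1}e0 -[leRHS](mean_cst hm); apply: (mean_le hm); [exact: (bounded_sqr Ktb)|exact: bounded_cst|].
  move=> y; rewrite -[leLHS]real_normK ?num_real// ler_pXn2r ?nnegrE//; exact: idem_bound.
by rewrite expr2 -{1}[e 0]mulr1 ler_pM2l.
Qed.

(* The even convolution powers of [f], divided by the powers of their growth rate,
   converge uniformly to an idempotent: the projection onto the top eigenspace. *)
Lemma idem_of f : evenuc f -> (exists x, f x <> 0) ->
  exists lam psi, [/\ 0 < lam, evenuc psi, psi ** psi = psi, 1 <= psi 0 &
    (f ** f) ** psi = fun x => lam * psi x].
Proof.
move=> ef [x0 fx0]; have uf := ef.1.
pose q n := cpow f n; have eq n : evenuc (q n) by exact: cpow_evenuc.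
pose a n := m (fun x => q n x ^+ 2).
have aE n : a n = q (n + n).+1 0 by rewrite /q -cpow_inner.
have bq n : bounded_fun (fun x => q n x ^+ 2) by exact: (bounded_sqr Ktb (eq n).1).
have a_ge0 n : 0 <= a n by apply: (mean_ge0 hm) => // x; exact: sqr_ge0.
have a_neq0 n x : q n x <> 0 -> 0 < a n.
  move=> qx; rewrite lt_def a_ge0 andbT; apply/eqP => an0; apply: qx.
  exact: (mean_sqr_eq0 Ktb hm (eq n).1 an0).
have inner i j : m (fun x => q i x * q j x) = q (i + j).+1 0 by exact: cpow_inner.
have logconv n : a n.+1 ^+ 2 <= a n * a n.+2.
  have -> : a n.+1 = m (fun x => q n x * q n.+2 x) by rewrite inner aE; congr (q _ 0); lia.
  by apply: (mean_CS hm); exact: (ucont_bounded Ktb (eq _).1).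
have a0 : 0 < a 0%N by exact: (@a_neq0 0%N x0 fx0).
have a1 : 0 < a 1%N.
  apply: (@a_neq0 1%N 0); have -> : q 1%N 0 = a 0%N by rewrite aE.
  by apply/eqP; rewrite gt_eqF.
have ap n : 0 < a n /\ 0 < a n.+1.
  elim: n => [//|n [an an1]]; split=> //; rewrite ltNge; apply/negP => h.
  have := logconv n; rewrite leNgt => /negP; apply.
  apply: (@le_lt_trans _ _ 0); last by rewrite exprn_gt0.
  by rewrite pmulr_rle0.
have {ap} ap n : 0 < a n by have [] := ap n.
(* Cauchy-Schwarz makes [a] log-convex, so these ratios increase. Their limit [lam] is the
   eigenvalue of [f ** f] on the idempotent to be built. *)
pose r n := a n.+1 / a n.
have rp n : 0 < r n by rewrite divr_gt0.
have ri n : r n <= r n.+1.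
  rewrite /r ler_pdivrMr// mulrAC ler_pdivlMr// -expr2 mulrC; exact: logconv.
have ra n : r n <= a 0%N.
  rewrite /r ler_pdivrMr// -[leRHS](mean_cst hm); apply: (mean_le hm) => //; first exact: bounded_cst.
  by move=> x; apply: (conv_CS Ktb hm) => //; exact: (eq n).1.
have [lam [rlam lamr]] := nondecreasing_sup ri ra.
have lam0 : 0 < lam by exact: lt_le_trans (rp 0%N) (rlam 0%N).
have lamX n : 0 < lam ^+ n by rewrite exprn_gt0.
pose B n := a n / lam ^+ n.+1.
have Bp n : 0 < B n by rewrite divr_gt0.
have BS n : B n.+1 = B n * (r n / lam).
  have h1 : a n != 0 by rewrite gt_eqF.
  have h2 : lam != 0 by rewrite gt_eqF.
  have h3 : lam ^+ n.+1 != 0 by rewrite gt_eqF.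
  rewrite /B /r [lam ^+ n.+2]exprS; move: (lam ^+ n.+1) h3 => X h3.
  by field; rewrite ?h1 ?h2 ?h3.
have Bdec n : B n.+1 <= B n.
  by rewrite BS ger_pMr// ler_pdivrMr// mul1r.
have Bsq n : B (n + n).+1 <= B n ^+ 2.
  have : a (n + n).+1 <= a n ^+ 2.
    rewrite -[leRHS](mean_cst hm); apply: (mean_le hm) => //; first exact: bounded_cst.
    move=> x; rewrite [a n ^+ 2]expr2 -[q (n + n).+1](cpow_add n n ef).
    by apply: (conv_CS Ktb hm); exact: (eq n).1.
  have -> : B n ^+ 2 = a n ^+ 2 / lam ^+ (n + n).+2.
    by rewrite /B expr_div_n -exprM; congr (_ / lam ^+ _); lia.
  by rewrite /B ler_pM2r ?invr_gt0.
have Bprod n k : B (n + k)%N >= B n * (r n / lam) ^+ k.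
  elim: k => [|k IH]; first by rewrite addn0 expr0 mulr1.
  rewrite addnS BS exprSr mulrA; apply: ler_pM => //.
  - by rewrite mulr_ge0 ?exprn_ge0 ?divr_ge0 ?ltW.
  - by rewrite divr_ge0 ?ltW.
  - rewrite ler_pM2r ?invr_gt0//.
    by elim: (k) => [|i IHi]; rewrite ?addn0// addnS; exact: le_trans (ri _).
have Bge n : 1 <= B n.
  rewrite leNgt; apply/negP => Bn1.
  (* Index [i] of [B] belongs to the exponent [i + 1]; with [N k + 1 = 2 ^ k * (n + 1)] the
     inequality [Bsq] squares the bound at each step. *)
  pose N k := (2 ^ k * n.+1).-1.
  have NS k : N k.+1 = (N k + N k).+1 by rewrite /N expnS; have := expn_gt0 2 k; lia.
  have BN k : B (N k) <= B n ^+ (2 ^ k).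
    elim: k => [|k IH]; first by rewrite /N expn0 mul1n expr1.
    have B0 i : 0 <= B i by exact: ltW.
    by rewrite NS; apply: le_trans (Bsq _) _; rewrite expnSr exprM ler_pXn2r ?nnegrE ?exprn_ge0 ?B0.
  (* With this [e] the ratio [t] satisfies [1 - t < (1 - B n) / (n + 1)], while the decay of [B]
     along [N] gives [t ^+ n.+1 <= B n]; Bernoulli's inequality excludes both at once. *)
  pose e := lam * ((1 - B n) / n.+1%:R).
  have e0 : 0 < e by rewrite mulr_gt0// divr_gt0// ?ltr0n// subr_gt0.
  have [M hM] := lamr _ e0.
  have MN : (M <= N M)%N by rewrite /N; have := ltn_expl M (isT : 1 < 2)%N; lia.
  have rho : 1 - (1 - B n) / n.+1%:R < r (N M) / lam.
    rewrite ltr_pdivlMr// mulrBl mul1r mulrC; exact: hM.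
  set t := r (N M) / lam in rho.
  have t0 : 0 < t by rewrite divr_gt0.
  have t1 : t <= 1 by rewrite ler_pdivrMr// mul1r.
  have h1 : B (N M) * t ^+ (N M).+1 <= B (N M) ^+ 2.
    by apply: le_trans (Bsq _); have := Bprod (N M) (N M).+1; rewrite addnS.
  have h2 : t ^+ (N M).+1 <= B (N M) by move: h1; rewrite expr2 ler_pM2l.
  have h3 : t ^+ (n.+1 * 2 ^ M) <= B n ^+ (2 ^ M).
    apply: le_trans (BN M); move: h2; rewrite /N prednK ?muln_gt0 ?expn_gt0//.
    by rewrite mulnC.
  have h4 : t ^+ n.+1 <= B n.
    have tn0 : 0 <= t ^+ n.+1 by rewrite exprn_ge0// ltW.
    have Bn0 : 0 <= B n by exact: ltW.
    by move: h3; rewrite exprM ler_pXn2r ?expn_gt0 ?nnegrE.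
  have bern k : 1 - k%:R * (1 - t) <= t ^+ k.
    elim: k => [|k IH]; first by rewrite mul0r subr0 expr0.
    rewrite exprS; apply: (@le_trans _ _ (t * (1 - k%:R * (1 - t)))).
      rewrite -natr1; have : 0 <= k%:R * (1 - t) ^+ 2 by rewrite mulr_ge0 ?sqr_ge0.
      by lra.
    by rewrite ler_pM2l.
  have := le_trans (bern n.+1) h4; rewrite leNgt => /negP; apply.
  have n0 : 0 < n.+1%:R :> R by rewrite ltr0n.
  have : (1 - t) < (1 - B n) / n.+1%:R by rewrite ltrBlDr addrC -ltrBlDr.
  rewrite ltr_pdivlMr// mulrC; move: (n.+1%:R * (1 - t)) => w; lra.
have Binc n j : (n <= j)%N -> B j <= B n.
  by elim: j => [|j IH]; [rewrite leqn0 => /eqP ->|rewrite leq_eqVlt => /predU1P[->//|/IH h]; exact: le_trans (Bdec j) h].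
have [|n|nb [Bnb nbB]] := @nondecreasing_sup R (fun n => - B n) 0.
- by move=> n; rewrite lerN2.
- by rewrite oppr_le0 ltW.
have Bcauchy e : 0 < e -> exists N, forall i j, (N <= i)%N -> (N <= j)%N -> `|B i - B j| <= e.
  move=> e0; have [N hN] := nbB _ e0; exists N => i j Ni Nj.
  have := hN i Ni; have := hN j Nj; have := Bnb i; have := Bnb j => *.
  by rewrite ler_norml; apply/andP; split; lra.
pose g n : K -> R := fun x => (lam ^+ n.+1)^-1 * q (n + n).+1 x.
have eg n : evenuc (g n) by apply: evenucZ.
have ginner i j : m (fun x => g i x * g j x) = B (i + j).+1.
  have -> : (fun x => g i x * g j x) =
      (fun x => (lam ^+ (i + j).+2)^-1 * (q (i + i).+1 x * q (j + j).+1 x)).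
    apply/funext => x; rewrite /g; have -> : lam ^+ (i + j).+2 = lam ^+ i.+1 * lam ^+ j.+1.
      by rewrite -exprD; congr (_ ^+ _); lia.
    by rewrite invfM; ring.
  rewrite (meanZ hm); last by apply: bounded_funM; exact: (ucont_bounded Ktb (eq _).1).
  by rewrite inner /B aE mulrC; congr (q _ 0 / _); lia.
have gstep n : (fun x => lam^-1 * (f ** f) x) ** g n = g n.+1.
  have uff : ucont (f ** f) by exact: (conv_ucont Ktb hm).
  rewrite (convZl Ktb hm) ?(convZr Ktb hm)//; try exact: (eq _).1; last exact: (eg n).1.
  apply/funext => x; rewrite /g [lam ^+ n.+2]exprS invfM -mulrA; congr (_ * (_ * _)).
  rewrite -[f ** f]/(cpow f 1) /q cpow_add//.
  by have -> : (1 + (n + n).+1).+1 = (n.+1 + n.+1).+1 by lia.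
have gdiff i j : m (fun x => (g i x - g j x) ^+ 2) = B (i + i).+1 - 2 * B (i + j).+1 + B (j + j).+1.
  have bgg i' j' : bounded_fun (fun x => g i' x * g j' x).
    by apply: bounded_funM; exact: (ucont_bounded Ktb (eg _).1).
  have -> : (fun x => (g i x - g j x) ^+ 2) =
      (fun x => (g i x * g i x + (-2) * (g i x * g j x)) + g j x * g j x).
    by apply/funext => x; ring.
  have bz : bounded_fun (fun x => (-2) * (g i x * g j x)).
    by apply: bounded_funM; [exact: bounded_cst|exact: bgg].
  rewrite (meanD hm) ?(meanD hm) ?(meanZ hm) ?ginner//; last exact: bounded_funD.
  by ring.
pose C := m (fun x => (lam^-1 * (f ** f) x) ^+ 2).
have C0 : 0 <= C.
  apply: (mean_ge0 hm) => [|x]; last exact: sqr_ge0.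
  by apply: (bounded_sqr Ktb); apply: ucontZ; exact: (conv_ucont Ktb hm).
(* [g i.+1 - g j.+1] is the convolution of [g i - g j] with a fixed function, so Cauchy-Schwarz
   turns convergence in mean square into uniform convergence. *)
have gcauchy e : 0 < e -> exists N, forall i j, (N <= i)%N -> (N <= j)%N -> forall x, `|g i x - g j x| <= e.
  move=> e0; have d0 : 0 < e ^+ 2 / (2 * (C + 1)) by rewrite divr_gt0 ?exprn_gt0//; lra.
  have [N hN] := Bcauchy _ d0; exists N.+1 => -[//|i] [//|j]; rewrite !ltnS => Ni Nj x.
  rewrite -(@ler_pXn2r _ 2) ?nnegrE ?(ltW e0)// real_normK ?num_real//.
  have -> : g i.+1 x - g j.+1 x = ((fun x => lam^-1 * (f ** f) x) ** (fun x => g i x + (-1) * g j x)) x.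
    have u1 : ucont (fun x => lam^-1 * (f ** f) x) by apply: ucontZ; exact: (conv_ucont Ktb hm).
    have ug j' : ucont (g j') := (eg j').1.
    have ug' : ucont (fun x => (-1) * g j x) by exact: ucontZ.
    rewrite (convDr Ktb hm (ug i) ug' u1) (convZr Ktb hm _ u1 (ug j)) !gstep.
    by rewrite mulN1r.
  apply: le_trans (conv_CS Ktb hm x _ _) _.
  - by apply: ucontZ; exact: (conv_ucont Ktb hm).
  - by apply: ucontD; [exact: (eg _).1|apply: ucontZ; exact: (eg _).1].
  have -> : (fun y => (g i y + (-1) * g j y) ^+ 2) = (fun y => (g i y - g j y) ^+ 2).
    by apply/funext => y; rewrite mulN1r.
  have h1 : `|B (i + i).+1 - B (i + j).+1| <= e ^+ 2 / (2 * (C + 1)) by apply: hN; lia.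
  have h2 : `|B (j + j).+1 - B (i + j).+1| <= e ^+ 2 / (2 * (C + 1)) by apply: hN; lia.
  rewrite gdiff -/C.
  have h3 : B (i + i).+1 - 2 * B (i + j).+1 + B (j + j).+1 <= e ^+ 2 / (C + 1).
    have -> : e ^+ 2 / (C + 1) = 2 * (e ^+ 2 / (2 * (C + 1))) by field; lra.
    by move: h1 h2; rewrite !ler_norml => /andP[? ?] /andP[? ?]; lra.
  have h4 : 0 <= B (i + i).+1 - 2 * B (i + j).+1 + B (j + j).+1.
    rewrite -gdiff; apply: (mean_ge0 hm) => [|y]; last exact: sqr_ge0.
    apply: (bounded_sqr Ktb) => //.
    have -> : (fun y => g i y - g j y) = (fun y => g i y + (-1) * g j y) by apply/funext => y; rewrite mulN1r.
    by apply: ucontD; [exact: (eg _).1|apply: ucontZ; exact: (eg _).1].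
  apply: (@le_trans _ _ ((C + 1) * (e ^+ 2 / (C + 1)))); last by rewrite mulrC divfK//; lra.
  by apply: ler_pM => //; lra.
have /choice[psi hpsi] : forall x, exists l, forall e, 0 < e -> exists N, forall n, (N <= n)%N -> `|g n x - l| <= e.
  move=> x; apply: real_cauchy => e /gcauchy[N hN]; exists N => i j Ni Nj; exact: hN.
have upsi e : 0 < e -> exists N, forall n, (N <= n)%N -> forall x, `|g n x - psi x| <= e.
  move=> e0; have e2 : 0 < e / 2 by lra.
  have [N hN] := gcauchy _ e2; exists N => n Nn x; have [N' hN'] := hpsi x _ e2.
  have h1 := hN n (maxn N N') Nn (leq_maxl _ _) x; have h2 := hN' (maxn N N') (leq_maxr _ _).
  by have := ler_normD (g n x - g (maxn N N') x) (g (maxn N N') x - psi x); rewrite subrKA; lra.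
have ucpsi : ucont psi.
  apply: ucont_limit => e /upsi[N hN]; exists (g N); first exact: (eg N).1.
  by move=> x; exact: hN.
have epsi : evenuc psi.
  split=> // x; apply: eq_approx => e e0; have e2 : 0 < e / 2 by lra.
  have [N hN] := upsi _ e2; have := hN N (leqnn _) x; have := hN N (leqnn _) (- x).
  rewrite (eg N).2 => h1 h2.
  have -> : psi (- x) - psi x = (g N x - psi x) - (g N x - psi (- x)) by ring.
  by apply: le_trans (ler_normB _ _) _; lra.
have gg i j : g i ** g j = g (i + j).+1.
  rewrite (convZl Ktb hm) ?(convZr Ktb hm)//; try exact: (eq _).1; last exact: (eg j).1.
  apply/funext => x; rewrite /g mulrA cpow_add//.
  have -> : lam ^+ (i + j).+2 = lam ^+ i.+1 * lam ^+ j.+1 by rewrite -exprD; congr (_ ^+ _); lia.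
  rewrite invfM.
  by have -> : ((i + i).+1 + (j + j).+1).+1 = ((i + j).+1 + (i + j).+1).+1 by lia.
have gpsi i : g i ** psi = psi.
  apply/funext => x; apply: eq_approx => e e0; have e2 : 0 < e / 2 by lra.
  have [N hN] := upsi _ e2.
  have [N' hN'] := conv_limit Ktb hm (eg i).1 ucpsi (fun n => (eg n).1) upsi e2.
  have h1 := hN' (maxn N N') (leq_maxr _ _) x.
  have h2 := hN (i + maxn N N').+1 (leq_trans (leq_maxl N N') (leqW (leq_addl _ _))) x.
  move: h1; rewrite gg => h1.
  have -> : (g i ** psi) x - psi x = (g (i + maxn N N').+1 x - psi x) - (g (i + maxn N N').+1 x - (g i ** psi) x) by ring.
  by apply: le_trans (ler_normB _ _) _; lra.
have uff : ucont (f ** f) by exact: (conv_ucont Ktb hm).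
exists lam, psi; split=> //.
- apply/funext => x; apply: eq_approx => e e0.
  have [N hN] := conv_limit Ktb hm ucpsi ucpsi (fun n => (eg n).1) upsi e0.
  have := hN N (leqnn _) x; rewrite (convC Ktb hm)// ?gpsi; last exact: (eg N).1.
  by rewrite distrC.
- rewrite leNgt; apply/negP => h; have e0 : 0 < (1 - psi 0) / 2 by lra.
  have [N hN] := upsi _ e0; have := hN N (leqnn _) 0.
  have -> : g N 0 = B N by rewrite /B aE mulrC.
  by rewrite ler_norml; have := Bge N; lra.
- have u1 : ucont (fun x => lam^-1 * (f ** f) x) by exact: ucontZ.
  have h : (fun x => lam^-1 * (f ** f) x) ** psi = psi.
    apply/funext => x; apply: eq_approx => e e0; have e2 : 0 < e / 2 by lra.
    have [N hN] := upsi _ e2.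
    have [N' hN'] := conv_limit Ktb hm u1 ucpsi (fun n => (eg n).1) upsi e2.
    have h1 := hN' (maxn N N') (leq_maxr _ _) x.
    have h2 := hN (maxn N N').+1 (leq_trans (leq_maxl N N') (leqnSn _)) x.
    move: h1; rewrite gstep => h1.
    have -> : ((fun x => lam^-1 * (f ** f) x) ** psi) x - psi x =
      (g (maxn N N').+1 x - psi x) - (g (maxn N N').+1 x - ((fun x => lam^-1 * (f ** f) x) ** psi) x) by ring.
    by apply: le_trans (ler_normB _ _) _; lra.
  apply/funext => x; rewrite -{2}h (convZl Ktb hm)//.
  by rewrite mulrA divff ?mul1r// gt_eqF.
Qed.

(* An idempotent of nearly minimal value at zero is minimal, because every nonzero
   idempotent is at least one there; the even functions it fixes are its multiples. *)
Lemma minimal_idem (psi : K -> R) : evenuc psi -> psi ** psi = psi -> (exists x, psi x <> 0) ->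
  exists e, [/\ evenuc e, e ** e = e, (exists x, e x <> 0), psi ** e = e &
    forall g, evenuc g -> g ** e = g -> exists k, forall x, g x = k * e x].
Proof.
move=> epsi psiI psi0.
pose E (e : K -> R) := [/\ evenuc e, e ** e = e, (exists x, e x <> 0) & psi ** e = e].
have Epsi : E psi by split.
have E1 e : E e -> 1 <= e 0 by move=> [ee eI e0 _]; exact: idem_ge1.
pose S := [set e 0 | e in E].
have hS : has_inf S by split; [exists (psi 0), psi|exists 1 => _ [e Ee <-]; exact: E1].
(* The margin 1 is the least value at zero of a nonzero idempotent, so nothing can be split off from
   [e]. *)
have [_ [e Ee <-] he] := inf_adherent (ltr01 : (0 : R) < 1) hS.
have [ee eI e0 pe] := Ee; exists e; split=> //.
have key g : evenuc g -> g ** e = g -> exists k, forall x, (g ** g) x = k * e x.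
  move=> eg ge; have [[x gx]|ng] := pselect (exists x, g x <> 0); last first.
    exists 0 => x; rewrite mul0r -(mean_cst hm 0) /conv; congr m; apply/funext => y.
    have -> : g y = 0 by apply: contrapT => gy; apply: ng; exists y.
    by rewrite mul0r.
  have [lam [psig [lam0 epg pgI pg1 hpg]]] := idem_of eg (ex_intro _ x gx).
  have ugg : ucont (g ** g) by apply: (conv_ucont Ktb hm); exact: eg.1.
  have gge : (g ** g) ** e = g ** g.
    by rewrite (convA Ktb hm) ?ge//; [exact: eg.1|exact: eg.1|exact: ee.1].
  have pge : psig ** e = psig.
    have hl : psig = (fun x => lam^-1 * ((g ** g) ** psig) x).
      by rewrite hpg; apply/funext => y; rewrite mulrA mulVf ?mul1r// gt_eqF.
    have u : ucont ((g ** g) ** psig) by apply: (conv_ucont Ktb hm) => //; exact: epg.1.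
    rewrite {1}hl (convZl Ktb hm)//; last exact: ee.1.
    rewrite (convC Ktb hm ugg epg.1) (convA Ktb hm epg.1 ugg ee.1) gge.
    by rewrite (convC Ktb hm epg.1 ugg) -hl.
  (* The difference of [e] and the smaller idempotent [psig] is idempotent. Were it nonzero, its
     value at zero would be at least 1, and [psig 0] would fall below the infimum. *)
  pose d x := e x + (-1) * psig x.
  have ed : evenuc d by apply: evenucD => //; exact: evenucZ.
  have pe' : e ** psig = psig by rewrite (convC Ktb hm)//; [exact: ee.1|exact: epg.1].
  have u1 : ucont (fun x => (-1) * psig x) by apply: ucontZ; exact: epg.1.
  have dI : d ** d = d.
    rewrite /d (convDl Ktb hm ee.1 u1 ed.1) (convDr Ktb hm ee.1 u1 ee.1) (convDr Ktb hm ee.1 u1 u1).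
    rewrite !(convZr Ktb hm) ?(convZl Ktb hm) ?eI ?pe' ?pge ?pgI//; try exact: ee.1; try exact: epg.1.
    by apply/funext => y; ring.
  have d0 y : d y = 0.
    apply: contrapT => dy; have d1 := idem_ge1 ed dI (ex_intro _ y dy).
    have : inf S <= psig 0.
      apply: (ge_inf hS.2); exists psig => //; split=> //.
        by exists 0; apply/eqP; rewrite gt_eqF//; lra.
      rewrite -{1}pe' -(convA Ktb hm) ?pe//; [exact: epsi.1|exact: ee.1|exact: epg.1].
    by move: d1; rewrite /d; lra.
  have -> : g ** g = (fun x => lam * e x).
    have epsig : e = psig by apply/funext => y; have := d0 y; rewrite /d; lra.
    by rewrite -gge epsig hpg.
  by exists lam.
move=> g eg ge; have [k hk] := key _ eg ge.
(* Polarisation: [key] controls squares, and the square of [g + e] contains [g] itself since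
   [g ** e = g]. *)
have eeg : evenuc (fun x => g x + e x) by exact: evenucD.
have [|k' hk'] := key _ eeg; first by rewrite (convDl Ktb hm) ?ge ?eI//; [exact: eg.1|exact: ee.1|exact: ee.1].
exists ((k' - k - 1) / 2) => x; have := hk' x.
rewrite (convDl Ktb hm eg.1 ee.1 eeg.1) (convDr Ktb hm eg.1 ee.1 eg.1) (convDr Ktb hm eg.1 ee.1 ee.1).
rewrite ge eI hk (convC Ktb hm ee.1 eg.1) ge => h.
have -> : (k' - k - 1) / 2 * e x = (k' * e x - k * e x - e x) / 2 by field.
by rewrite -h; field.
Qed.

(** [c] is a minimal idempotent [e] divided by [e 0]. As a function of [x], [e (x + a) + e (x - a)]
    is even and fixed by [e], hence a multiple of [e], which is d'Alembert's equation. *)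
Lemma exists_cosine f0 (x0 : K) : evenuc f0 -> f0 0 <> f0 x0 ->
  exists c : K -> R, [/\ ucont c, c 0 = 1, forall x, `|c x| <= 1,
    forall x y, c (x + y) + c (x - y) = 2 * c x * c y & c x0 <> 1].
Proof.
move=> ef0 f00; have uf0 := ef0.1.
(* A second difference along [x0]: convolution with it annihilates every such [e] with [e x0 = e 0],
   so idempotents obtained from [f] detect [x0]. *)
pose f x := (2 * f0 x + (-1) * f0 (x + x0)) + (-1) * f0 (x - x0).
have us a : ucont (fun x => (-1) * f0 (x + a)) by apply: ucontZ; exact: ucont_shift.
have ef : evenuc f.
  split; first by apply: ucontD => //; apply: ucontD => //; exact: ucontZ.
  move=> x; rewrite /f -(ef0.2 (- x + x0)) -(ef0.2 (- x - x0)) (ef0.2 x).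
  have -> : - (- x + x0) = x - x0 by zmodule.
  have -> : - (- x - x0) = x + x0 by zmodule.
  by ring.
have [M hM] := ucont_bounded Ktb uf0.
(* Otherwise [f0] would be affine with nonzero slope along the multiples of [x0], against its
   boundedness. *)
have fn0 : exists x, f x <> 0.
  apply: contrapT => nf; have f0x x : f x = 0 by apply: contrapT => fx; apply: nf; exists x.
  have step n : f0 (x0 *+ n.+1) - f0 (x0 *+ n) = f0 x0 - f0 0.
    elim: n => [|n IH]; first by rewrite mulr1n mulr0n.
    rewrite -IH; have := f0x (x0 *+ n.+1); rewrite /f.
    have -> : x0 *+ n.+1 + x0 = x0 *+ n.+2 by rewrite -mulrSr.
    have -> : x0 *+ n.+1 - x0 = x0 *+ n by rewrite mulrSr addrK.
    by lra.
  have lin n : f0 (x0 *+ n) = f0 0 + n%:R * (f0 x0 - f0 0).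
    elim: n => [|n IH]; first by rewrite mulr0n mul0r addr0.
    by have := step n; rewrite IH -natr1; lra.
  have d0 : 0 < `|f0 x0 - f0 0| by rewrite normr_gt0 subr_eq0; apply/eqP => h; apply: f00.
  pose n := (Num.trunc ((2 * M) / `|f0 x0 - f0 0|)).+1.
  have : `|n%:R * (f0 x0 - f0 0)| <= 2 * M.
    have -> : n%:R * (f0 x0 - f0 0) = f0 (x0 *+ n) - f0 0 by rewrite lin; ring.
    by apply: le_trans (ler_normB _ _) _; have := hM (x0 *+ n); have := hM 0; lra.
  rewrite normrM (ger0_norm (_ : 0 <= n%:R))// leNgt => /negP; apply.
  by rewrite -ltr_pdivrMr//; exact: truncnS_gt.
have [lam [psi [lam0 epsi psiI psi1 hpsi]]] := idem_of ef fn0.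
have [|e [ee eI [z ez] pe emin]] := minimal_idem epsi psiI.
  by exists 0; apply/eqP; rewrite gt_eqF//; lra.
have ue := ee.1; have e01 : 1 <= e 0 by apply: idem_ge1 => //; exists z.
have en0 : e 0 != 0 by rewrite gt_eqF//; lra.
have shift a x : e (x + a) + e (x - a) = 2 * (e a / e 0) * e x.
  pose g x := e (x + a) + e (x - a).
  have eg : evenuc g.
    split; first by apply: ucontD; exact: ucont_shift.
    move=> y; rewrite /g -(ee.2 (- y + a)) -(ee.2 (- y - a)).
    have -> : - (- y + a) = y - a by zmodule.
    have -> : - (- y - a) = y + a by zmodule.
    by rewrite addrC.
  have [|k hk] := emin _ eg.
    rewrite /g (convDl Ktb hm) ?(conv_shift Ktb hm) ?eI//; exact: ucont_shift.
  have h0 := hk 0; rewrite /g add0r sub0r ee.2 in h0.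
  have -> : e (x + a) + e (x - a) = g x by [].
  by rewrite hk; congr (_ * _); apply: (mulIf en0); rewrite -h0; field.
exists (fun x => (e 0)^-1 * e x); split.
- exact: ucontZ.
- by rewrite mulVf.
- move=> x; rewrite normrM normfV (ger0_norm (_ : 0 <= e 0)) ?(le_trans ler01)//.
  by rewrite ler_pdivrMl ?mulr1; [exact: idem_bound|lra].
- by move=> x y; rewrite -mulrDr shift; field.
move=> c1; have ex0 : e x0 = e 0 by rewrite -[e x0]mul1r -(divff en0) -mulrA c1 mulr1.
(* Under [e x0 = e 0] the shift identity cancels the second difference, yet [f ** f] acts on [e] as
   the positive scalar [lam]. *)
have fe : f ** e = (fun=> 0).
  rewrite /f (convDl Ktb hm) ?(convDl Ktb hm) ?(convZl Ktb hm) ?(conv_shift Ktb hm)//; try exact: ucont_shift.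
  all: try by apply: ucontD => //; exact: ucontZ.
  all: try exact: ucontZ.
  apply/funext => x; have := congr1 (fun u => u x) (conv_shift Ktb hm x0 ue uf0).
  have := congr1 (fun u => u x) (conv_shift Ktb hm (- x0) ue uf0) => /=.
  rewrite -!(convC Ktb hm uf0 ue) => <- <-.
  have -> : 2 * (f0 ** e) x + -1 * ((fun x => e (x + x0)) ** f0) x + -1 * ((fun x => e (x - x0)) ** f0) x =
     2 * (f0 ** e) x - ((fun x => e (x + x0) + e (x - x0)) ** f0) x.
    by rewrite (convDl Ktb hm (ucont_shift _ ue) (ucont_shift _ ue) uf0); ring.
  have -> : (fun x => e (x + x0) + e (x - x0)) = (fun x => 2 * e x).
    by apply/funext => y; rewrite shift ex0 divff// mulr1.
  by rewrite (convZl Ktb hm)// (convC Ktb hm ue uf0) subrr.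
have : lam * e 0 = 0.
  have -> : lam * e 0 = ((f ** f) ** e) 0.
    rewrite -pe -(convA Ktb hm) ?hpsi ?(convZl Ktb hm)//; try exact: epsi.1.
    by apply: (conv_ucont Ktb hm); exact: ef.1.
  rewrite (convA Ktb hm) ?fe//; try exact: ef.1.
  by rewrite /conv -[RHS](mean_cst hm); congr m; apply/funext => y; rewrite mulr0.
by apply/eqP; rewrite mulf_neq0// gt_eqF.
Qed.

End Idempotents.

(** * Trigonometry on the circle; characters separate points *)

Section CircleTrigonometry.
Context (R : realType).
Local Notation circle := (circle R).
Local Notation twopi := (pi *+ 2 : R).

Lemma twopi_gt0 : 0 < twopi. Proof. by rewrite pmulrn_lgt0 // pi_gt0. Qed.

Definition ccos (t : circle) : R := cos (twopi * tlift t).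
Definition csin (t : circle) : R := sin (twopi * tlift t).

Let cos_sin_int r (k : int) :
  cos (twopi * (r + k%:~R)) = cos (twopi * r) /\ sin (twopi * (r + k%:~R)) = sin (twopi * r).
Proof.
have pos s (n : nat) : cos (twopi * (s + n%:R)) = cos (twopi * s) /\
    sin (twopi * (s + n%:R)) = sin (twopi * s).
  have -> : twopi * (s + n%:R) = twopi * s + twopi *+ n by rewrite mulrDr mulr_natr.
  split; rewrite periodicn//; [exact: cosD2pi|exact: sinD2pi].
case: k => n; first exact: pos.
have [h1 h2] := pos (r + (Negz n)%:~R) n.+1.
have e : r + (Negz n)%:~R + n.+1%:R = r by rewrite NegzE rmorphN /= -pmulrn subrK.
by rewrite -h1 -h2 e.
Qed.

Lemma ccos_tpi r : ccos (tpi r) = cos (twopi * r).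
Proof.
have /tpi_eq[k hk] := tliftK (tpi r).
by rewrite /ccos (_ : tlift _ = r + k%:~R) ?(cos_sin_int _ _).1// -hk; ring.
Qed.

Lemma csin_tpi r : csin (tpi r) = sin (twopi * r).
Proof.
have /tpi_eq[k hk] := tliftK (tpi r).
by rewrite /csin (_ : tlift _ = r + k%:~R) ?(cos_sin_int _ _).2// -hk; ring.
Qed.

Lemma ccosD s t : ccos (s + t) = ccos s * ccos t - csin s * csin t.
Proof. by rewrite -{1}(tliftK s) -{1}(tliftK t) -tpiD ccos_tpi mulrDr cosD. Qed.

Lemma csinD s t : csin (s + t) = csin s * ccos t + ccos s * csin t.
Proof. by rewrite -{1}(tliftK s) -{1}(tliftK t) -tpiD csin_tpi mulrDr sinD. Qed.

Lemma ccosN t : ccos (- t) = ccos t.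
Proof. by rewrite -{1}(tliftK t) -raddfN ccos_tpi mulrN cosN. Qed.

Lemma csinN t : csin (- t) = - csin t.
Proof. by rewrite -{1}(tliftK t) -raddfN csin_tpi mulrN sinN. Qed.

Lemma ccos0 : ccos 0 = 1.
Proof. by rewrite -[0](raddf0 (@tpi R)) ccos_tpi mulr0 cos0. Qed.

Lemma ccos_add_sub s t : ccos (s + t) + ccos (s - t) = 2 * (ccos s * ccos t).
Proof. by rewrite !ccosD ccosN csinN; ring. Qed.

Lemma ccos_le1 t : ccos t <= 1. Proof. exact: cos_le1. Qed.
Lemma ccos_geN1 t : -1 <= ccos t. Proof. exact: cos_geN1. Qed.

Lemma ccos_norm t : ccos t = cos (twopi * cnorm t).
Proof. by rewrite /ccos -cos_norm normrM ger0_norm // ltW// twopi_gt0. Qed.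

Let cnorm_itv t : twopi * cnorm t \in `[0, pi].
Proof.
rewrite in_itv /=; apply/andP; split; first by rewrite mulr_ge0 ?cnorm_ge0 ?ltW ?twopi_gt0.
have : 0 <= pi * (2^-1 - cnorm t) by rewrite mulr_ge0 ?subr_ge0 ?pi_ge0 ?cnorm_half.
have -> : pi *+ 2 * cnorm t = pi - 2 * (pi * (2^-1 - cnorm t)) :> R by field.
by move=> h; rewrite lerBlDr lerDl mulr_ge0.
Qed.

Lemma ccos_eq1 t : ccos t = 1 -> t = 0.
Proof.
rewrite ccos_norm -cos0 => h; apply: cnorm_eq0.
have h0 : (0 : R) \in `[0, pi] by rewrite in_itv /= lexx pi_ge0.
have /eqP := cos_inj (cnorm_itv t) h0 h.
by rewrite mulf_eq0 gt_eqF ?twopi_gt0//= => /eqP.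
Qed.

Lemma ccos_small (e : R) : 0 < e -> exists2 d, 0 < d & forall t, 1 - d < ccos t -> cnorm t < e.
Proof.
move=> e0; have [e2|e2] := ltP 2^-1 e.
  by exists 1 => // t _; exact: le_lt_trans (cnorm_half t) e2.
have eE : e = cnorm (tpi e) \/ e = 2^-1.
  have [h|h] := ltP e 2^-1; last by right; lra.
  by left; rewrite /cnorm tlift_small ger0_norm// ?ltW.
have eI : twopi * e \in `[0, pi].
  case: eE => [->|->]; first exact: cnorm_itv.
  rewrite in_itv /= mulr2n; have := pi_gt0 R; lra.
have h0 : (0 : R) \in `[0, pi] by rewrite in_itv /= lexx pi_ge0.
exists (1 - cos (twopi * e)).
  by rewrite subr_gt0 -cos0 ltr_cos// mulr_gt0// twopi_gt0.
move=> t; rewrite subKr ccos_norm ltr_cos; [|exact: cnorm_itv|exact: eI].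
by rewrite ltr_pM2l// twopi_gt0.
Qed.

Lemma ccos_near (e : R) : 0 < e -> exists2 d, 0 < d & forall t, cnorm t < d -> 1 - e < ccos t.
Proof.
move=> e0; have : cos x @[x --> (0 : R)] --> (1 : R).
  by rewrite -[X in _ --> X]cos0; exact: continuous_cos.
move=> /cvgrPdist_lt/(_ _ e0)/nbhs_ballP[d /= d0 hd]; exists (d / twopi); first by rewrite divr_gt0 ?twopi_gt0.
move=> t; rewrite ltr_pdivlMr ?twopi_gt0// => td.
have := hd (twopi * cnorm t); rewrite /ball /= sub0r normrN ger0_norm; last first.
  by rewrite mulr_ge0 ?cnorm_ge0 ?ltW ?twopi_gt0.
rewrite mulrC => /(_ td); rewrite mulrC -ccos_norm ltr_norml; lra.
Qed.

Lemma circle_point (x y : R) : x ^+ 2 + y ^+ 2 = 1 -> exists t, ccos t = x /\ csin t = y.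
Proof.
move=> xy; have x1 : -1 <= x <= 1.
  by rewrite -ler_norml -(@ler_pXn2r _ 2) ?nnegrE// real_normK ?num_real// expr1n; have := sqr_ge0 y; lra.
have xI : x \in `[-1, 1] by rewrite in_itv.
have tp : twopi != 0 by rewrite gt_eqF ?twopi_gt0.
have s2 : Num.sqrt (1 - x ^+ 2) = `|y| by rewrite -xy addrC addKr sqrtr_sqr.
have [y0|y0] := leP 0 y.
  exists (tpi (acos x / twopi)); rewrite ccos_tpi csin_tpi mulrC divfK// acosK//; split=> //.
  by rewrite sin_acos// s2 ger0_norm.
exists (tpi (- (acos x / twopi))).
rewrite ccos_tpi csin_tpi mulrN mulrC divfK// cosN sinN acosK//; split=> //.
by rewrite sin_acos// s2 ltr0_norm// opprK.
Qed.

End CircleTrigonometry.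

Section Characters.
Context (R : realType) (K : topologicalZmodType).
Local Notation circle := (circle R).

Definition character (chi : K -> circle) : Prop :=
  (forall x y, chi (x - y) = chi x - chi y) /\
  forall e : R, 0 < e -> nbhs (0 : K) [set x | cnorm (chi x) < e].

Section HomTheory.
Context (chi : K -> circle) (hchi : forall x y, chi (x - y) = chi x - chi y).

Lemma hom0 : chi 0 = 0. Proof. by have := hchi 0 0; rewrite !subrr. Qed.
Lemma homN x : chi (- x) = - chi x. Proof. by have := hchi 0 x; rewrite hom0 !sub0r. Qed.
Lemma homD x y : chi (x + y) = chi x + chi y. Proof. by have := hchi x (- y); rewrite homN !opprK. Qed.
Lemma homMn x n : chi (x *+ n) = chi x *+ n.
Proof. by elim: n => [|n IH]; rewrite ?mulr0n ?hom0// !mulrS homD IH. Qed.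
End HomTheory.

Lemma characterB chi chi' : character chi -> character chi' -> character (chi - chi').
Proof.
move=> [h c] [h' c']; split=> [x y|e e0]; first by rewrite !fctE h h'; zmodule.
have e2 : 0 < e / 2 by lra.
apply: filterS (filterI (c _ e2) (c' _ e2)) => x /= [hx hx'].
by rewrite !fctE; apply: le_lt_trans (cnormB _ _) _; lra.
Qed.

Lemma character0 : character 0.
Proof.
split=> [x y|e e0]; first exact: (esym (subr0 _)).
by apply: filterE => x; rewrite /= cnorm0.
Qed.

Lemma character_subgroup : subgroup [set chi | character chi].
Proof. by split; [exact: character0|exact: characterB]. Qed.

Lemma compact_ucont (f : K -> R) : compact [set: K] -> continuous f -> ucont f.
Proof.
move=> cK cf e e0; apply: contrapT => nQ.
have /choice[xy hxy] : forall Q : set K, exists xy : K * K, nbhs (0 : K) Q ->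
    Q (xy.1 - xy.2) /\ ~ `|f xy.1 - f xy.2| <= e.
  move=> Q; have [Q0|nQ0] := pselect (nbhs (0 : K) Q); last by exists (0, 0).
  apply: contrapT => nxy; apply: nQ; exists Q => // x y Qxy; apply: contrapT => h.
  by apply: nxy; exists (x, y).
pose D (Q : set K) := [set x | exists2 Q', nbhs (0 : K) Q' & Q' `<=` Q /\ x = (xy Q').1].
have FF : ProperFilter (filter_from (nbhs (0 : K)) D).
  apply: filter_from_proper; last by move=> Q Q0; exists (xy Q).1; exists Q => //; split.
  apply: filter_from_filter; first by exists setT; exact: filterT.
  move=> Q Q' Q0 Q'0; exists (Q `&` Q'); first exact: filterI.
  by move=> _ [S S0 [/sub_setI[SQ SQ'] ->]]; split; exists S.
have [|x [_ clx]] := cK _ FF; first by exists setT => //; exact: filterT.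
have e2 : 0 < e / 2 by lra.
have /cvgrPdist_lt/(_ _ e2)/nbhs_shift A0 := cf x.
have [V [V0 VN VA VD]] := nbhs0_add A0.
have DV : filter_from (nbhs (0 : K)) D (D V) by exists V.
have [z [[Q Q0 [QV ->]] Vz]] := clx _ _ DV (nbhs_subx x V0).
have [Qxy] := hxy _ Q0; apply.
have h1 : `|f x - f (xy Q).1| < e / 2 by have := VA _ Vz; rewrite /= subrK.
have h2 : `|f x - f (xy Q).2| < e / 2.
  have := (VD _ _ Vz (QV _ Qxy)).2.
  have -> : (xy Q).1 - x - ((xy Q).1 - (xy Q).2) = (xy Q).2 - x by zmodule.
  by rewrite /= subrK.
have -> : f (xy Q).1 - f (xy Q).2 = (f x - f (xy Q).2) - (f x - f (xy Q).1) by ring.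
by apply: le_trans (ler_normB _ _) _; lra.
Qed.

(** Urysohn's lemma separates 0 from both [x0] and [- x0], so that the separation survives
    symmetrisation. *)
Lemma compact_separating (x0 : K) : hausdorff_space K -> compact [set: K] -> x0 <> 0 ->
  exists2 f : K -> R, evenuc f & f 0 <> f x0.
Proof.
move=> hK cK x00.
have nK := compact_normal hK cK.
have cl1 (x : K) : closed [set x] by apply: compact_closed => //; exact: compact_set1.
have clB : closed ([set x0] `|` [set - x0]) by apply: closedU.
have dAB : [set 0] `&` ([set x0] `|` [set - x0]) = set0.
  by apply/seteqP; split=> // y [->] [] // h; [apply: x00|apply: x00; apply: oppr_inj]; rewrite /= ?oppr0 -h.
have [f [cf fI fA fB]] := (iffLR (@uniform_separatorP K R _ _)) (iffLR (@normal_separatorP R K) nK _ _ (cl1 0) clB dAB).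
have f0 : f 0 = 0 by apply: fA; exists 0.
have f1 : f x0 = 1 by apply: fB; exists x0 => //; left.
have f2 : f (- x0) = 1 by apply: fB; exists (- x0) => //; right.
have uf := compact_ucont cK cf.
exists (fun x => f x + f (- x)); last by rewrite f1 f2 oppr0 f0; lra.
by split; [apply: ucontD => //; exact: ucont_opp|move=> x; rewrite opprK addrC].
Qed.

(* d'Alembert's functional equation: [c] is the real part of a character. *)
Lemma cosine_character (c : K -> R) (x0 : K) :
  ucont c -> c 0 = 1 -> (forall x, `|c x| <= 1) ->
  (forall x y, c (x + y) + c (x - y) = 2 * c x * c y) -> c x0 <> 1 ->
  exists2 chi, character chi & chi x0 <> 0.
Proof.
move=> uc c0 c1 dal cx0.
have ev x : c (- x) = c x by have := dal 0 x; rewrite add0r sub0r c0; lra.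
have [s [s2 sc ss]] : exists s : K -> R, [/\ forall x, c x ^+ 2 + s x ^+ 2 = 1,
    forall x y, c (x + y) = c x * c y - s x * s y &
    forall x y, s (x + y) = s x * c y + c x * s y].
  have dd x y : c x * c y = (c (x + y) + c (x - y)) / 2 by rewrite dal; field.
  have [[x1 hx1]|nx1] := pselect (exists x, c x ^+ 2 <> 1); last first.
    have c2 x : c x ^+ 2 = 1 by apply: contrapT => h; apply: nx1; exists x.
    exists (fun=> 0); split=> [x|x y|x y]; first by rewrite c2 expr0n addr0.
      rewrite mulr0 subr0; have h := dal x y; have h1 := c2 (x + y); have h2 := c2 (x - y).
      have hx := c2 x; have hy := c2 y.
      have : (c (x + y) - c (x - y)) ^+ 2 = 0.
        have -> : (c (x + y) - c (x - y)) ^+ 2 = 2 * (c (x + y) ^+ 2 + c (x - y) ^+ 2) - (c (x + y) + c (x - y)) ^+ 2 by ring.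
        rewrite h h1 h2; have -> : (2 * c x * c y) ^+ 2 = 4 * (c x ^+ 2 * c y ^+ 2) by ring.
        by rewrite hx hy; ring.
      by move=> /eqP; rewrite expf_eq0 /= => /eqP; lra.
    by rewrite mulr0 mul0r addr0.
  have d0 : 0 < 1 - c x1 ^+ 2.
    have := c1 x1; rewrite -(@ler_pXn2r _ 2) ?nnegrE// real_normK ?num_real// expr1n => h.
    by rewrite lt_def subr_ge0 h andbT subr_eq0; apply/eqP => h'; apply: hx1.
  pose s0 := Num.sqrt (1 - c x1 ^+ 2).
  have s00 : s0 != 0 by rewrite gt_eqF// sqrtr_gt0.
  have s02 : s0 ^+ 2 = 1 - c x1 ^+ 2 by rewrite sqr_sqrtr// ltW.
  (* The sine is recovered from [cos (a - b) - cos (a + b) = 2 sin a sin b], with [s0] the chosen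
     sine of [x1]. *)
  pose s x := (c (x - x1) - c (x + x1)) / (2 * s0).
  have ssE x y : s x * s y = (c (x - y) - c (x + y)) / 2.
    have -> : s x * s y = (c (x - x1) - c (x + x1)) * (c (y - x1) - c (y + x1)) / (4 * s0 ^+ 2).
      by rewrite /s; field; rewrite s00.
    apply: (@mulIf _ (4 * s0 ^+ 2)); first by rewrite mulf_neq0 ?expf_neq0.
    rewrite divfK ?mulf_neq0 ?expf_neq0//.
    have -> : s0 ^+ 2 = (1 - c (x1 + x1)) / 2.
      have := dd x1 x1; rewrite subrr c0 -expr2 s02; lra.
    rewrite mulrBl !mulrBr !dd.
    have -> : x - x1 + (y - x1) = x + y - (x1 + x1) by zmodule.
    have -> : x - x1 - (y - x1) = x - y by zmodule.
    have -> : x - x1 + (y + x1) = x + y by zmodule.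
    have -> : x - x1 - (y + x1) = x - y - (x1 + x1) by zmodule.
    have -> : x + x1 + (y - x1) = x + y by zmodule.
    have -> : x + x1 - (y - x1) = x - y + (x1 + x1) by zmodule.
    have -> : x + x1 + (y + x1) = x + y + (x1 + x1) by zmodule.
    have -> : x + x1 - (y + x1) = x - y by zmodule.
    have := dal (x + y) (x1 + x1); have := dal (x - y) (x1 + x1) => h1 h2.
    have -> : (c (x - y) - c (x + y)) / 2 * (4 * ((1 - c (x1 + x1)) / 2)) =
       (c (x - y) - (2 * c (x - y) * c (x1 + x1)) / 2) - (c (x + y) - (2 * c (x + y) * c (x1 + x1)) / 2) by field.
    by rewrite -h1 -h2; field.
  exists s; split=> [x|x y|x y].
  - rewrite [s x ^+ 2]expr2 ssE subrr c0 expr2 dd subrr c0; lra.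
  - by rewrite ssE dd; field.
  - have -> : s x * c y + c x * s y = ((c (x - x1) * c y - c (x + x1) * c y) + (c x * c (y - x1) - c x * c (y + x1))) / (2 * s0).
      by rewrite /s; field.
    rewrite /s; congr (_ / _); rewrite !dd.
    have -> : x - x1 + y = x + y - x1 by zmodule.
    have -> : x - x1 - y = x - y - x1 by zmodule.
    have -> : x + x1 + y = x + y + x1 by zmodule.
    have -> : x + x1 - y = x - y + x1 by zmodule.
    have -> : x + (y - x1) = x + y - x1 by zmodule.
    have -> : x - (y - x1) = x - y + x1 by zmodule.
    have -> : x + (y + x1) = x + y + x1 by zmodule.
    have -> : x - (y + x1) = x - y - x1 by zmodule.
    by field.
have /choice[chi hchi] : forall x, exists t, ccos t = c x /\ csin t = s x.
  by move=> x; apply: circle_point.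
have chiD x y : chi (x + y) = chi x + chi y.
  apply/eqP; rewrite -subr_eq0; apply/eqP; apply: ccos_eq1.
  have [hx sx] := hchi x; have [hy sy] := hchi y; have [hxy sxy] := hchi (x + y).
  rewrite ccosD ccosN csinN ccosD csinD hxy sxy hx hy sx sy.
  rewrite sc ss; have := s2 x; have := s2 y => h1 h2.
  have -> : (c x * c y - s x * s y) * (c x * c y - s x * s y) - (s x * c y + c x * s y) * - (s x * c y + c x * s y)
    = (c x ^+ 2 + s x ^+ 2) * (c y ^+ 2 + s y ^+ 2) by ring.
  by rewrite h1 h2 mulr1.
have chi0 : chi 0 = 0 by apply: ccos_eq1; rewrite (hchi 0).1.
have chiB x y : chi (x - y) = chi x - chi y.
  by have := chiD (x - y) y; rewrite subrK => ->; rewrite addrK.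
exists chi; last by move=> h; apply: cx0; rewrite -(hchi x0).1 h ccos0.
split=> // e e0; have [d d0 hd] := ccos_small e0.
have d2 : 0 < d / 2 by lra.
have [Q Q0 hQ] := uc _ d2; apply: filterS Q0 => x Qx; apply: hd; rewrite (hchi x).1.
by have := hQ x 0; rewrite subr0 c0 => /(_ Qx); rewrite ler_norml; lra.
Qed.

Theorem compact_characters_separate (x0 : K) :
  hausdorff_space K -> compact [set: K] -> x0 <> 0 ->
  exists2 chi, character chi & chi x0 <> 0.
Proof.
move=> hK cK x00; have [f ef f0] := compact_separating hK cK x00.
have Ktb := compact_totally_bounded cK; have [m hm] := exists_mean R K.
have [c [uc c0 c1 dal cx0]] := exists_cosine Ktb hm ef f0.
exact: cosine_character uc c0 c1 dal cx0.
Qed.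

End Characters.

(** * Kronecker approximation and duality for compact groups *)

Lemma compact_directed (T : topologicalType) (A : set T) (I : Type) (i0 : I) (D : I -> set T) :
  compact A -> (forall i j, exists k, D k `<=` D i `&` D j) ->
  (forall i, exists2 x, A x & D i x) -> exists2 x, A x & forall i, closure (D i) x.
Proof.
move=> cA dD ne.
have FF : ProperFilter (filter_from [set: I] (fun i => A `&` D i)).
  apply: filter_from_proper; last by move=> i _; have [x Ax Dx] := ne i; exists x.
  apply: filter_from_filter; first by exists i0.
  move=> i j _ _; have [k /sub_setI[ki kj]] := dD i j; exists k => // x [Ax Dx].
  by split; split => //; [exact: ki|exact: kj].
have [|x [Ax clx]] := cA _ FF; first by exists i0 => // y [].
exists x => // i B xB.
have Fi : filter_from [set: I] (fun i => A `&` D i) (D i) by exists i => // y [].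
exact: clx Fi xB.
Qed.

Section ClosureOfCharacters.
Context (R : realType) (K : topologicalZmodType).
Local Notation circle := (circle R).

Lemma character_closure (chi : K -> circle) (a : circle) (x : K) : character chi ->
  (forall e, 0 < e -> closure [set y | cnorm (chi y - a) < e] x) -> chi x = a.
Proof.
move=> [h c] cl; apply/eqP; rewrite -subr_eq0; apply/eqP; apply: cnorm_eq0; apply/eqP.
rewrite eq_le cnorm_ge0 andbT leNgt; apply/negP => pos.
have e2 : 0 < cnorm (chi x - a) / 2 by lra.
have /closure_sub' := cl _ e2 => /(_ _ (c _ e2))[y /= hy]; rewrite h => hxy.
have := cnormD (chi x - chi y) (chi y - a).
have -> : chi x - chi y + (chi y - a) = chi x - a by zmodule.
lra.
Qed.

Lemma characters_nbhs (L : seq (K -> circle)) (e : R) : (forall chi, chi \in L -> character chi) ->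
  0 < e -> nbhs (0 : K) [set x | forall chi, chi \in L -> cnorm (chi x) < e].
Proof.
move=> hL e0; elim: L hL => [|chi L IH] hL; first by apply: filterE => x chi; rewrite in_nil.
have h1 := (hL _ (mem_head _ _)).2 _ e0.
have h2 : nbhs (0 : K) [set x | forall chi, chi \in L -> cnorm (chi x) < e].
  by apply: IH => psi psiL; apply: hL; rewrite inE psiL orbT.
apply: filterS (filterI h1 h2) => x [/= hx hx'] psi; rewrite inE => /predU1P[->//|]; exact: hx'.
Qed.

(** For positive [a], Bernoulli's inequality in the form [a ^+ r * (a + r%:R * (b - a)) <= b ^+ r *
    a] makes the quotient of the powers unbounded. *)
Lemma power_growth (a b N : R) : 0 <= a -> a < b -> ~ (forall r, b ^+ r <= N * a ^+ r).
Proof.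
move=> a0 ab h; have [a1|a1] := ltP 0 a; last first.
  by have := h 1%N; rewrite !expr1 (_ : a = 0); lra.
have b0 : 0 < b by lra.
have bern r : a ^+ r * (a + r%:R * (b - a)) <= b ^+ r * a.
  elim: r => [|r IH]; first by rewrite !expr0; lra.
  have : b * (a ^+ r * (a + r%:R * (b - a))) <= b * (b ^+ r * a) by rewrite ler_pM2l.
  have -> : b * (b ^+ r * a) = b ^+ r.+1 * a by rewrite exprS; ring.
  apply: le_trans.
  have -> : b * (a ^+ r * (a + r%:R * (b - a))) =
     a ^+ r.+1 * (a + r.+1%:R * (b - a)) + a ^+ r * (r%:R * (b - a) ^+ 2).
    by rewrite exprS -natr1; ring.
  rewrite lerDl; apply: mulr_ge0; [exact: exprn_ge0|apply: mulr_ge0; [exact: ler0n|exact: sqr_ge0]].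
have lin r : a + r%:R * (b - a) <= N * a.
  rewrite -(@ler_pM2l _ (a ^+ r)) ?exprn_gt0//; apply: le_trans (bern r) _.
  have := h r; rewrite -(ler_pM2r a1) => h'; apply: le_trans h' _.
  by rewrite mulrAC mulrC.
have ba : 0 < b - a by lra.
have N0 : 0 <= N * a by have := lin 0%N; lra.
have := archi_boundP (divr_ge0 N0 (ltW ba)); rewrite ltr_pdivrMr// => h1.
by have := lin (Num.bound (N * a / (b - a))); lra.
Qed.

Lemma mean_translates (m : (K -> R) -> R) (f : K -> R) (F : seq K) : is_mean m -> bounded_fun f ->
  bounded_fun (fun x => \sum_(y <- F) f (x - y)) /\
  m (fun x => \sum_(y <- F) f (x - y)) = (size F)%:R * m f.
Proof.
move=> hm bf; elim: F => [|y F [b IH]].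
  rewrite (_ : (fun x => _) = fun=> 0); last by apply/funext => x; rewrite big_nil.
  by rewrite mean_cst// mul0r; split=> //; exists 0 => ?; rewrite normr0.
rewrite (_ : (fun x => _) = fun x => f (x - y) + \sum_(y <- F) f (x - y)); last first.
  by apply/funext => x; rewrite big_cons.
have b1 : bounded_fun (fun x => f (x - y)) by exact: bounded_comp.
split; first exact: bounded_funD.
by rewrite (meanD hm)// (mean_shift hm)// IH /= -natr1; ring.
Qed.

End ClosureOfCharacters.

Section Kronecker.
Context (R : realType) (K : topologicalZmodType).
Local Notation circle := (circle R).
Hypothesis cK : compact [set: K].
Context (Fh : (K -> circle) -> circle).
Hypothesis FhB : forall chi chi', Fh (chi - chi') = Fh chi - Fh chi'.

Let Fh0 : Fh 0 = 0. Proof. by have := FhB 0 0; rewrite !subrr. Qed.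
Let FhD chi chi' : Fh (chi + chi') = Fh chi + Fh chi'.
Proof. by have := FhB (chi + chi') chi'; rewrite addrK => ->; rewrite subrK. Qed.

(* [linked f g]: [f] is a trigonometric polynomial and [g] is what its translate by a
   point with evaluation map [Fh] would be. *)
Inductive linked : (K -> R) -> (K -> R) -> Prop :=
| linked0 : linked (fun=> 0) (fun=> 0)
| linkedS a chi f g of character chi & linked f g :
    linked (fun x => a * ccos (chi x) + f x) (fun x => a * ccos (chi x - Fh chi) + g x).

Let linked_eq f g f' g' : linked f g -> f =1 f' -> g =1 g' -> linked f' g'.
Proof. by move=> l /funext <- /funext <-. Qed.

Lemma linkedD f g f' g' : linked f g -> linked f' g' ->
  linked (fun x => f x + f' x) (fun x => g x + g' x).
Proof.
move=> l l'; elim: l => [|a chi f1 g1 hchi _ IH].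
  by apply: linked_eq l' _ _ => x; rewrite add0r.
by apply: (linked_eq (linkedS a hchi IH)) => x; rewrite addrA.
Qed.

(** A product of cosines is half the sum of those of [chi + chi'] and [chi - chi']; additivity of
    [Fh] gives the same frequencies the right phases. *)
Lemma linkedM chi f g : character chi -> linked f g ->
  linked (fun x => ccos (chi x) * f x) (fun x => ccos (chi x - Fh chi) * g x).
Proof.
move=> hchi; elim=> [|a chi' f1 g1 hchi' _ IH].
  by apply: (linked_eq linked0) => x; rewrite mulr0.
have hD : character (chi + chi') := subgroupD (character_subgroup R K) hchi hchi'.
have aux A B C D E : A + B = 2 * (C * D) ->
    a / 2 * A + (a / 2 * B + C * E) = C * (a * D + E) :> R.
  move=> h; have -> : a / 2 * A + (a / 2 * B + C * E) = a / 2 * (A + B) + C * E by ring.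
  by rewrite h; field.
apply: (linked_eq (linkedS (a / 2) hD (linkedS (a / 2) (characterB hchi hchi') IH))) => x.
  by apply: aux; exact: ccos_add_sub.
apply: aux; rewrite FhD FhB -ccos_add_sub; congr (ccos _ + ccos _).
  by rewrite -[(chi + chi') x]/(chi x + chi' x); zmodule.
by rewrite -[(chi - chi') x]/(chi x - chi' x); zmodule.
Qed.

Lemma ccos_bounded (chi : K -> circle) (a : circle) : bounded_fun (fun x => ccos (chi x - a)).
Proof. by exists 1 => x; rewrite ler_norml ccos_geN1 ccos_le1. Qed.

(** Adding the translates by [y] and [- y] multiplies the function by [2 * ccos (chi y)]. Where
    [chi y] is nonzero this factor is not 2, so invariance forces the mean to vanish. *)
Lemma mean_character m (chi : K -> circle) a : is_mean m -> character chi -> chi <> 0 ->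
  m (fun x => ccos (chi x - a)) = 0.
Proof.
move=> hm [h _] chi0; have [y hy] : exists y, chi y <> 0.
  by apply: contrapT => n; apply: chi0; apply/funext => y; apply: contrapT => hy; apply: n; exists y.
have b := ccos_bounded chi a; set M := m _.
have := meanD hm (bounded_comp (fun x => x + y) b) (bounded_comp (fun x => x - y) b).
rewrite (mean_shift hm y b) (mean_shift hm (- y) b) -/M.
have -> : (fun x => ccos (chi (x + y) - a) + ccos (chi (x - y) - a)) =
    (fun x => (2 * ccos (chi y)) * ccos (chi x - a)).
  apply/funext => x; rewrite (homD h) h.
  have -> : chi x + chi y - a = chi x - a + chi y by zmodule.
  have -> : chi x - chi y - a = chi x - a - chi y by zmodule.
  by rewrite ccos_add_sub; ring.
rewrite (meanZ hm)// -/M => e; have : (1 - ccos (chi y)) * M = 0 by lra.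
move=> /eqP; rewrite mulf_eq0 => /orP[|/eqP//]; rewrite subr_eq0 => /eqP/esym/ccos_eq1//.
Qed.

Lemma linked_mean m f g : is_mean m -> linked f g ->
  [/\ bounded_fun f, bounded_fun g & m f = m g].
Proof.
move=> hm; elim=> [|a chi f1 g1 hchi _ [bf bg e]].
  by have b := bounded_cst K (0 : R); split.
have b1 : bounded_fun (fun x => ccos (chi x)) by exists 1 => x; rewrite ler_norml ccos_geN1 ccos_le1.
have b2 := ccos_bounded chi (Fh chi).
have bc := bounded_cst K a.
have b3 := bounded_funM bc b1; have b4 := bounded_funM bc b2.
split; [exact: bounded_funD|exact: bounded_funD|].
rewrite (meanD hm b3 bf) (meanD hm b4 bg) e (meanZ hm)// (meanZ hm)//; congr (_ * _ + _).
have [->|chi0] := pselect (chi = 0); first by rewrite Fh0; congr m; apply/funext => x; rewrite subr0.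
have e0 : (fun x => ccos (chi x)) = (fun x => ccos (chi x - 0)) by apply/funext => x; rewrite subr0.
by rewrite e0 !mean_character.
Qed.

(* The means of [v ^+ r] and [u ^+ r] agree because only the constant terms count, but
   if [u] stayed below its formal maximum the latter would grow more slowly. *)
Lemma kronecker_approx (L : seq (K -> circle)) (e : R) : (forall chi, chi \in L -> character chi) ->
  0 < e -> exists x, forall chi, chi \in L -> cnorm (chi x - Fh chi) < e.
Proof.
move=> hL e0; apply: contrapT => nex; have [d d0 hd] := ccos_small e0.
have [m hm] := exists_mean R K.
pose u x := \sum_(chi <- L) (1 + ccos (chi x - Fh chi)).
pose v x := \sum_(chi <- L) (1 + ccos (chi x)).
have lk r : linked (fun x => v x ^+ r) (fun x => u x ^+ r).
  elim: r => [|r IH].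
    apply: (linked_eq (linkedS 1 (character0 R K) linked0)) => x; rewrite expr0 mul1r addr0.
      by rewrite -[X in ccos X]/0 ccos0.
    by rewrite Fh0 -[X in ccos X]/(0 - 0) subr0 ccos0.
  have step (L' : seq (K -> circle)) : (forall chi, chi \in L' -> character chi) ->
      linked (fun x => (\sum_(chi <- L') (1 + ccos (chi x))) * v x ^+ r)
             (fun x => (\sum_(chi <- L') (1 + ccos (chi x - Fh chi))) * u x ^+ r).
    elim: L' => [|chi L' IH'] hL'.
      by apply: (linked_eq linked0) => x; rewrite big_nil mul0r.
    have hchi := hL' _ (mem_head _ _).
    have h2 : forall chi, chi \in L' -> character chi by move=> psi hp; apply: hL'; rewrite inE hp orbT.
    apply: (linked_eq (linkedD IH (linkedD (linkedM hchi IH) (IH' h2)))) => x; rewrite big_cons; ring.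
  by apply: (linked_eq (step L hL)) => x; rewrite exprS.
have u0 x : 0 <= u x by apply: sumr_ge0 => chi _; have := ccos_geN1 (chi x - Fh chi); lra.
have v0 x : 0 <= v x by apply: sumr_ge0 => chi _; have := ccos_geN1 (chi x); lra.
have sum2 (L' : seq (K -> circle)) (c : R) : \sum_(chi <- L') c = (size L')%:R * c.
  by elim: L' => [|chi L' IH]; rewrite ?big_nil ?mul0r// big_cons IH /= -natr1; ring.
pose n : R := (size L)%:R.
have uA x : u x <= 2 * n - d.
  have [chi chiL hchi] : exists2 chi, chi \in L & ccos (chi x - Fh chi) <= 1 - d.
    apply: contrapT => no; apply: nex; exists x => chi chiL; apply: hd; rewrite ltNge.
    by apply/negP => h; apply: no; exists chi.
  rewrite /u (big_rem chi)//=; have hs := size_rem chiL.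
  have : \sum_(y <- rem chi L) (1 + ccos (y x - Fh y)) <= \sum_(y <- rem chi L) 2.
    by apply: ler_sum => psi _; have := ccos_le1 (psi x - Fh psi); lra.
  rewrite sum2 hs; have : n = (size L).-1%:R + 1.
    by rewrite natr1 prednK //; case: (L) chiL.
  by move=> ->; lra.
(* This tolerance makes [v] at least [2 * n - d / 2] near zero, while [u] is at most [2 * n - d]
   everywhere. *)
pose e' := d / (2 * (n + 1)).
have n0 : 0 <= n by rewrite ler0n.
have e'0 : 0 < e' by rewrite divr_gt0//; lra.
have ne' : n * e' < d / 2.
  have : (n + 1) * e' = d / 2 by rewrite /e'; field; lra.
  by lra.
have [d' d'0 hd'] := ccos_near e'0.
have [F hF] := compact_totally_bounded cK (characters_nbhs hL d'0).
have vB x : (forall chi, chi \in L -> cnorm (chi x) < d') -> 2 * n - d / 2 <= v x.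
  move=> hx; apply: (@le_trans _ _ (\sum_(chi <- L) (2 - e'))); first by rewrite sum2 -/n; lra.
  by rewrite /v big_seq [leRHS]big_seq; apply: ler_sum => chi /hx/hd'; lra.
(* Translates of the neighbourhood by [F] cover [K], so the translates of [v ^+ r] by [F] add up
   everywhere to at least [(2 * n - d / 2) ^+ r]. *)
refine (power_growth (a := 2 * n - d) (b := 2 * n - d / 2) (N := (size F)%:R) _ _ _).
- exact: le_trans (u0 0) (uA 0).
- by lra.
move=> r; have [bv bu mvu] := linked_mean hm (lk r).
have A0 : 0 <= 2 * n - d := le_trans (u0 0) (uA 0).
have h1 : m (fun x => u x ^+ r) <= (2 * n - d) ^+ r.
  rewrite -[leRHS](mean_cst hm); apply: (mean_le hm) => //; first exact: bounded_cst.
  by move=> x; case: r {bv bu mvu} => [|r]; rewrite ?expr0// ler_pXn2r// ?nnegrE.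
have [b2 e2] := mean_translates F hm bv.
apply: (@le_trans _ _ ((size F)%:R * m (fun x => v x ^+ r))); last first.
  by rewrite mvu; apply: ler_pM => //; apply: mean_ge0 => // x; rewrite exprn_ge0.
rewrite -e2 -[leLHS](mean_cst hm); apply: (mean_le hm) => //; first exact: bounded_cst.
move=> x; have [f fF hxf] := hF x I; rewrite (big_rem f)//=.
apply: (@le_trans _ _ (v (x - f) ^+ r)); last by rewrite lerDl sumr_ge0// => y _; rewrite exprn_ge0.
by case: r {bv bu mvu h1 b2 e2} => [|r]; rewrite ?expr0// ler_pXn2r// ?nnegrE//; (lra || exact: vB).
Qed.

End Kronecker.

Section CompactDuality.
Context (R : realType) (K : topologicalZmodType).
Local Notation circle := (circle R).
Hypothesis hK : hausdorff_space K.
Hypothesis cK : compact [set: K].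

(** Indices of the basic Bohr neighbourhoods: a finite list of characters with a positive
    tolerance. *)
Let test : Type :=
  {Le : seq (K -> circle) * R | (forall chi, chi \in Le.1 -> character chi) /\ 0 < Le.2}.

Let test0 : test.
Proof. by exists ([::], 1); split=> // chi; rewrite in_nil. Defined.

Let test_meet (s t : test) : exists u : test, [/\ (sval u).2 <= (sval s).2,
  (sval u).2 <= (sval t).2, forall chi, chi \in (sval s).1 -> chi \in (sval u).1 &
  forall chi, chi \in (sval t).1 -> chi \in (sval u).1].
Proof.
case: s => -[L e] /= [hL e0]; case: t => -[L' e'] /= [hL' e'0].
have hu : (forall chi, chi \in (L ++ L', Num.min e e').1 -> character chi) /\
    0 < (L ++ L', Num.min e e').2.
  split=> [chi /=|/=]; last by rewrite lt_min e0.
  by rewrite mem_cat => /orP[/hL|/hL'].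
exists (exist _ (L ++ L', Num.min e e') hu) => /=; split; rewrite ?ge_min ?lexx ?orbT//.
  by move=> chi h; rewrite mem_cat h.
by move=> chi h; rewrite mem_cat h orbT.
Qed.

Let test1 (chi : K -> circle) e : character chi -> 0 < e ->
  exists t : test, (sval t).2 = e /\ chi \in (sval t).1.
Proof.
move=> hchi e0; have ht : (forall psi, psi \in ([:: chi], e).1 -> character psi) /\ 0 < ([:: chi], e).2.
  by split=> //= psi; rewrite inE => /eqP ->.
by exists (exist _ ([:: chi], e) ht); rewrite /= mem_head.
Qed.

(** Compactness makes the approximations on finite lists simultaneous. [Fh] is additive on all
    functions, not only on characters, which is the form that [extend_hom] supplies. *)
Theorem dual_surjective (Fh : (K -> circle) -> circle) :
  (forall chi chi', Fh (chi - chi') = Fh chi - Fh chi') ->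
  exists x, forall chi, character chi -> chi x = Fh chi.
Proof.
move=> FhB; pose D (t : test) := [set x | forall chi, chi \in (sval t).1 -> cnorm (chi x - Fh chi) < (sval t).2].
have [||x _ hx] := @compact_directed K setT test test0 D cK.
- move=> s t; have [u [us ut hs ht]] := test_meet s t; exists u => x Dx; split=> chi h.
    exact: lt_le_trans (Dx _ (hs _ h)) us.
  exact: lt_le_trans (Dx _ (ht _ h)) ut.
- by move=> t; have [x hx] := kronecker_approx cK FhB (svalP t).1 (svalP t).2; exists x.
exists x => chi hchi; apply: character_closure => // e e0.
have [t [te tchi]] := test1 hchi e0; apply: closureS (hx t) => y /(_ _ tchi).
by rewrite te.
Qed.

(** Otherwise some point lies in the closure of all the sets [D t]. Every character kills it, so it
    is zero, yet it is a limit of points outside [U]. *)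
Lemma compact_bohr U : nbhs (0 : K) U -> exists (L : seq (K -> circle)) (e : R),
  [/\ forall chi, chi \in L -> character chi, 0 < e &
      forall x, (forall chi, chi \in L -> cnorm (chi x) < e) -> U x].
Proof.
move=> U0; apply: contrapT => nLe.
pose D (t : test) := [set x | ~ U x /\ forall chi, chi \in (sval t).1 -> cnorm (chi x) < (sval t).2].
have [||x _ hx] := @compact_directed K setT test test0 D cK.
- move=> s t; have [u [us ut hs ht]] := test_meet s t; exists u => x [nUx Dx].
  split; split=> // chi h; first exact: lt_le_trans (Dx _ (hs _ h)) us.
  exact: lt_le_trans (Dx _ (ht _ h)) ut.
- move=> t; apply: contrapT => nx; apply: nLe; exists (sval t).1, (sval t).2.
  split; [exact: (svalP t).1|exact: (svalP t).2|].
  by move=> x hx; apply: contrapT => nUx; apply: nx; exists x.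
have x0 : x = 0.
  apply: contrapT => /(compact_characters_separate R hK cK)[chi hchi]; apply.
  apply: (character_closure hchi) => e e0.
  have [t [te tchi]] := test1 hchi e0; apply: closureS (hx t) => y [_ /(_ _ tchi)].
  by rewrite te /= subr0.
by have [y [[nUy _]]] := hx test0 _ (eq_ind_r (fun x => nbhs x U) U0 x0).
Qed.

Lemma fun_mulrn (chi : K -> circle) n x : (chi *+ n) x = chi x *+ n.
Proof. by elim: n => // n IH; rewrite !mulrS -IH. Qed.

Lemma character_eq x y : (forall chi : K -> circle, character chi -> chi x = chi y) -> x = y.
Proof.
move=> h; apply: contrapT => xy.
have /(compact_characters_separate R hK cK)[chi hchi] : x - y <> 0 by move/eqP; rewrite subr_eq0 => /eqP.
by rewrite hchi.1 h// subrr.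
Qed.

(** The hypothesis makes [chi *+ n] sent to [chi x] a well-defined homomorphism. Extended to all
    functions, it is evaluation at some [z], and [z *+ n] has the same characters as [x]. *)
Lemma multiples_annihilator n x :
  (forall chi : K -> circle, character chi -> chi *+ n = 0 -> chi x = 0) -> multiples K n x.
Proof.
move=> ann; pose g0 : set ((K -> circle) * circle) :=
  [set p | exists2 chi, character chi & p = (chi *+ n, chi x)].
have [||||||F [FB _ Fg]] := @extend_hom (K -> circle) circle setT _ _ _ g0.
- by [].
- by move=> x' k y k0 _; have [z hz] := circle_divisible y k0; exists z.
- by move=> x'; exists 0.
- split; first by exists 0; [exact: character0|rewrite mul0rn].
  move=> _ _ [chi h ->] [chi' h' ->]; exists (chi - chi'); first exact: characterB.
  by rewrite pairB mulrnBl.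
- by move=> y [chi hchi [/esym e ->]]; exact: ann.
- by [].
have [z hz] := dual_surjective FB; exists z => //; apply: character_eq => chi hchi.
have FM k : F (chi *+ k) = F chi *+ k.
  elim: k => [|k IH]; first by have := FB 0 0; rewrite !subrr.
  have e : F (chi *+ k.+1) - F chi = F chi *+ k by rewrite -FB mulrSr addrK IH.
  by rewrite [RHS]mulrSr -e subrK.
by rewrite (homMn hchi.1) hz// -FM; apply: Fg; exists chi.
Qed.

End CompactDuality.

(** * Partial characters and the Bohr topology of a subgroup *)

Section SubgroupType.
Context (P : topologicalZmodType) (S : set P) (sS : subgroup S).

(** Indexed by the proof, from which the [zmodClosed] instance of this predicate is built. *)
Definition subgroup_pred (_ : subgroup S) : {pred P} := fun x => `[< S x >].

Lemma subgroup_predP x : x \in subgroup_pred sS <-> S x.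
Proof. by split=> [/asboolP//|?]; exact/asboolP. Qed.

Let subgroup_pred_closed : zmod_closed (subgroup_pred sS).
Proof.
split; first by apply/subgroup_predP; exact: subgroup0.
by move=> x y /subgroup_predP Sx /subgroup_predP Sy; apply/subgroup_predP; exact: subgroupB.
Qed.

HB.instance Definition _ :=
  GRing.isZmodClosed.Build _ (subgroup_pred sS) subgroup_pred_closed.

Definition subgroup_carrier : Type := {x : P | x \in subgroup_pred sS}.
HB.instance Definition _ := SubChoice.on subgroup_carrier.
HB.instance Definition _ := [SubChoice_isSubZmodule of subgroup_carrier by <:].

Definition subgroup_base : set (set subgroup_carrier) :=
  [set A | exists2 U, nbhs (0 : P) U & A = [set x | U (val x)]].

Lemma subgroup_group_base : group_base subgroup_base.
Proof.
split.
- by exists setT, setT; [exact: filterT|].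
- move=> _ _ [U U0 ->] [V V0 ->]; exists [set x | (U `&` V) (val x)] => //.
  by exists (U `&` V) => //; exact: filterI.
- by move=> _ [U U0 ->]; exact: (nbhs0_0 U0).
move=> _ [U U0 ->]; have [V V0 VU] := nbhs0_sub U0; exists [set x | V (val x)]; first by exists V.
by move=> x y Vx Vy; exact: VU.
Qed.

Local Notation Q := (gtop subgroup_group_base).

Let lift_in x (Sx : S x) : Q := exist _ x ((subgroup_predP x).2 Sx).

Let valS (q : Q) : S (val (q : subgroup_carrier)).
Proof. by apply/subgroup_predP; exact: (valP (q : subgroup_carrier)). Qed.

Lemma subgroup_type_hausdorff : hausdorff_space P -> hausdorff_space Q.
Proof.
move=> hP; apply/hausdorff_sep0 => x hx; apply: val_inj; rewrite [RHS]raddf0.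
have h0 := (hausdorff_sep0 P).1 hP; apply: h0 => U U0.
by apply: (hx [set x | U (val (x : subgroup_carrier))]); apply/gtop_nbhs0;
  exists [set x | U (val x)] => //; exists U.
Qed.

Lemma subgroup_type_compact : compact S -> compact [set: Q].
Proof.
move=> cS F FF _.
pose F' : set_system P := [set A | F [set q : Q | A (val (q : subgroup_carrier))]].
have FF' : ProperFilter F'.
  have F0 : Filter F'.
    split=> [|A B FA FB|A B AB]; [exact: (@filterT _ F)|exact: (@filterI _ F)|].
    by apply: (@filterS _ F) => q; exact: AB.
  apply: Build_ProperFilter_ex => A FA.
  by have [q hq] := @filter_ex _ F FF _ FA; exists (val (q : subgroup_carrier)).
have [|x [Sx clx]] := cS F' FF'; first by apply: (@filterE _ F) => q; exact: valS.
exists (lift_in Sx); split=> // A B FA /nbhs_shift/gtop_nbhs0[_ [U U0 ->] hB].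
have FA' : F' [set y | exists2 q : Q, A q & val (q : subgroup_carrier) = y].
  by apply: (@filterS _ F) FA => q Aq; exists q.
have [_ [[q Aq <-] hq]] := clx _ _ FA' (nbhs_subx x U0).
exists q; split=> //; have := hB (q - lift_in Sx); rewrite /= subrK; apply.
by [].
Qed.

Lemma compact_subgroup_characters (R : realType) x : hausdorff_space P -> compact S -> S x -> x <> 0 ->
  exists psi : P -> circle R, [/\ forall a b, S a -> S b -> psi (a - b) = psi a - psi b,
    forall e, 0 < e -> exists2 V, nbhs (0 : P) V & forall a, S a -> V a -> cnorm (psi a) < e
  & psi x <> 0].
Proof.
move=> hP cS Sx x0.
have [|chi [chiB chic] chix] :=
  @compact_characters_separate R Q (lift_in Sx) (subgroup_type_hausdorff hP) (subgroup_type_compact cS).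
  by move=> e; apply: x0; exact: (congr1 (fun q : Q => val (q : subgroup_carrier)) e).
(* The value 0 off [S] is a default. *)
pose psi (a : P) : circle R := if pselect (S a) is left Sa then chi (lift_in Sa) else 0.
have psiE a (Sa : S a) : psi a = chi (lift_in Sa).
  by rewrite /psi; case: pselect => // Sa'; congr chi; exact: val_inj.
exists psi; split; last by rewrite psiE.
- move=> a b Sa Sb; rewrite (psiE _ (subgroupB sS Sa Sb)) !psiE -chiB; congr chi; apply: val_inj.
  by [].
move=> e e0; have /gtop_nbhs0[_ [U U0 ->] hU] := chic _ e0; exists U => // a Sa Ua.
by rewrite psiE; apply: hU.
Qed.

End SubgroupType.

Section PartialCharacters.
Context (R : realType) (P : zmodType).
Local Notation circle := (circle R).

Lemma extend_partial_character (S : set P) (phi : P -> circle) : subgroup S ->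
  (forall x y, S x -> S y -> phi (x - y) = phi x - phi y) ->
  exists F : P -> circle, (forall x y, F (x - y) = F x - F y) /\ forall x, S x -> F x = phi x.
Proof.
move=> sS hphi; pose g0 : set (P * circle) := [set p | S p.1 /\ p.2 = phi p.1].
have phi0 : phi 0 = 0 by have := hphi 0 0 sS.1 sS.1; rewrite !subrr.
have [||||||F [FB _ Fg]] := @extend_hom P circle setT _ _ _ g0.
- by [].
- by move=> x k y k0 _; have [z hz] := circle_divisible y k0; exists z.
- by move=> x; exists 0.
- split; first by split; [exact: sS.1|rewrite phi0].
  by move=> [x _] [y _] [/= Sx ->] [/= Sy ->]; split=> /=; [exact: subgroupB|rewrite hphi].
- by move=> y [_ /= ->].
- by [].
by exists F; split=> // x Sx; apply: Fg.
Qed.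

(** The value [t] at [h] has the order of [h] modulo [S], and is [1/3] when that order is infinite.
    As the circle has no small subgroups, some multiple of the extended homomorphism exceeds [1/5]
    at [h]. *)
Lemma discrete_character (S : set P) (h : P) : subgroup S -> ~ S h ->
  exists F : P -> circle, [/\ forall x y, F (x - y) = F x - F y,
    forall x, S x -> F x = 0 & 5^-1 < cnorm (F h)].
Proof.
move=> sS nSh.
have [t t0 ht] : exists2 t : circle, t <> 0 & forall k : int, S (h *~ k) -> t *~ k = 0.
  have [[n [n0 Sn]]|no] := pselect (exists n, (0 < n)%N /\ S (h *+ n)); last first.
    exists (tpi (3^-1 : R)).
      move=> /(congr1 (@cnorm R)); rewrite cnorm0 /cnorm tlift_small ger0_norm; lra.
    by case=> n Sk; first (case: n Sk => [|n] Sk; [by rewrite mulr0z|]); exfalso; apply: no; exists n.+1;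
      split=> //; move: Sk; rewrite ?NegzE ?mulrNz -?pmulrn // => /(subgroupN sS); rewrite opprK.
  have ex : exists n, (0 < n)%N && `[< S (h *+ n) >] by exists n; rewrite n0; apply/asboolP.
  case: (ex_minnP ex) => n1 /andP[n10 /asboolP Sn1] min.
  have n1gt1 : (1 < n1)%N by case: n1 n10 Sn1 min => [|[|]].
  have nz : n1%:R != 0 :> R by rewrite pnatr_eq0 -lt0n.
  exists (tpi (n1%:R^-1 : R)).
    rewrite -[0](raddf0 (@tpi R)) => /tpi_eq[k]; rewrite subr0 => hk.
    have : k = 0.
      apply: (@int_small R); rewrite -hk ger0_norm ?invr_ge0// invf_lt1 ?ltr1n//.
      by rewrite ltr0n.
    by move=> k0; move: hk; rewrite k0 => /eqP; rewrite invr_eq0 (negbTE nz).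
  move=> k Sk; have [c kc] : exists c : int, k = c * n1%:Z.
    exists (k %/ n1%:Z)%Z; rewrite {1}(divz_eq k n1%:Z).
    suff -> : (k %% n1%:Z)%Z = 0 by rewrite addr0.
    have r0 : (0 <= (k %% n1%:Z)%Z)%R by rewrite modz_ge0// eqz_nat; lia.
    have rlt : ((k %% n1%:Z)%Z < n1%:Z)%R by rewrite ltz_pmod.
    have Sr : S (h *~ (k %% n1%:Z)%Z).
      have -> : h *~ (k %% n1%:Z)%Z = h *~ k - (h *+ n1) *~ (k %/ n1%:Z)%Z.
        have e : h *~ k = (h *+ n1) *~ (k %/ n1%:Z)%Z + h *~ (k %% n1%:Z)%Z.
          by rewrite {1}(divz_eq k n1%:Z) mulrzDr [(_ %/ _)%Z * _]mulrC mulrzA -pmulrn.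
        by rewrite e addrC addKr.
      by apply: subgroupB => //; exact: subgroupMz.
    case: (k %% n1%:Z)%Z r0 rlt Sr => // [[|r]] // _ rlt Sr.
    have /min : (0 < r.+1)%N && `[< S (h *+ r.+1) >] by apply/andP; split=> //; exact/asboolP.
    by move: rlt; rewrite ltz_nat ltnNge => /negbTE ->.
  rewrite kc mulrC mulrzA -pmulrn.
  suff -> : tpi (n1%:R^-1 : R) *+ n1 = 0 by rewrite mul0rz.
  have <- : tpi ((n1%:R^-1 : R) *+ n1) = tpi (n1%:R^-1 : R) *+ n1 by exact: raddfMn.
  have -> : (n1%:R^-1 : R) *+ n1 = 1 by rewrite -[LHS]mulr_natr mulVf.
  by rewrite -[RHS](raddf0 (@tpi R)); apply/tpi_eq; exists 1; rewrite subr0.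
have [n hn] : exists n, ~ cnorm (t *+ n) <= 5^-1.
  by apply: contrapT => no; apply: t0; apply: cnorm_small_multiples => n; apply: contrapT => hn; apply: no; exists n.
pose g0 : set (P * circle) := [set p | exists s (k : int), [/\ S s, p.1 = s + h *~ k & p.2 = t *~ k]].
have [||||||F [FB _ Fg]] := @extend_hom P circle setT _ _ _ g0.
- by [].
- by move=> x k y k0 _; have [z hz] := circle_divisible y k0; exists z.
- by move=> x; exists 0.
- split; first by exists 0, 0; rewrite !mulr0z addr0; split=> //; exact: sS.1.
  move=> [x _] [y _] [s [k [/= Ss -> ->]]] [s' [k' [/= Ss' -> ->]]]; exists (s - s'), (k - k').
  split=> /=; [exact: subgroupB| |by rewrite mulrzBr].
  by rewrite mulrzBr; zmodule.
- move=> y [s [k [/= Ss e ->]]]; apply: ht.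
  have -> : h *~ k = - s by apply/eqP; rewrite -addr_eq0 addrC -e.
  exact: subgroupN.
- by [].
have FS s : S s -> F s = 0 by move=> Ss; apply: Fg; exists s, 0; rewrite !mulr0z addr0.
have Fh : F h = t by apply: Fg; exists 0, 1; rewrite add0r; split=> //; exact: sS.1.
have F0 : F 0 = 0 by apply: FS; exact: sS.1.
exists (fun x => F x *+ n); split=> [x y|x /FS ->|].
- by rewrite FB mulrnBl.
- by rewrite mul0rn.
by rewrite Fh ltNge; apply/negP.
Qed.

End PartialCharacters.

Section BohrTopology.
Context (R : realType) (P : topologicalZmodType) (hP : hausdorff_space P) (mP : minprop P).
Context (DD H0 : set P).
Hypotheses (sD : subgroup DD) (cD : compact DD) (sH : subgroup H0) (DH : DD `<=` H0).
(** Modulo the compact [DD], the topology of [H0] is linear: relatively open subgroups come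
    arbitrarily close to [DD]. *)
Hypothesis filtration : forall V, nbhs (0 : P) V -> exists S : set P,
  [/\ subgroup S, DD `<=` S, S `<=` H0,
      exists2 W, nbhs (0 : P) W & H0 `&` W `<=` S
    & forall s, S s -> exists2 d, DD d & V (s - d)].
Local Notation circle := (circle R).

(** Defined on all of [P] but continuous on [H0] only, since the extension off an open subgroup of
    [H0] is purely algebraic. *)
Definition character_on (phi : P -> circle) : Prop :=
  (forall x y, phi (x - y) = phi x - phi y) /\
  forall e, 0 < e -> exists2 V, nbhs (0 : P) V & forall x, H0 x -> V x -> cnorm (phi x) < e.

(** A multiple of a character of [DD] exceeds [1/5] at [x]. Sending [s] in an open subgroup [S] near
    [DD] to its value at a nearby point [d s] of [DD] is additive up to a small error; [approx_hom]
    corrects it, and the result extends off [S] algebraically. *)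
Lemma character_on_separates x : H0 x -> x <> 0 -> DD x ->
  exists2 phi, character_on phi & 10^-1 < cnorm (phi x).
Proof.
move=> Hx x0 Dx; have [psi0 [psi0B psi0c psi0x]] := compact_subgroup_characters sD R hP cD Dx x0.
have [n hn] : exists n, ~ cnorm (psi0 x *+ n) <= 5^-1.
  by apply: contrapT => no; apply: psi0x; apply: cnorm_small_multiples => n; apply: contrapT => hn; apply: no; exists n.
have [psi [psiB psic psix]] : exists psi : P -> circle, [/\
    forall a b, DD a -> DD b -> psi (a - b) = psi a - psi b,
    forall e, 0 < e -> exists2 V, nbhs (0 : P) V & forall a, DD a -> V a -> cnorm (psi a) < e
  & 5^-1 < cnorm (psi x)].
  exists (fun a => psi0 a *+ n); split=> [a b Da Db|e e0|]; last by rewrite ltNge; apply/negP.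
    by rewrite psi0B// mulrnBl.
  have normMn t : cnorm (t *+ n : circle) <= n%:R * cnorm t.
    elim: (n) => [|k IH]; first by rewrite mulr0n cnorm0 mul0r.
    by rewrite mulrS; apply: le_trans (cnormD _ _) _; rewrite -natr1 mulrDl mul1r; lra.
  have n1 : 0 < n%:R + 1 :> R by rewrite ltr_wpDl.
  have [V V0 hV] := psi0c _ (divr_gt0 e0 n1); exists V => // a Da Va.
  apply: le_lt_trans (normMn _) _.
  have := hV a Da Va; rewrite ltr_pdivlMr// => h; apply: le_lt_trans h.
  by have := cnorm_ge0 (psi0 a); lra.
(* [1/40] is below the [1/4] required by [approx_hom], and two errors of this size leave more than
   [1/5 - 1/20] at [x]. *)
have [V V0 hV] := psic (40^-1 : R) ltac:(lra).
have [V1 [V10 V1N V1V hV1]] := nbhs0_sums 3 V0.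
have [S [sS DS SH [W W0 HW] hS]] := filtration V10.
have /choice[d hd] : forall s, exists d, S s -> DD d /\ V1 (s - d).
  move=> s; have [Ss|nSs] := pselect (S s); last by exists 0.
  by have [d Dd Vd] := hS s Ss; exists d.
have V3 a b c : V1 a -> V1 b -> V1 c -> V (a + b + c).
  move=> Va Vb Vc; have := hV1 (nth a [:: a; b; c]) _ 3 (leqnn _); rewrite !big_ord_recl big_ord0 /= addr0 addrA; apply.
  by case=> [|[|[|i]]] //=; rewrite nth_nil.
have psi00 : psi 0 = 0 by have := psiB 0 0 sD.1 sD.1; rewrite !subrr.
have psiN a : DD a -> psi (- a) = - psi a.
  by move=> Da; have := psiB 0 a sD.1 Da; rewrite psi00 !sub0r.
have psiD a b : DD a -> DD b -> psi (a + b) = psi a + psi b.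
  by move=> Da Db; have := psiB a (- b) Da (subgroupN sD Db); rewrite psiN// !opprK.
have approx s s' : S s -> S s' -> cnorm (psi (d (s + s')) - psi (d s) - psi (d s')) <= 40^-1.
  move=> Ss Ss'; have [D1 h1] := hd s Ss; have [D2 h2] := hd s' Ss'.
  have [D3 h3] := hd _ (subgroupD sS Ss Ss').
  rewrite -psiB// -psiB//; last exact: subgroupB.
  apply: ltW; apply: hV; first by apply: subgroupB => //; exact: subgroupB.
  have -> : d (s + s') - d s - d s' = - (s + s' - d (s + s')) + (s - d s) + (s' - d s') by zmodule.
  by apply: V3 => //; exact: V1N.
have [phi phiD phin] := approx_hom (g := psi \o d) (e := 40^-1) sS ltac:(lra) approx.
have phi00 : phi 0 = 0.
  by have /eqP := phiD 0 0 sS.1 sS.1; rewrite addr0 -{1}[phi 0]addr0 (inj_eq (addrI _)) => /eqP/esym.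
have phiB a b : S a -> S b -> phi (a - b) = phi a - phi b.
  by move=> Sa Sb; rewrite -[X in _ = phi X - _](subrK b) phiD ?addrK//; exact: subgroupB.
have small s : S s -> V1 s -> cnorm (phi s) <= 5^-1.
  move=> Ss Vs; have [Ds hs] := hd s Ss.
  have := phin s Ss; have : cnorm (psi (d s)) < 40^-1.
    apply: hV => //; have -> : d s = s + (- (s - d s)) + 0 by zmodule.
    by apply: V3 => //; [exact: V1N|exact: nbhs0_0].
  move=> /= h1 h2; have := cnormD (phi s - psi (d s)) (psi (d s)); rewrite subrK; lra.
have cphi := hom_on_continuous sS phiD V10 small.
have [F [FB FS]] := extend_partial_character sS phiB.
exists F.
  split=> // e e0; have [V' V'0 hV'] := cphi e e0; exists (V' `&` W); first exact: filterI.
  by move=> y Hy [V'y Wy]; rewrite FS; [apply: hV' => //; apply: HW|apply: HW].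
have Sx := DS _ Dx; rewrite FS//; have [Ds hs] := hd x Sx.
have h1 := phin x Sx; have h2 : cnorm (psi (x - d x)) < 40^-1.
  by apply: hV; [exact: subgroupB|exact: V1V].
have := cnormD (psi (x - d x)) (psi (d x)); rewrite psiB// subrK => h3.
have h4 := cnormB (phi x) (phi x - psi (d x)); move: h4; rewrite opprB addrC subrK.
rewrite psiB// in h2; rewrite /= in h1; lra.
Qed.

(** A point [x] off [DD] has points of [H0] near it outside some open subgroup [S], all in one coset
    of [S]; a homomorphism trivial on [S] takes one large value on that coset. On [DD] the previous
    lemma and continuity suffice. *)
Lemma character_on_separates_near x : x <> 0 ->
  (forall U, nbhs (0 : P) U -> exists2 h, H0 h & U (h - x)) ->
  exists2 phi, character_on phi & exists2 U, nbhs (0 : P) U &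
    forall h, H0 h -> U (h - x) -> 20^-1 < cnorm (phi h).
Proof.
move=> x0 clx; have [Dx|nDx] := pselect (DD x).
  have [phi [phiB phic] phix] := character_on_separates (DH Dx) x0 Dx; exists phi => //.
  have [V V0 hV] := phic (20^-1 : R) ltac:(lra); exists V => // h Hh Vh.
  have := hV _ (subgroupB sH Hh (DH Dx)) Vh; rewrite phiB => h1.
  have := cnormB (phi h) (phi h - phi x); rewrite opprB addrC subrK; lra.
have clD : closed DD by exact: compact_closed.
have [V V0 hV] : exists2 V, nbhs (0 : P) V & forall d, DD d -> ~ V (x - d).
  apply: contrapT => no; apply: nDx; apply: clD; apply/closure_sub' => U U0.
  by apply: contrapT => nU; apply: no; exists U => // d Dd Ud; apply: nU; exists d.
have [V1 [V10 V1N V1V hV1]] := nbhs0_add V0.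
have [S [sS DS SH [W W0 HW] hS]] := filtration V10.
have [W1 [W10 W1N W1W hW1]] := nbhs0_add (filterI W0 V10).
have [h0 Hh0 Wh0] := clx _ W10.
have nS : ~ S h0.
  move=> Sh0; have [d Dd Vd] := hS _ Sh0; apply: (hV _ Dd).
  have -> : x - d = (- (h0 - x)) + (h0 - d) by zmodule.
  by apply: (hV1 _ _ _ Vd).1; apply: V1N; have [] := W1W _ Wh0.
have [F [FB FS Fh0]] := discrete_character R sS nS; exists F.
  split=> // e e0; exists W => // y Hy Wy; rewrite FS ?cnorm0//; exact: HW.
exists W1 => // h Hh Wh.
have : S (h - h0).
  apply: HW; split; first exact: subgroupB.
  have -> : h - h0 = (h - x) - (h0 - x) by zmodule.
  by have [_ []] := hW1 _ _ Wh Wh0.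
move=> /FS; rewrite FB => /eqP; rewrite subr_eq0 => /eqP ->; lra.
Qed.

(* The sets [U + V], with [V] a Bohr neighbourhood in [H0], are a base of a coarser
   Hausdorff group topology, hence of the given one. *)
Theorem minprop_totally_bounded : totally_bounded H0.
Proof.
pose Bohr (L : seq (P -> circle)) (e : R) : set P :=
  [set v | H0 v /\ forall phi, phi \in L -> cnorm (phi v) < e].
pose B : set (set P) := [set A | exists U L e, [/\ nbhs (0 : P) U,
  forall phi, phi \in L -> character_on phi, 0 < e &
  A = [set x | exists2 v, Bohr L e v & U (x - v)]]].
have phi0 phi : character_on phi -> phi 0 = 0 by move=> [h _]; have := h 0 0; rewrite !subrr.
have Bohr0 L e : (forall phi, phi \in L -> character_on phi) -> 0 < e -> Bohr L e 0.
  by move=> hL e0; split; [exact: sH.1|move=> phi /hL/phi0 ->; rewrite cnorm0].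
have gB : group_base B; first split.
- exists [set x | exists2 v, Bohr [::] 1 v & setT (x - v)], setT, [::], 1.
  by split=> //; exact: filterT.
- move=> _ _ [U [L [e [U0 hL e0 ->]]]] [U' [L' [e' [U'0 hL' e'0 ->]]]].
  exists [set x | exists2 v, Bohr (L ++ L') (Num.min e e') v & (U `&` U') (x - v)].
    exists (U `&` U'), (L ++ L'), (Num.min e e'); split=> //; first exact: filterI.
      by move=> phi; rewrite mem_cat => /orP[/hL|/hL'].
    by rewrite lt_min e0.
  move=> x [v [Hv hv] [Ux U'x]]; split; exists v => //; split=> // phi phiL.
    by have := hv phi; rewrite mem_cat phiL lt_min => /(_ isT)/andP[].
  by have := hv phi; rewrite mem_cat phiL orbT lt_min => /(_ isT)/andP[].
- move=> _ [U [L [e [U0 hL e0 ->]]]]; exists 0; first exact: Bohr0.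
  by rewrite subr0; exact: nbhs0_0.
- move=> _ [U [L [e [U0 hL e0 ->]]]]; have [V V0 VU] := nbhs0_sub U0.
  have e2 : 0 < e / 2 by lra.
  exists [set x | exists2 v, Bohr L (e / 2) v & V (x - v)]; first by exists V, L, (e / 2).
  move=> x y [v [Hv hv] Vx] [w [Hw hw] Vy]; exists (v - w).
    split=> [|phi phiL]; first exact: subgroupB.
    rewrite (hL _ phiL).1; apply: le_lt_trans (cnormB _ _) _.
    by have := hv _ phiL; have := hw _ phiL; lra.
  have -> : x - y - (v - w) = (x - v) - (y - w) by zmodule.
  exact: VU.
have BN V : B V -> nbhs (0 : P) V.
  move=> [U [L [e [U0 hL e0 ->]]]]; apply: filterS U0 => x Ux; exists 0; first exact: Bohr0.
  by rewrite subr0.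
have sep x : (forall V, B V -> V x) -> x = 0.
  move=> hx; apply: contrapT => x0.
  have clx U : nbhs (0 : P) U -> exists2 h, H0 h & U (h - x).
    move=> U0; have [V [V0 VN VU _]] := nbhs0_add U0.
    have [|v [Hv _] Vv] := hx [set x | exists2 v, Bohr [::] 1 v & V (x - v)].
      by exists V, [::], 1; split.
    by exists v => //; apply: VU; rewrite -opprB; apply: VN.
  have [phi hphi [U U0 hU]] := character_on_separates_near x0 clx.
  have [V [V0 VN VU _]] := nbhs0_add U0.
  have [|v [Hv hv] Vv] := hx [set x | exists2 v, Bohr [:: phi] (20^-1) v & V (x - v)].
    have p20 : 0 < 20^-1 :> R by lra.
    by exists V, [:: phi], (20^-1 : R); split=> // psi; rewrite inE => /eqP ->.
  have := hv phi (mem_head _ _); have := hU v Hv; rewrite -opprB => /(_ (VU _ (VN _ Vv))); lra.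
move=> U U0; have [_ [U' [L [e [U'0 hL e0 ->]]]] VU] := mP gB BN sep U0.
(* Finitely many maps to the circle have totally bounded joint image; taking the centres in [H0]
   keeps [x - f] inside the Bohr set. *)
have [F [FH hF]] := circle_family_big H0 L e0; exists F => x Hx; have [f fF hf] := hF x Hx.
exists f => //; apply: VU; exists (x - f); last by rewrite subrr; exact: nbhs0_0.
split=> [|phi /(nthP 0)[i iL <-]]; first by apply: subgroupB => //; exact: FH.
by rewrite (hL _ (mem_nth 0 iL)).1; exact: hf.
Qed.

End BohrTopology.

(** * Independent sequences modulo a prime; total boundedness of primary parts *)

Lemma sum_delta (G : zmodType) (x : nat -> G) n i : (i < n)%N ->
  \sum_(k < n) x k *~ (nat_of_bool (k == i :> nat))%:Z = x i.
Proof.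
move=> lt_in; rewrite (bigD1 (Ordinal lt_in)) //= eqxx big1 ?addr0// => k.
by rewrite -val_eqE /= => /negbTE ->.
Qed.

Lemma sum_truncate (G : zmodType) (x : nat -> G) (c : nat -> int) n N : (n <= N)%N ->
  \sum_(i < N) x i *~ (if (i < n)%N then c i else 0) = \sum_(i < n) x i *~ c i.
Proof.
move=> nN; rewrite (big_ord_widen N (fun i => x i *~ c i) nN) [RHS]big_mkcond /=.
by apply: eq_bigr => i _; case: ifP.
Qed.

Lemma inverse_mod_prime (p : nat) (c : int) : prime p -> ~~ (p%:Z %| c)%Z ->
  exists (u : nat) (k : int), (u <= p)%N /\ u%:Z * c = 1 + k * p%:Z.
Proof.
move=> pp pc; have [u1 [u2 h]] := Bezoutz c p%:Z.
have g1 : gcdz c p%:Z = 1.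
  have : coprime p `|c|%N by rewrite prime_coprime//; move: pc; rewrite dvdzE.
  by rewrite /gcdz /coprime gcdnC => /eqP /= ->.
rewrite g1 in h; have p0 : (0 < p)%N := prime_gt0 pp.
have r0 : (0 <= (u1 %% p%:Z)%Z)%R by rewrite modz_ge0// eqz_nat; lia.
have rlt : ((u1 %% p%:Z)%Z < p%:Z)%R by rewrite ltz_pmod.
exists `|(u1 %% p%:Z)%Z|%N, (- (u2 + (u1 %/ p%:Z)%Z * c)).
rewrite gez0_abs//; split; first by lia.
have := divz_eq u1 p%:Z; move: (u1 %% p%:Z)%Z (u1 %/ p%:Z)%Z {r0 rlt} => r q e; rewrite e in h; lia.
Qed.

Section IndependentSequences.
Context (K : topologicalZmodType) (p : nat) (pp : prime p).
Context (A L : set K) (sA : subgroup A) (sL : subgroup L).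

Lemma subgroup_powers v : subgroup [set x *+ p ^ v | x in A].
Proof.
split; first by exists 0; [exact: sA.1|rewrite mul0rn].
by move=> _ _ [x Ax <-] [y Ay <-]; exists (x - y); [exact: subgroupB|rewrite mulrnBl].
Qed.

(** Iterating the approximation modulo [p B + L] gives one modulo [p ^ a B + L], still with finitely
    many centres, and [p ^ a B] is close to [L] for a suitable [a]. *)
Lemma totally_bounded_mod_p (B : set K) : subgroup B -> totally_bounded L ->
  (forall V, nbhs (0 : K) V -> exists a, forall x, B x -> exists2 l, L l & V (x *+ p ^ a - l)) ->
  (forall U, nbhs (0 : K) U -> exists F : seq K, forall x, B x ->
     exists f b l, [/\ f \in F, B b, L l & U (x - f - b *+ p - l)]) ->
  totally_bounded B.
Proof.
move=> sB tL hB hU.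
have step a U : nbhs (0 : K) U -> exists F : seq K, forall x, B x ->
    exists f b l, [/\ f \in F, B b, L l & U (x - f - b *+ p ^ a - l)].
  elim: a U => [|a IH] U U0.
    exists [:: 0] => x Bx; exists 0, x, 0; rewrite mem_head expn0 !subr0 subrr.
    by split=> //; [exact: sL.1|exact: nbhs0_0].
  have [V [V0 VN VU hV]] := nbhs0_add U0; have [V1 [V10 _ V1V hV1]] := nbhs0_muln (p ^ a) V0.
  have [F hF] := IH V V0; have [F1 hF1] := hU V1 V10.
  exists [seq f + f1 *+ p ^ a | f <- F, f1 <- F1] => x Bx.
  have [f [b [l [fF Bb Ll h]]]] := hF x Bx; have [f1 [b1 [l1 [f1F Bb1 Ll1 h1]]]] := hF1 b Bb.
  exists (f + f1 *+ p ^ a), b1, (l + l1 *+ p ^ a); split=> //.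
  - by apply/allpairsP; exists (f, f1).
  - by apply: subgroupD => //; exact: subgroupMn.
  have -> : x - (f + f1 *+ p ^ a) - b1 *+ p ^ a.+1 - (l + l1 *+ p ^ a) =
     (x - f - b *+ p ^ a - l) + (b - f1 - b1 *+ p - l1) *+ p ^ a.
    by rewrite !mulrnBl -mulrnA -expnS; zmodule.
  by apply: (hV _ _ h _).1; exact: hV1.
apply: totally_bounded_approx => U U0; have [V [V0 VN VU hV]] := nbhs0_add U0.
have [a ha] := hB V V0; have [F hF] := step a V V0.
exists [set x + y | x in [set` F] & y in L].
  apply: totally_bounded_add => // W W0; exists F => x xF; exists x => //.
  by rewrite subrr; exact: nbhs0_0.
move=> x Bx; have [f [b [l [fF Bb Ll h]]]] := hF x Bx; have [l' Ll' h'] := ha b Bb.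
exists (f + (l + l')); first by exists f => //; exists (l + l') => //; exact: subgroupD.
have -> : x - (f + (l + l')) = (x - f - b *+ p ^ a - l) + (b *+ p ^ a - l') by zmodule.
by have [] := hV _ _ h h'.
Qed.

(** Finitely many representatives, modulo [p A], of the integer combinations of [s]. *)
Definition residues (s : seq K) : seq K :=
  foldr (fun x F => [seq f + x *+ c | f <- F, c <- iota 0 p]) [:: 0] s.

Lemma residuesP (s : seq K) (c : nat -> int) : (forall y, y \in s -> A y) ->
  exists f b, [/\ f \in residues s, A b & \sum_(i < size s) nth 0 s i *~ c i = f + b *+ p].
Proof.
elim: s c => [|x s IH] c hs.
  by exists 0, 0; rewrite mem_head big_ord0 mul0rn addr0; split=> //; exact: sA.1.
have [|f [b [fF Ab e]]] := IH (c \o S); first by move=> y ys; apply: hs; rewrite inE ys orbT.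
have p0 := prime_gt0 pp.
have r0 : (0 <= (c 0%N %% p%:Z)%Z)%R by rewrite modz_ge0// eqz_nat; lia.
have rlt : ((c 0%N %% p%:Z)%Z < p%:Z)%R by rewrite ltz_pmod.
have Ax : A x by apply: hs; exact: mem_head.
exists (f + x *+ `|(c 0%N %% p%:Z)%Z|%N), (b + x *~ (c 0%N %/ p%:Z)%Z); split.
- by apply/allpairsP; exists (f, `|(c 0%N %% p%:Z)%Z|%N); split=> //; rewrite /= mem_iota; move: r0 rlt; move: (c 0%N %% p%:Z)%Z => r; lia.
- by apply: subgroupD => //; exact: subgroupMz.
have ex : x *+ `|(c 0%N %% p%:Z)%Z|%N = x *~ (c 0%N %% p%:Z)%Z by rewrite pmulrn gez0_abs.
rewrite big_ord_recl /= e ex {1}(divz_eq (c 0%N) p%:Z) mulrzDr mulrzA -pmulrn.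
by rewrite mulrnDl; zmodule.
Qed.

Hypothesis tL : totally_bounded L.
Hypothesis hA : forall V, nbhs (0 : K) V ->
  exists a, forall x, A x -> exists2 l, L l & V (x *+ p ^ a - l).

(** By [totally_bounded_mod_p] no finite set is [U]-dense in [p ^ v A] modulo [p ^ v.+1 A + L]; each
    new term avoids the residues of its predecessors. *)
Lemma independent_sequence v : ~ totally_bounded [set x *+ p ^ v | x in A] ->
  exists U (x : nat -> K), [/\ nbhs (0 : K) U, forall i, A (x i) &
    forall n (c : nat -> int) b l, A b -> L l ->
      ~ U (x n *+ p ^ v - (\sum_(i < n) x i *~ c i) *+ p ^ v - b *+ p ^ v.+1 - l)].
Proof.
move=> ntb; have [U U0 hU] : exists2 U, nbhs (0 : K) U & forall F : seq K,
    exists2 y, A y & forall f b l, f \in F -> A b -> L l -> ~ U (y *+ p ^ v - f - b *+ p ^ v.+1 - l).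
  apply: contrapT => no; apply: ntb; apply: totally_bounded_mod_p => //; first exact: subgroup_powers.
    move=> V V0; have [a ha] := hA V0; exists a => _ [x Ax <-].
    by have [l Ll h] := ha _ (subgroupMn sA (p ^ v) Ax); exists l.
  move=> U U0; apply: contrapT => nF; apply: no; exists U => // F.
  apply: contrapT => ny; apply: nF; exists F => _ [y Ay <-].
  apply: contrapT => nf; apply: ny; exists y => // f b l fF Ab Ll Uy; apply: nf.
  exists f, (b *+ p ^ v), l; split=> //; first by exists b.
  by rewrite -mulrnA -expnSr.
pose Q s y := (forall z, z \in s -> A z) -> A y /\ forall f b l, f \in residues s -> A b -> L l ->
  ~ U (y *+ p ^ v - f *+ p ^ v - b *+ p ^ v.+1 - l).
have [s|x hx] := @seq_recursive_choice K Q.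
  have [y Ay hy] := hU [seq f *+ p ^ v | f <- residues s]; exists y => hs; split=> // f b l fF Ab Ll.
  by apply: hy => //; exact: map_f.
have Ax n : A (x n).
  elim/ltn_ind: n => n IH; have [|//] := hx n; move=> z /(nthP 0)[i]; rewrite size_mkseq => lt_in <-.
  by rewrite nth_mkseq//; exact: IH.
have Amk n z : z \in mkseq x n -> A z.
  by move=> /(nthP 0)[i]; rewrite size_mkseq => lt_in <-; rewrite nth_mkseq.
exists U, x; split=> // n c b l Ab Ll.
have [_ h] := hx n (@Amk n); have [f [b' [fF Ab' e]]] := residuesP c (@Amk n).
have -> : \sum_(i < n) x i *~ c i = f + b' *+ p.
  by rewrite -e size_mkseq; apply: eq_bigr => i _; rewrite nth_mkseq.
have -> : x n *+ p ^ v - (f + b' *+ p) *+ p ^ v - b *+ p ^ v.+1 - l =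
    x n *+ p ^ v - f *+ p ^ v - (b' + b) *+ p ^ v.+1 - l.
  by rewrite !mulrnDl -mulrnA -expnS; zmodule.
by apply: h => //; exact: subgroupD.
Qed.

(** Consider the last coefficient prime to [p]. Later terms are absorbed in [p ^ v.+1 A], and a
    multiplier [u <= p] makes this coefficient 1 modulo [p]; the bound on [u] lets one [W] serve all
    combinations. *)
Lemma separated_sequence v : ~ totally_bounded [set x *+ p ^ v | x in A] ->
  exists W (x : nat -> K), [/\ nbhs (0 : K) W, forall i, A (x i),
    forall n (c : nat -> int) l, L l -> (exists2 i, (i < n)%N & ~~ (p%:Z %| c i)%Z) ->
      ~ W ((\sum_(i < n) x i *~ c i) *+ p ^ v + l)
  & forall i j, (i < j)%N -> ~ W (x j *+ p ^ v - x i *+ p ^ v)].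
Proof.
move=> /independent_sequence[U [x [U0 Ax hx]]].
have [W [W0 _ WU hW]] := nbhs0_muln p U0; exists W, x; split=> //; last first.
  move=> i j ij /WU; have := hx j (fun k => (nat_of_bool (k == i))%:Z) 0 0 sA.1 sL.1.
  by rewrite sum_delta// mul0rn !subr0.
have gen n (c : nat -> int) b l : A b -> L l -> (exists2 i, (i < n)%N & ~~ (p%:Z %| c i)%Z) ->
    ~ W ((\sum_(i < n) x i *~ c i) *+ p ^ v + b *+ p ^ v.+1 + l).
  elim: n b => [|n IH] b Ab Ll [i lt_in hi]; first by [].
  rewrite big_ord_recr /=; have [/dvdzP[k kc]|ndvd] := boolP (p%:Z %| c n)%Z.
    have -> : (\sum_(i < n) x i *~ c i + x n *~ c n) *+ p ^ v + b *+ p ^ v.+1 + l =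
        (\sum_(i < n) x i *~ c i) *+ p ^ v + (x n *~ k + b) *+ p ^ v.+1 + l.
      by rewrite kc mulrzA -pmulrn !mulrnDl -mulrnA -expnS; zmodule.
    apply: IH => //; first by apply: subgroupD => //; exact: subgroupMz.
    exists i => //; move: lt_in; rewrite ltnS leq_eqVlt => /predU1P[ein|//].
    by move: hi; rewrite ein kc dvdz_mull.
  have [u [k [up uk]]] := inverse_mod_prime pp ndvd => /hW/(_ up).
  pose z := \sum_(i < n) x i *~ c i.
  have e : (x n *~ c n) *+ u = x n + x n *~ k *+ p.
    by rewrite !pmulrn -mulrzA mulrC uk mulrzDr mulrzA.
  have -> : ((z + x n *~ c n) *+ p ^ v + b *+ p ^ v.+1 + l) *+ u =
     x n *+ p ^ v - (\sum_(i < n) x i *~ (- (c i * u%:Z))) *+ p ^ v - (- (x n *~ k) - b *+ u) *+ p ^ v.+1 - (- (l *+ u)).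
    have -> : \sum_(i < n) x i *~ (- (c i * u%:Z)) = - (z *+ u).
      by rewrite -sumrMnl -sumrN; apply: eq_bigr => j _; rewrite mulrNz mulrzA -pmulrn.
    have e' : (x n *~ c n) *+ p ^ v *+ u = x n *+ p ^ v + x n *~ k *+ p ^ v.+1.
      by rewrite mulrnAC e mulrnDl -mulrnA -expnS.
    have ez : z *+ p ^ v *+ u = z *+ u *+ p ^ v := mulrnAC _ _ _.
    have eb : b *+ p ^ v.+1 *+ u = b *+ u *+ p ^ v.+1 := mulrnAC _ _ _.
    by rewrite !mulrnDl e' ez eb !mulNrn; zmodule.
  apply: (hx n (fun i => - (c i * u%:Z))); last by apply: subgroupN => //; exact: subgroupMn.
  by apply: subgroupB => //; [apply: subgroupN => //; exact: subgroupMz|exact: subgroupMn].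
move=> n c l Ll hi; have := gen n c 0 l sA.1 Ll hi; by rewrite mul0rn addr0.
Qed.

End IndependentSequences.

Section PrimaryTotallyBounded.
Context (R : realType) (K : topologicalZmodType).
Hypotheses (hK : hausdorff_space K) (cK : complete_group K).
Local Notation P := (prod_topology (fun _ : nat => K)).
Hypothesis mP : minprop P.
Context (p : nat) (pp : prime p).

Lemma power_hausdorff : hausdorff_space P.
Proof.
apply/hausdorff_sep0 => x hx; apply: functional_extensionality_dep => i.
have h0 := (hausdorff_sep0 K).1 hK; apply: h0 => U U0.
by have := hx _ (prod_proj_nbhs (T := fun _ => K) (i := i) U0).
Qed.

Lemma first_nondivisible (a n : nat) (c : nat -> int) :
  (forall i, (i < n)%N -> ((p ^ a)%:Z %| c i)%Z) \/
  exists2 v, (v < a)%N & exists2 c' : nat -> int, (forall i, (i < n)%N -> c i = c' i * (p ^ v)%:Z) &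
    exists2 i, (i < n)%N & ~~ (p%:Z %| c' i)%Z.
Proof.
elim: a => [|a [IH|[v va h]]]; first by left=> i _; rewrite expn0 dvd1z.
  have [h|nh] := pselect (forall i, (i < n)%N -> (p%:Z %| (c i %/ (p ^ a)%:Z)%Z)%Z).
    left=> i lt_in; have /dvdzP[k hk] := h i lt_in; apply/dvdzP; exists k.
    by rewrite expnSr PoszM [(p ^ a)%:Z * _]mulrC mulrA -hk divzK// IH.
  right; exists a => //; exists (fun i => (c i %/ (p ^ a)%:Z)%Z) => [i lt_in|].
    by rewrite divzK// IH.
  apply: contrapT => no; apply: nh => i lt_in; apply: contrapT => hi; apply: no; exists i => //.
  exact/negP.
by right; exists v => //; exact: leqW.
Qed.

(* Otherwise sequences independent modulo [p] in [p ^ v * A], placed in coordinate [v]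
   of the power, generate together with a power of a compact group a subgroup that
   [minprop_totally_bounded] shows to be totally bounded, although it is not. *)
Theorem p_filtered_totally_bounded (A L : set K) : subgroup A -> subgroup L -> compact L ->
  (forall V, nbhs (0 : K) V ->
     exists a, forall x, A x -> exists2 l, L l & V (x *+ p ^ a - l)) ->
  totally_bounded A.
Proof.
move=> sA sL cL hA; apply: contrapT => ntA.
(* With [J] least such that [p ^ J A] is totally bounded, [L'] is the closure of [L + p ^ J A]:
   below [J] independent sequences exist, from [J] on all lies in [L']. If there is no [J], [L]
   itself will do. *)
have [L' [sL' cL' LL' dich]] : exists L' : set K, [/\ subgroup L', compact L', L `<=` L' &
    forall v, ~ totally_bounded [set x *+ p ^ v | x in A] \/ forall x, A x -> L' (x *+ p ^ v)].
  have [[J0 tJ0]|no] := pselect (exists J, totally_bounded [set x *+ p ^ J | x in A]); last first.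
    by exists L; split=> // v; left=> h; apply: no; exists v.
  have ex : exists J, `[< totally_bounded [set x *+ p ^ J | x in A] >] by exists J0; apply/asboolP.
  case: (ex_minnP ex) => J /asboolP tJ minJ.
  pose S := [set x + y | x in L & y in [set x *+ p ^ J | x in A]].
  have sS : subgroup S.
    split; first by exists 0; [exact: sL.1|exists 0; [exact: (subgroup_powers p sA J).1|rewrite addr0]].
    move=> _ _ [x Lx [y Ay <-]] [x' Lx' [y' Ay' <-]]; exists (x - x'); first exact: subgroupB.
    exists (y - y'); first exact: (subgroup_powers p sA J).2.
    zmodule.
  exists (closure S); split.
  - exact: closure_subgroup.
  - apply: closed_totally_bounded_compact => //; first exact: closed_closure.
    by apply: totally_bounded_closure; apply: totally_bounded_add => //; exact: compact_totally_bounded.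
  - move=> x Lx; apply: subset_closure; exists x => //; exists 0; last by rewrite addr0.
    exact: (subgroup_powers p sA J).1.
  move=> v; have [vJ|Jv] := ltnP v J.
    by left=> tv; have := minJ v; rewrite leqNgt vJ => h; have /h : `[< totally_bounded [set x *+ p ^ v | x in A] >] by apply/asboolP.
  right=> x Ax; apply: subset_closure; exists 0; first exact: sL.1.
  exists (x *+ p ^ v); last by rewrite add0r.
  exists (x *+ p ^ (v - J)); first exact: subgroupMn.
  by rewrite -mulrnA -expnD subnK.
have tL' := compact_totally_bounded cL'.
have hA' V : nbhs (0 : K) V -> exists a, forall x, A x -> exists2 l, L' l & V (x *+ p ^ a - l).
  by move=> /hA[a ha]; exists a => x /ha[l Ll h]; exists l => //; exact: LL'.
have /choice[WX hWX] : forall v, exists WX : set K * (nat -> K), [/\ nbhs (0 : K) WX.1,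
    forall i, A (WX.2 i) & (forall x, A x -> L' (x *+ p ^ v)) \/
    (forall n (c : nat -> int) l, L' l -> (exists2 i, (i < n)%N & ~~ (p%:Z %| c i)%Z) ->
      ~ WX.1 ((\sum_(i < n) WX.2 i *~ c i) *+ p ^ v + l)) /\
    forall i j, (i < j)%N -> ~ WX.1 (WX.2 j *+ p ^ v - WX.2 i *+ p ^ v)].
  move=> v; have [ntv|good] := dich v.
    have [W [x [W0 Ax h1 h2]]] := separated_sequence pp sA sL' tL' hA' ntv.
    by exists (W, x); split=> //; right.
  by exists (setT, fun=> 0); split=> //=; [exact: filterT|move=> _; exact: sA.1|left].
pose W v := (WX v).1; pose X v := (WX v).2.
have AX v n (c : nat -> int) : A (\sum_(i < n) X v i *~ c i).
  by apply: subgroup_sum => // i _; apply: subgroupMz => //; have [_ h _] := hWX v; exact: h.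
pose DD : set P := [set y | forall v, L' (y v)].
(* Modulo [DD], the [p ^ a]-multiples of the group generated by the points with coordinates [X v i];
   the coefficients are common to all coordinates. *)
pose Sa (a : nat) : set P := [set y | exists n (c : nat -> int),
  forall v, L' (y v - (\sum_(i < n) X v i *~ c i) *+ p ^ a)].
have sDD : subgroup DD.
  by split=> [v|x y Dx Dy v]; [exact: sL'.1|apply: (subgroupB sL' (Dx v) (Dy v))].
have cDD : compact DD by exact: (@tychonoff nat (fun=> K) (fun=> L') (fun=> cL')).
have DSa a : DD `<=` Sa a.
  by move=> y Dy; exists 0%N, (fun=> 0) => v; rewrite big_ord0 mul0rn subr0.
have sSa a : subgroup (Sa a).
  split; first by apply: DSa; exact: sDD.1.
  move=> x y [n [c hc]] [n' [c' hc']].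
  exists (n + n')%N, (fun i => (if (i < n)%N then c i else 0) - (if (i < n')%N then c' i else 0)) => v.
  have -> : \sum_(i < n + n') X v i *~ ((if (i < n)%N then c i else 0) - (if (i < n')%N then c' i else 0)) =
      \sum_(i < n) X v i *~ c i - \sum_(i < n') X v i *~ c' i.
    rewrite -(sum_truncate _ c (leq_addr n' n)) -(sum_truncate _ c' (leq_addl n n')) -sumrB.
    by apply: eq_bigr => i _; rewrite mulrzBr.
  rewrite mulrnBl -[(x - y) v]/(x v - y v).
  have -> : x v - y v - ((\sum_(i < n) X v i *~ c i) *+ p ^ a - (\sum_(i < n') X v i *~ c' i) *+ p ^ a) =
    (x v - (\sum_(i < n) X v i *~ c i) *+ p ^ a) - (y v - (\sum_(i < n') X v i *~ c' i) *+ p ^ a) by zmodule.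
  exact: subgroupB.
have SaH a : Sa a `<=` Sa 0%N.
  move=> y [n [c hc]]; exists n, (fun i => c i * (p ^ a)%:Z) => v; rewrite expn0.
  have -> : \sum_(i < n) X v i *~ (c i * (p ^ a)%:Z) = (\sum_(i < n) X v i *~ c i) *+ p ^ a.
    by rewrite -sumrMnl; apply: eq_bigr => i _; rewrite mulrzA -pmulrn.
  exact: hc.
have nbW a : nbhs (0 : P) [set y : P | forall v, (v < a)%N -> W v (y v)].
  elim: a => [|a IH]; first by apply: (nbhs0S _ (filterT (F := nbhs (0 : P)))) => y _ v.
  have [W0 _ _] := hWX a.
  apply: (nbhs0S _ (nbhs0I IH (prod_proj_nbhs (T := fun _ => K) (i := a) W0))) => y [h1 h2] v.
  by rewrite ltnS leq_eqVlt => /predU1P[->|/h1].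
have tbH : totally_bounded (Sa 0%N).
  apply: (@minprop_totally_bounded R P power_hausdorff mP DD) => //.
  move=> V V0; have [n0 [U [U0 UV]]] := power_nbhsP V0; have [a ha] := hA' U U0.
  exists (Sa a); split=> //.
    exists [set y : P | forall v, (v < a)%N -> W v (y v)]; first exact: nbW.
    move=> y [[n [c hc]] hW].
    (* Let [p ^ v], with [v < a], be the exact power dividing all coefficients. Either [p ^ v A]
       lies in [L'], and the element is in [DD], or its smallness in coordinate [v] contradicts
       independence. *)
    have [hdiv|[v va [c' cc' ndiv]]] := first_nondivisible a n c.
      exists n, (fun i => (c i %/ (p ^ a)%:Z)%Z) => v.
      have <- : (\sum_(i < n) X v i *~ c i) *+ p ^ 0 = (\sum_(i < n) X v i *~ (c i %/ (p ^ a)%:Z)%Z) *+ p ^ a.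
        rewrite expn0 mulr1n -sumrMnl; apply: eq_bigr => i _.
        by rewrite pmulrn -mulrzA divzK// hdiv.
      exact: hc.
    have eX w : (\sum_(i < n) X w i *~ c i) *+ p ^ 0 = (\sum_(i < n) X w i *~ c' i) *+ p ^ v.
      by rewrite expn0 mulr1n -sumrMnl; apply: eq_bigr => i _; rewrite cc'// mulrzA -pmulrn.
    have [_ _ [good|[bad _]]] := hWX v.
      apply: DSa => w; have := hc w; rewrite eX => h.
      have -> : y w = (y w - (\sum_(i < n) X w i *~ c' i) *+ p ^ v) + (\sum_(i < n) X w i *~ c' i) *+ p ^ v.
        by rewrite subrK.
      by apply: subgroupD => //; apply: good; exact: AX.
    exfalso; have := hc v; rewrite eX => h; apply: (bad n c' _ h ndiv).
    by rewrite addrC subrK; exact: hW.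
  move=> y [n [c hc]]; have /choice[l hl] : forall v, exists l, L' l /\ U ((\sum_(i < n) X v i *~ c i) *+ p ^ a - l).
    by move=> v; have [l Ll h] := ha _ (AX v n c); exists l.
  exists (fun v => (y v - (\sum_(i < n) X v i *~ c i) *+ p ^ a) + l v).
    by move=> v; apply: subgroupD => //; exact: (hl v).1.
  apply: UV => v _; have := (hl v).2.
  set z := _ *+ _; rewrite -[(y - _) v]/(y v - (y v - z + l v)).
  by have -> : y v - (y v - z + l v) = z - l v by zmodule.
have [_ AX0 [good|[_ sep]]] := hWX 0%N.
  apply: ntA; apply: totally_boundedW tL' => x Ax; have := good x Ax; by rewrite expn0.
pose h i : P := fun v => X v i.
have Hh i : Sa 0%N (h i).
  exists i.+1, (fun k => (nat_of_bool (k == i))%:Z) => v.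
  by rewrite sum_delta// expn0 subrr; exact: sL'.1.
have [W0 _ _] := hWX 0%N.
have PW := prod_proj_nbhs (T := fun _ => K) (i := 0%N) W0.
have [V V0 VW] := nbhs0_sub PW.
have [i [j [ij hij]]] := big_pigeonhole VW (tbH _ V0) Hh.
by apply: (sep i j ij); rewrite expn0; exact: hij.
Qed.

End PrimaryTotallyBounded.

(** * Primary components and compactness of the completion *)

Section PrimaryProjectors.

(* The integer [projector p n] tends to the [p]-adic idempotent of the profinite integers. *)
Definition projector (p n : nat) : nat := chinese n`!`_p n`!`_(negn p) 1 0.

Lemma projector1 (p n : nat) : projector p n = 1 %[mod n`!`_p].
Proof. exact: chinese_modl (coprime_partC _ _ _) _ _. Qed.

Lemma dvdn_projector (p n : nat) : (n`!`_(negn p) %| projector p n)%N.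
Proof.
have := chinese_modr (coprime_partC p n`! n`!) 1 0.
by rewrite /dvdn /projector mod0n => ->.
Qed.

Lemma projector_mod (p m n : nat) : (n <= m)%N -> projector p m = projector p n %[mod n`!].
Proof.
move=> nm; have d := fact_dvdn nm; have m0 := fact_gt0 m.
apply/eqP; rewrite -{1 2}(partnC p (fact_gt0 n)) chinese_remainder ?coprime_partC//.
apply/andP; split; apply/eqP.
  rewrite projector1 -(modn_dvdm _ (partn_dvd p m0 d)) projector1.
  by rewrite modn_dvdm // partn_dvd.
have /eqP -> := dvdn_projector p n; apply/eqP; apply: dvdn_trans (dvdn_projector p m).
exact: partn_dvd.
Qed.

(** Modulo the [q]-part of [n!] only the projector of [q] survives, with value 1, and every prime
    divisor of [n!] occurs in the sum. *)
Lemma sum_projectors n : \sum_(p < n`!.+1 | prime p) projector p n = 1 %[mod n`!].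
Proof.
set N := n`!; have N0 : (0 < N)%N := fact_gt0 n; set a := (\sum_(p < _ | _) _)%N.
(* [a + N.-1] stands for [a - 1] modulo [N], as subtraction of naturals truncates. *)
have key : (N %| a + N.-1)%N.
  apply/(dvdn_partP _ N0) => q; rewrite mem_primes => /and3P[pq _ qN].
  have qlt : (q < N.+1)%N by rewrite ltnS dvdn_leq.
  rewrite /a (bigD1 (Ordinal qlt))//= addnAC dvdn_addl.
    have h := projector1 q n; have NqN : (N`_q %| N)%N := dvdn_part q N.
    by rewrite /dvdn -modnDml h modnDml add1n prednK.
  apply: (big_ind (fun x => N`_q %| x)%N) => // [x y|i /andP[pi iq]]; first exact: dvdn_add.
  apply: dvdn_trans (dvdn_projector i n); apply: sub_in_partn => x _.
  by rewrite !inE => /eqP ->; move: iq; rewrite -val_eqE eq_sym.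
move/eqP: key => h.
have -> : (a %% N = (a + N.-1 + 1) %% N)%N by rewrite -addnA addn1 prednK// modnDr.
by rewrite -modnDml h.
Qed.

Lemma mod_mulrn (G : zmodType) a b N : a = b %[mod N] ->
  exists c : int, forall x : G, x *+ a - x *+ b = (x *~ c) *+ N.
Proof.
move=> e; exists ((a %/ N)%N%:Z - (b %/ N)%N%:Z) => x.
rewrite {1}(divn_eq a N) {1}(divn_eq b N) e !mulrnDr mulrzBr mulrnBl -!pmulrn -!mulrnA; zmodule.
Qed.

End PrimaryProjectors.

Section PowerMinimalCompact.
Context (R : realType) (K : topologicalZmodType).
Hypotheses (hK : hausdorff_space K) (cK : complete_group K).
Hypothesis mP : minprop (prod_topology (fun _ : nat => K)).

Let K_big U : nbhs (0 : K) U -> exists2 k, (0 < k)%N & big (multiples K k) U.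
Proof. by move=> U0; exact: (minprop_multiples_big hK (minprop_power mP) U0). Qed.

Local Notation D := (@divpart K).

(** Defined by approximate divisibility prime to [p] rather than by torsion; in particular it
    contains [divpart]. *)
Definition primary_part (p : nat) : set K :=
  [set x | forall b, (0 < b)%N -> coprime p b -> closure (multiples K b) x].

Lemma primary_part_subgroup p : subgroup (primary_part p).
Proof.
have cs b := closure_subgroup (multiples_subgroup K b).
by split=> [b _ _|x y hx hy b b0 pb]; [exact: (cs b).1|apply: (subgroupB (cs b)); [exact: hx|exact: hy]].
Qed.

(** Write [k = b * p ^ a] with [b] prime to [p]. As [x] is close to some [b z], [p ^ a x] is close
    to [k z], which is close to [divpart]. *)
Lemma primary_part_totally_bounded p : prime p -> totally_bounded (primary_part p).
Proof.
move=> pp; refine (p_filtered_totally_bounded R hK cK mP pp (primary_part_subgroup p)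
  (divpart_subgroup K) (divpart_compact cK K_big) _).
move=> V V0; have [V1 [V10 V1N V1V hV1]] := nbhs0_add V0.
have [k k0 hk] := divpart_absorb cK K_big V10.
pose b := (k`_(negn p))%N; pose a := logn p k.
have kE : k = (b * p ^ a)%N by rewrite mulnC -p_part partnC.
exists a => x hx; have [V2 [V20 _ V2V1 hV2]] := nbhs0_muln (p ^ a) V10.
have b0 : (0 < b)%N by exact: part_gt0.
have pb : coprime p b.
  by rewrite prime_coprime// -p'natE//; exact: part_pnat.
have /closure_sub'/(_ _ V20)[_ [z _ <-] hz] := hx b b0 pb.
have [|d Dd hd] := hk (z *+ k); first by exists z.
exists d => //.
have -> : x *+ p ^ a - d = (x - z *+ b) *+ p ^ a + (z *+ k - d).
  by rewrite mulrnBl -mulrnA -kE; zmodule.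
by have [] := hV1 _ _ (hV2 _ _ hz (leqnn _)) hd.
Qed.

Lemma closure_multiples_absorb U : nbhs (0 : K) U -> exists n : nat,
  forall x, closure (multiples K n`!) x -> exists2 d, D d & U (x - d).
Proof.
move=> U0; have [V [V0 VN VU hV]] := nbhs0_add U0.
have [k k0 hk] := divpart_absorb cK K_big V0; exists k => x /closure_sub'/(_ _ V0)[y hy hxy].
have [|d Dd hd] := hk y; first by apply: multiples_dvd hy; rewrite dvdn_fact// k0 leqnn.
exists d => //; have -> : x - d = (x - y) + (y - d) by zmodule.
by have [] := hV _ _ hxy hd.
Qed.

(** From [n] on the points [x *+ projector p m] differ by elements of [n! K], which lie close to the
    totally bounded [divpart]. An ultrafilter on them is therefore Cauchy; completeness stands in
    for the compactness still to be proved. *)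
Lemma primary_component p x : prime p -> exists2 y, primary_part p y &
  forall n, closure (multiples K n`!) (y - x *+ projector p n).
Proof.
move=> pp; pose C n := [set y | closure (multiples K n`!) (y - x *+ projector p n)].
have cs b := closure_subgroup (multiples_subgroup K b).
have Cle m n : (n <= m)%N -> C m `<=` C n.
  move=> nm y Cy; have [c hc] := mod_mulrn K (projector_mod p nm).
  change (closure (multiples K n`!) (y - x *+ projector p n)).
  have -> : y - x *+ projector p n = (y - x *+ projector p m) + (x *+ projector p m - x *+ projector p n) by zmodule.
  apply: (subgroupD (cs _)); last by rewrite hc; apply: subset_closure; exists (x *~ c).
  by apply: closureS Cy; apply: multiples_dvd; exact: fact_dvdn.
have FF : ProperFilter (filter_from [set: nat] C).
  apply: filter_from_proper; last first.
    by move=> n _; exists (x *+ projector p n); rewrite /C /= subrr; exact: (cs _).1.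
  apply: filter_from_filter; first by exists 0%N.
  move=> m n _ _; exists (maxn m n) => // y Cy.
  by split; apply: Cle Cy; rewrite ?leq_maxl ?leq_maxr.
have [G [UG FG]] := ultraFilterLemma FF.
have GC n : G (C n) by apply: FG; exists n.
have PG : ProperFilter G by exact: ultra_proper.
have [|y Gy] := @cK G PG.
  move=> U U0; have [V V0 hV] := nbhs0_sub U0.
  have [V1 [V10 V1N V1V hV1]] := nbhs0_add V0.
  have [n hn] := closure_multiples_absorb V10.
  have [F hF] := divpart_totally_bounded K_big V10.
  apply: (ultra_big (S := C n) (U := V)) => //; exists [seq x *+ projector p n + f | f <- F].
  move=> z /hn[d Dd hd]; have [f fF hf] := hF d Dd; exists (x *+ projector p n + f); first exact: map_f.
  have -> : z - (x *+ projector p n + f) = (z - x *+ projector p n - d) + (d - f) by zmodule.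
  by have [] := hV1 _ _ hd hf.
have Cy n : C n y.
  apply/closure_sub => U U0; have [V [V0 VN VU hV]] := nbhs0_add U0.
  have Gn : G (C n `&` [set z | V (z - y)]) by apply: filterI; [exact: GC|exact: (Gy _ (nbhs_subx y V0))].
  have [z [/closure_sub/(_ _ V0)[a Ha Va] Vz]] := @filter_ex _ G PG _ Gn.
  exists a => //; have -> : a - (y - x *+ projector p n) = (a - (z - x *+ projector p n)) + (z - y) by zmodule.
  by have [] := hV _ _ Va Vz.
exists y => // b b0 pb.
have -> : y = (y - x *+ projector p b) + x *+ projector p b by rewrite subrK.
have bb : (b %| b`!)%N by rewrite dvdn_fact// b0 leqnn.
apply: (subgroupD (cs b)); first by apply: closureS (Cy b); exact: multiples_dvd.
apply: subset_closure; apply: (@multiples_dvd _ b (projector p b)); last by exists x.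
apply: dvdn_trans (dvdn_projector p b).
rewrite -(@Gauss_dvdr _ b`!`_p) ?partnC ?fact_gt0//.
by rewrite p_part coprime_sym coprimeXl.
Qed.

Definition primary_sums (m : nat) : set K := [set x | exists2 f : nat -> K,
  (forall p, prime p -> primary_part p (f p)) & x = \sum_(p < m | prime p) f p].

Lemma primary_sums_totally_bounded m : totally_bounded (primary_sums m).
Proof.
elim: m => [|m IH].
  move=> U U0; exists [:: 0] => _ [f _ ->]; exists 0; first exact: mem_head.
  by rewrite big_ord0 subr0; exact: nbhs0_0.
have [pm|npm] := boolP (prime m); last first.
  by apply: totally_boundedW IH => _ [f hf ->]; exists f; rewrite // big_mkcond big_ord_recr /= (negbTE npm) addr0 -big_mkcond.
apply: totally_boundedW (totally_bounded_add IH (primary_part_totally_bounded pm)) => _ [f hf ->].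
exists (\sum_(p < m | prime p) f p); first by exists f.
by exists (f m); [exact: hf|rewrite [RHS]big_mkcond big_ord_recr /= pm -big_mkcond].
Qed.

Theorem power_minimal_compact : compact [set: K].
Proof.
apply: closed_totally_bounded_compact => //.
apply: totally_bounded_approx => U U0; have [n hn] := closure_multiples_absorb U0.
exists [set x + y | x in primary_sums n`!.+1 & y in D].
  by apply: totally_bounded_add; [exact: primary_sums_totally_bounded|exact: (divpart_totally_bounded K_big)].
move=> x _; have /choice[y hy] : forall p, exists y, prime p ->
    primary_part p y /\ closure (multiples K n`!) (y - x *+ projector p n).
  move=> p; have [pp|npp] := boolP (prime p); last by exists 0.
  by have [y Ey hy] := primary_component x pp; exists y.
pose s := \sum_(p < n`!.+1 | prime p) y p.
have cs := closure_subgroup (multiples_subgroup K n`!).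
(* The projectors sum to 1 modulo [n!], so [x] minus its components lies in the closure of
   [n! K]. *)
have [d Dd hd] : exists2 d, D d & U (x - s - d).
  apply: hn; have [c hc] := mod_mulrn K (sum_projectors n).
  have -> : x - s = - ((x *+ (\sum_(p < n`!.+1 | prime p) projector p n)) - x *+ 1)
      - \sum_(p < n`!.+1 | prime p) (y p - x *+ projector p n).
    have eS : x *+ (\sum_(p < n`!.+1 | prime p) projector p n) =
        \sum_(p < n`!.+1 | prime p) x *+ projector p n by rewrite sumrMnr.
    rewrite sumrB -/s eS mulr1n; set T := \sum_(p < _ | _) (x *+ _).
    zmodule.
  apply: (subgroupB cs); first by apply: (subgroupN cs); rewrite hc; apply: subset_closure; exists (x *~ c).
  by apply: (subgroup_sum cs) => p pp; have [] := hy p pp.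
exists (s + d); last by have -> : x - (s + d) = x - s - d by zmodule.
by exists s; [exists y => // p pp; have [] := hy p pp|exists d].
Qed.

End PowerMinimalCompact.

(** * Essential subgroups and closed monothetic subgroups *)

Lemma essential_dense (G H : topologicalZmodType) (f : {additive G -> H}) (M : set H) :
  dense_embedding f -> minprop G -> hausdorff_space H -> subgroup M -> closed M ->
  (forall g, M (f g) -> g = 0) -> forall x, M x -> x = 0.
Proof.
move=> [finj fc fo fd] mG hH sM cM ess.
(* The topology that [G] inherits from the quotient of [H] by [M]. It is Hausdorff since [M] is
   closed and meets [G] trivially, so minimality makes it the given one; but points of [G] close to
   [x] in [M] are small for it. *)
pose B : set (set G) := [set A | exists2 U, nbhs (0 : H) U & A = [set g | exists2 a, M a & U (f g - a)]].
have gB : group_base B.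
  split.
  - by exists [set g | exists2 a, M a & setT (f g - a)], setT => //; exact: filterT.
  - move=> _ _ [U U0 ->] [V V0 ->]; exists [set g | exists2 a, M a & (U `&` V) (f g - a)].
      by exists (U `&` V) => //; exact: filterI.
    by move=> g [a Ma [Ug Vg]]; split; exists a.
  - by move=> _ [U U0 ->]; exists 0; [exact: sM.1|rewrite raddf0 subrr; exact: nbhs0_0].
  move=> _ [U U0 ->]; have [V V0 VU] := nbhs0_sub U0.
  exists [set g | exists2 a, M a & V (f g - a)]; first by exists V.
  move=> x y [a Ma Va] [b Mb Vb]; exists (a - b); first exact: subgroupB.
  have fB : f (x - y) = f x - f y := raddfB f x y.
  have -> : f (x - y) - (a - b) = (f x - a) - (f y - b) by rewrite fB; zmodule.
  exact: VU.
have BN V : B V -> nbhs (0 : G) V.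
  move=> [U U0 ->]; apply: nbhs0S (fc U U0) => g Ug; exists 0; first exact: sM.1.
  by rewrite subr0.
have sep g : (forall V, B V -> V g) -> g = 0.
  move=> hg; apply: ess; apply: cM; apply/closure_sub' => U U0.
  by apply: (hg [set g | exists2 a, M a & U (f g - a)]); exists U.
move=> x Mx; apply: (hausdorff_sep0 H).1 => // U U0.
have [V [V0 VN VU hV]] := nbhs0_add U0.
have [_ [W W0 ->] hW] := mG B gB BN sep _ (fc V V0).
have [W' [W'0 W'N W'W _]] := nbhs0_add (filterI W0 V0).
have [g hg] := fd x _ W'0.
have Vg : V (f g).
  by apply: (hW g); exists x => //; rewrite -opprB; have [] := W'W _ (W'N _ hg).
have -> : x = f g + (x - f g) by zmodule.
by have [_ Vx] := W'W _ hg; have [] := hV _ _ Vg Vx.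
Qed.

Section Monothetic.
Context (H : topologicalZmodType) (x : H).

(** The closure of the group generated by [n x]; with [n = 1], the closed monothetic subgroup of
    [x]. *)
Definition cyclic_multiples (n : nat) : set H := closure [set (x *~ c) *+ n | c in [set: int]].

Lemma cyclic_multiples_subgroup n : subgroup (cyclic_multiples n).
Proof.
apply: closure_subgroup; split; first by exists 0; rewrite // mulr0z mul0rn.
by move=> _ _ [c _ <-] [d _ <-]; exists (c - d); rewrite // mulrzBr mulrnBl.
Qed.

Lemma cyclic_multiples_dvd m n : (m %| n)%N -> cyclic_multiples n `<=` cyclic_multiples m.
Proof.
move=> /dvdnP[k ->]; apply: closureS => _ [c _ <-]; exists (c * k%:Z) => //.
by rewrite mulrzA -pmulrn -mulrnA.
Qed.

Lemma cyclic_multiples_mulrn n a : (n %| a)%N -> cyclic_multiples n (x *+ a).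
Proof.
move=> /dvdnP[k ->]; apply: subset_closure; exists k%:Z => //.
by rewrite -pmulrn -mulrnA.
Qed.

Lemma cyclic_multiples_mod n a b : a = b %[mod n] -> cyclic_multiples n (x *+ a - x *+ b).
Proof. by move=> /(mod_mulrn H)[c ->]; apply: subset_closure; exists c. Qed.

Lemma cyclic_multiples_small U : nbhs (0 : H) U -> exists2 V, nbhs (0 : H) V &
  forall n, (forall c : nat, V (x *+ (n * c))) -> cyclic_multiples n `<=` U.
Proof.
move=> U0; have [V [V0 VN VU hV]] := nbhs0_add U0; exists V => // n hn z /closure_sub'/(_ _ V0)[_ [c _ <-] hz].
have -> : z = (z - x *~ c *+ n) + x *~ c *+ n by zmodule.
suff Vc : V (x *~ c *+ n) by have [] := hV _ _ hz Vc.
case: c {hz} => c; first by rewrite -pmulrn -mulrnA mulnC.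
by rewrite NegzE mulrNz mulNrn -pmulrn -mulrnA mulnC; exact: VN.
Qed.

Lemma finite_nbhs0 n (Q : nat -> set H) : (forall i, (i < n)%N -> nbhs (0 : H) (Q i)) ->
  nbhs (0 : H) [set z | forall i, (i < n)%N -> Q i z].
Proof.
elim: n => [|n IH] hQ; first by apply: (nbhs0S _ (@filterT _ (nbhs (0 : H)) _)) => z _.
apply: (nbhs0S _ (nbhs0I (IH _) (hQ n (leqnn _)))) => [z [h1 h2] i|i lt_in]; last by apply: hQ; exact: ltnW.
by rewrite ltnS leq_eqVlt => /predU1P[->|/h1].
Qed.

(** The multiples of [m x] fall into finitely many cosets of the group generated by [n x], and the
    closure of a finite union is the union of the closures. *)
Lemma cyclic_residue (y : H) m n r : (m %| n)%N -> (0 < n)%N -> cyclic_multiples m (y - x *+ r) ->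
  exists2 r', r' = r %[mod m] & cyclic_multiples n (y - x *+ r').
Proof.
move=> mn n0 hy; apply: contrapT => no.
have /choice[Q hQ] : forall i, exists Q : set H, r + i * m = r %[mod m] -> nbhs (0 : H) Q /\
    forall c : int, ~ Q (y - x *+ (r + i * m) - (x *~ c) *+ n).
  move=> i; have [e|ne] := eqVneq ((r + i * m) %% m)%N (r %% m)%N; last by exists setT => /eqP; rewrite (negbTE ne).
  apply: contrapT => nQ; apply: no; exists (r + i * m)%N => //; apply/closure_sub' => U U0.
  apply: contrapT => nc; apply: nQ; exists U => _; split=> // c Uc; apply: nc.
  by exists (x *~ c *+ n) => //; exists c.
have md i : r + i * m = r %[mod m] by rewrite addnC modnMDl.
have N0 := @finite_nbhs0 (n %/ m) Q (fun i _ => (hQ i (md i)).1).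
have /closure_sub'/(_ _ N0)[_ [c _ <-] hc] := hy.
have m0 : (0 < m)%N by move: mn; case: (m) => //; rewrite dvd0n => /eqP n00; rewrite n00 in n0.
pose s := (n %/ m)%N; have nE : n = (s * m)%N by rewrite divnK.
have s0 : (0 < s)%N by rewrite divn_gt0// dvdn_leq.
have r0 : (0 <= (c %% s%:Z)%Z)%R by rewrite modz_ge0// eqz_nat; lia.
have rlt : ((c %% s%:Z)%Z < s%:Z)%R by rewrite ltz_pmod.
pose i := `|(c %% s%:Z)%Z|%N; have lt_is : (i < s)%N.
  by rewrite /i; move: r0 rlt; move: (c %% s%:Z)%Z => z; lia.
have ec : x *~ c = x *~ (c %/ s%:Z)%Z *+ s + x *+ i.
  rewrite {1}(divz_eq c s%:Z) mulrzDr mulrzA -pmulrn; congr (_ + _).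
  by rewrite pmulrn gez0_abs.
apply: ((hQ i (md i)).2 (c %/ s%:Z)%Z); have := hc i lt_is.
have -> // : y - x *+ r - x *~ c *+ m = y - x *+ (r + i * m) - x *~ (c %/ s%:Z)%Z *+ n.
by rewrite ec mulrnDl -!mulrnA -nE mulrnDr; zmodule.
Qed.

End Monothetic.

(** Topologically [p]-torsion. The factor [c] makes the whole groups generated by [p ^ n x] shrink
    to zero. *)
Definition ptors (p : nat) (H : topologicalZmodType) (x : H) : Prop :=
  forall U, nbhs (0 : H) U -> exists n, forall c : nat, U (x *+ (p ^ n * c)).

Lemma ptors_small p (H : topologicalZmodType) (x : H) U : ptors p x -> nbhs (0 : H) U ->
  exists n, forall m, (n <= m)%N -> cyclic_multiples x (p ^ m) `<=` U.
Proof.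
move=> tx /(cyclic_multiples_small x)[V V0 hV]; have [n hn] := tx V V0; exists n => m nm.
by apply: hV => c; have := hn (p ^ (m - n) * c)%N; rewrite mulnA -expnD subnKC.
Qed.

Lemma dvdn_mod_eq d N a b : (d %| N)%N -> a = b %[mod N] -> (d %| a)%N = (d %| b)%N.
Proof. by move=> dN e; rewrite /dvdn -(modn_dvdm a dN) e modn_dvdm. Qed.

Lemma inverse_mod u N : coprime u N -> (0 < N)%N -> exists d, (d * u)%N = 1 %[mod N].
Proof.
move=> co N0; exists (chinese u N 0 1 %/ u)%N.
by rewrite divnK ?(chinese_modr co)//; apply/eqP; rewrite (chinese_modl co) mod0n.
Qed.

(** The closed group generated by [x] is an image of the [p]-adic integers, in which a nonzero [y]
    generates the same closed ideal as some [p ^ a]. Here [a] is the valuation of a residue of [y];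
    finer residues keep it, and their unit part is inverted modulo a power of [p]. *)
Lemma monothetic_power p (H : topologicalZmodType) (x y : H) : prime p -> hausdorff_space H ->
  ptors p x -> cyclic_multiples x 1 y -> y <> 0 ->
  exists a, forall m, exists d, cyclic_multiples x (p ^ m) (x *+ p ^ a - y *+ d).
Proof.
move=> pp hH tx yx y0; have cs k := cyclic_multiples_subgroup x k.
have pn0 k : (0 < p ^ k)%N by rewrite expn_gt0 prime_gt0.
have [n hn] : exists n, ~ cyclic_multiples x (p ^ n) y.
  apply: contrapT => no; apply: y0; apply: (hausdorff_sep0 H).1 => // U U0.
  have [n hn] := ptors_small tx U0; apply: (hn n (leqnn _)).
  by apply: contrapT => h; apply: no; exists n.
have yx0 : cyclic_multiples x 1 (y - x *+ 0) by rewrite mulr0n subr0.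
have [r _ hr] := cyclic_residue (dvd1n (p ^ n)) (pn0 n) yx0.
have nr : ~~ (p ^ n %| r)%N.
  apply/negP => /(cyclic_multiples_mulrn (x := x)) h; apply: hn.
  by rewrite -(subrK (x *+ r) y); exact: (subgroupD (cs _)).
have r0 : (0 < r)%N by case: (r) nr => //; rewrite dvdn0.
have an : (logn p r < n)%N by move: nr; rewrite pfactor_dvdn// -ltnNge.
exists (logn p r) => m; set a := logn p r.
have pmn : (p ^ n %| p ^ (m + n))%N by rewrite dvdn_exp2l// leq_addl.
have [r' e' hr'] := cyclic_residue pmn (pn0 _) hr.
have d1 : (p ^ a %| r')%N.
  by rewrite (dvdn_mod_eq (dvdn_exp2l p (ltnW an)) e') pfactor_dvdn.
have d2 : ~~ (p ^ a.+1 %| r')%N.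
  by rewrite (dvdn_mod_eq (dvdn_exp2l p an) e') pfactor_dvdn// ltnn.
have /dvdnP[u ru] := d1.
have pu : coprime u (p ^ (m + n)).
  rewrite coprime_sym; apply: coprimeXl; rewrite prime_coprime//; apply: contra d2.
  by rewrite ru expnS => h; rewrite dvdn_pmul2r.
have [d hd] := inverse_mod pu (pn0 _); exists d.
apply: (@cyclic_multiples_dvd _ x (p ^ m) (p ^ (m + n))); first by rewrite dvdn_exp2l// leq_addr.
have -> : x *+ p ^ a - y *+ d = - (x *+ (r' * d) - x *+ p ^ a) - (y - x *+ r') *+ d.
  have eM : x *+ (r' * d) = x *+ r' *+ d by rewrite mulrnA.
  by rewrite mulrnBl eM; zmodule.
apply: (subgroupB (cs _)); last exact: (subgroupMn (cs _)).
apply: (subgroupN (cs _)); apply: cyclic_multiples_mod.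
by rewrite ru mulnC mulnA -modnMml hd modnMml mul1n.
Qed.

Section EssentialRange.
Context (G K : topologicalZmodType) (f : {additive G -> K}).
Hypotheses (df : dense_embedding f) (hK : hausdorff_space K).
Hypothesis mP : minprop (prod_topology (fun _ : nat => G)).
Hypothesis seqG : forall (u : nat -> K) (l : K), (forall n, exists g, f g = u n) ->
  (forall U, nbhs (0 : K) U -> exists N, forall n, (N <= n)%N -> U (u n - l)) -> exists g, f g = l.
Local Notation PK := (prod_topology (fun _ : nat => K)).

Lemma ptors_power p (x : PK) : (forall k, ptors p (x k)) -> ptors p x.
Proof.
move=> tx A A0; have [n0 [U [U0 UA]]] := power_nbhsP A0.
have /choice[n hn] : forall k, exists n, forall c : nat, U (x k *+ (p ^ n * c)) by move=> k; exact: tx.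
exists (\max_(k < n0) n k)%N => c; apply: UA => k kn0.
have projM (z : PK) i : (z *+ i) k = z k *+ i by elim: i => // i IH; rewrite !mulrS -IH.
have le : (n k <= \max_(k < n0) n k)%N by exact: (leq_bigmax (Ordinal kn0)).
have := hn k (p ^ (\max_(k < n0) n k - n k) * c)%N.
by rewrite mulnA -expnD subnKC// projM.
Qed.

(** Diagonal argument. If [X k] violates exponent [k], the closed group generated by [X] in the
    power contains a nonzero point of the power of [G], hence [p ^ a X] is a limit of a sequence of
    multiples of that point. Coordinate [a] contradicts the choice of [X a]. *)
Lemma primary_in_range p : prime p -> exists k, forall x, ptors p x -> exists g, f g = x *+ p ^ k.
Proof.
move=> pp; apply: contrapT => no.
have /choice[X hX] : forall k, exists x, ptors p x /\ ~ exists g, f g = x *+ p ^ k.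
  move=> k; apply: contrapT => nx; apply: no; exists k => x tx.
  by apply: contrapT => ng; apply: nx; exists x.
have tX : ptors p (X : PK) by apply: ptors_power => k; have [] := hX k.
pose M := cyclic_multiples (X : PK) 1; have sM : subgroup M by exact: cyclic_multiples_subgroup.
have [g Mg g0] : exists2 g, M (power_map f g) & g <> 0.
  apply: contrapT => ng.
  have X0 : (X : PK) = 0.
    apply: (essential_dense (dense_embedding_power df) mP (power_hausdorff hK) sM).
    - exact: closed_closure.
    - by move=> g Mg; apply: contrapT => g0; apply: ng; exists g.
    by apply: subset_closure; exists 1.
  have [_ []] := hX 0%N; exists 0; rewrite (_ : X 0%N = 0) ?mul0rn ?raddf0//.
  by have := congr1 (fun z : PK => z 0%N) X0.
have y0 : power_map f g <> 0.
  move=> h; apply: g0; have [inj _ _ _] := dense_embedding_power df; apply: inj.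
  exact: (etrans h (esym (raddf0 (power_map f)))).
have [a ha] := monothetic_power pp (power_hausdorff hK) tX Mg y0.
have /choice[d hd] := ha; have [_ []] := hX a.
apply: (seqG (u := fun m => f (g a) *+ d m)) => [m|U U0].
  by exists (g a *+ d m); rewrite raddfMn.
have PU : nbhs (0 : PK) [set z : PK | U (- z a)].
  have [V [V0 VN VU _]] := nbhs0_add U0.
  by apply: (nbhs0S _ (prod_proj_nbhs (T := fun _ => K) (i := a) V0)) => z Vz; apply: VU; exact: VN.
have [N hN] := ptors_small tX PU; exists N => m Nm; have := hN m Nm _ (hd m).
have projM (z : PK) i : (z *+ i) a = z a *+ i by elim: i => // i IH; rewrite !mulrS -IH.
rewrite /= -[(_ - _) a]/((X *+ p ^ a : PK) a - (power_map f g *+ d m) a) !projM opprB; exact.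
Qed.

(** A nonzero [x] generates a group of order [p]; essentiality puts a nonzero element of [G] in it,
    and that element generates it. *)
Lemma socle_in_range p x : prime p -> x *+ p = 0 -> exists g, f g = x.
Proof.
move=> pp px; have [->|x0] := pselect (x = 0); first by exists 0; rewrite raddf0.
have cyc_p z : cyclic_multiples x p z -> z = 0.
  move=> hz; apply: (hausdorff_sep0 K).1 => // U U0; have [V V0 hV] := cyclic_multiples_small x U0.
  by apply: hV hz => c; rewrite mulrnA px mul0rn; exact: nbhs0_0.
have sM := cyclic_multiples_subgroup x 1.
have [g Mg g0] : exists2 g, cyclic_multiples x 1 (f g) & g <> 0.
  apply: contrapT => ng; apply: x0.
  apply: (essential_dense df (minprop_power mP) hK sM).
  - exact: closed_closure.
  - by move=> g Mg; apply: contrapT => g0; apply: ng; exists g.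
  by apply: subset_closure; exists 1.
have Mg0 : cyclic_multiples x 1 (f g - x *+ 0) by rewrite mulr0n subr0.
have [r _ /cyc_p/eqP] := cyclic_residue (dvd1n p) (prime_gt0 pp) Mg0; rewrite subr_eq0 => /eqP fg.
have pr : coprime r p.
  rewrite coprime_sym prime_coprime//; apply/negP => /dvdnP[k rk]; apply: g0.
  have [inj _ _ _] := df; apply: inj; rewrite raddf0 fg rk mulnC mulrnA px mul0rn//.
have [d hd] := inverse_mod pr (prime_gt0 pp); exists (g *+ d).
rewrite raddfMn /= fg -mulrnA mulnC; have [c hc] := mod_mulrn K hd.
have : x *~ c *+ p = 0 by rewrite pmulrn -mulrzA mulrC mulrzA -pmulrn px mul0rz.
by rewrite -hc mulr1n => /eqP; rewrite subr_eq0 => /eqP.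
Qed.

End EssentialRange.

(** * Topologically torsion points of a compact group *)

Section TorsionInCompact.
Context (R : realType) (K : topologicalZmodType).
Hypotheses (hK : hausdorff_space K) (cK : compact [set: K]).
Local Notation circle := (circle R).

(** The dual form of being topologically torsion; [torsion_valued_small] gives the topological
    form. *)
Definition torsion_valued (x : K) : Prop :=
  forall chi : K -> circle, character chi -> exists2 n, (0 < n)%N & chi x *+ n = 0.

Lemma torsion_valued_small x U : torsion_valued x -> nbhs (0 : K) U ->
  exists2 n, (0 < n)%N & cyclic_multiples x n `<=` U.
Proof.
move=> tx /(cyclic_multiples_small x)[V V0 hV].
have [L [e [hL e0 LV]]] := compact_bohr R hK cK V0.
have [n n0 hn] : exists2 n, (0 < n)%N & forall chi, chi \in L -> chi x *+ n = 0.
  elim: L hL {LV} => [|chi L IH] hL; first by exists 1%N.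
  have [psi hp|n n0 hn] := IH; first by apply: hL; rewrite inE hp orbT.
  have [m m0 hm] := tx chi (hL _ (mem_head _ _)); exists (m * n)%N; first by rewrite muln_gt0 m0.
  move=> psi; rewrite inE => /predU1P[->|/hn h]; first by rewrite mulrnA hm mul0rn.
  by rewrite mulnC mulrnA h mul0rn.
exists n => //; apply: hV => c; apply: LV => chi chiL.
by rewrite (homMn (hL _ chiL).1) mulrnA hn// mul0rn cnorm0.
Qed.

Lemma torsion_dense (t : circle) : exists s : nat -> circle,
  (forall n, exists2 k, (0 < k)%N & s n *+ k = 0) /\
  forall e : R, 0 < e -> exists N, forall n, (N <= n)%N -> cnorm (s n - t) < e.
Proof.
pose r := tlift t; pose q (n : nat) : R := (Num.floor (r * n.+1%:R))%:~R / n.+1%:R.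
have np n : n.+1%:R != 0 :> R by rewrite pnatr_eq0.
exists (fun n => tpi (q n)); split=> [n|e e0].
  exists n.+1 => //; have <- : tpi (q n *+ n.+1) = tpi (q n) *+ n.+1 by exact: raddfMn.
  have -> : q n *+ n.+1 = (Num.floor (r * n.+1%:R))%:~R by rewrite -[LHS]mulr_natr divfK.
  by rewrite -[RHS](raddf0 (@tpi R)); apply/tpi_eq; exists (Num.floor (r * n.+1%:R)); rewrite subr0.
have ei : 0 <= e^-1 by rewrite invr_ge0 ltW.
exists (Num.bound e^-1) => n Nn; rewrite -{1}(tliftK t) -/r.
have <- : tpi (q n - r) = tpi (q n) - tpi r by exact: raddfB.
apply: le_lt_trans (cnorm_tpi _) _.
have n0 : 0 < n.+1%:R :> R by rewrite ltr0n.
have h1 : (Num.bound e^-1 <= n.+1)%N by exact: leqW.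
have h2 : e^-1 < n.+1%:R by apply: lt_le_trans (archi_boundP ei) _; rewrite ler_nat.
have := floor_le (r * n.+1%:R); have := floorD1_gt (r * n.+1%:R) => h3 h4.
have -> : q n - r = - ((r * n.+1%:R - (Num.floor (r * n.+1%:R))%:~R) / n.+1%:R).
  by rewrite /q; field.
rewrite normrN ger0_norm; last by rewrite divr_ge0// subr_ge0.
rewrite ltr_pdivrMr//; apply: (@lt_trans _ _ 1).
  by move: h3; rewrite intrD; lra.
by rewrite mulrC -ltr_pdivrMr// mul1r.
Qed.

(* By divisibility of the circle the homomorphism sending a torsion character to the
   constant sequence of its value at [x] extends to all characters, with values in the
   sequences of torsion points converging to the value at [x]. *)
Lemma torsion_approx (x : K) : exists t : nat -> K, [/\ forall n, torsion_valued (t n),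
  forall n (chi : K -> circle) k, character chi -> (0 < k)%N -> chi *+ k = 0 -> chi (t n) = chi x &
  forall U, nbhs (0 : K) U -> exists N, forall n, (N <= n)%N -> U (t n - x)].
Proof.
pose Ad : set ((K -> circle) * (nat -> circle)) := [set q |
  (forall n, exists2 k, (0 < k)%N & q.2 n *+ k = 0) /\
  forall e : R, 0 < e -> exists N, forall n, (N <= n)%N -> cnorm (q.2 n - q.1 x) < e].
pose g0 : set ((K -> circle) * (nat -> circle)) := [set q |
  (exists2 k, (0 < k)%N & q.1 *+ k = 0) /\ q.2 = fun=> q.1 x].
have funMn (s : nat -> circle) k n : (s *+ k) n = s n *+ k.
  by elim: k => // k IH; rewrite !mulrS -IH.
have [||||||F [FB FAd Fg]] := @extend_hom (K -> circle) (nat -> circle) Ad _ _ _ g0.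
- split.
    split=> [n|e e0]; first by exists 1%N.
    by exists 0%N => n _; rewrite /= -[X in cnorm X]/(0 - 0) subr0 cnorm0.
  move=> [chi s] [chi' s'] [/= h1 h2] [/= h1' h2']; split=> /= [n|e e0].
    have [k k0 hk] := h1 n; have [k' k'0 hk'] := h1' n; exists (k * k')%N; first by rewrite muln_gt0 k0.
    rewrite -[(s - s') n]/(s n - s' n) mulrnBl mulrnA hk mul0rn mulnC mulrnA hk' mul0rn subr0//.
  have e2 : 0 < e / 2 by lra.
  have [N hN] := h2 _ e2; have [N' hN'] := h2' _ e2; exists (maxn N N') => n; rewrite geq_max => /andP[Nn N'n].
  rewrite -[(s - s') n]/(s n - s' n) -[(chi - chi') x]/(chi x - chi' x).
  have -> : s n - s' n - (chi x - chi' x) = (s n - chi x) - (s' n - chi' x) by zmodule.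
  by apply: le_lt_trans (cnormB _ _) _; have := hN n Nn; have := hN' n N'n; lra.
- move=> chi k s k0 [/= h1 h2].
  have kp : 0 < k%:R :> R by rewrite ltr0n.
  (* The [k]-th root of [s n] nearest to [chi x], so that convergence to [chi x] is inherited. *)
  pose z n : circle := chi x + tpi (tlift (s n - chi x *+ k) / k%:R).
  have zk n : z n *+ k = s n.
    rewrite /z mulrnDl.
    have <- : tpi (tlift (s n - chi x *+ k) / k%:R *+ k) = tpi (tlift (s n - chi x *+ k) / k%:R) *+ k by exact: raddfMn.
    by rewrite -[X in tpi X]mulr_natr divfK ?gt_eqF// tliftK addrC subrK.
  exists z; first by apply/funext => n; rewrite funMn.
  split=> /= [n|e e0].
    have [m m0 hm] := h1 n; exists (k * m)%N; first by rewrite muln_gt0 k0.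
    by rewrite mulrnA zk.
  have [N hN] := h2 e e0; exists N => n Nn; apply: le_lt_trans (hN n Nn).
  have -> : z n - chi x = tpi (tlift (s n - chi x *+ k) / k%:R) by rewrite /z addrC addKr.
  rewrite fun_mulrn; apply: le_trans (cnorm_tpi _) _.
  have -> : `|tlift (s n - chi x *+ k) / k%:R| = cnorm (s n - chi x *+ k) / k%:R.
    by rewrite normrM normfV (ger0_norm (ltW kp)).
  rewrite ler_pdivrMr// ler_peMr ?cnorm_ge0//.
  by rewrite ler1n.
- by move=> chi; have [s hs] := torsion_dense (chi x); exists s.
- split; first by split; [exists 1%N|].
  move=> [chi s] [chi' s'] [/= [k k0 hk] ->] [/= [k' k'0 hk'] ->]; split=> //=.
  exists (k * k')%N; first by rewrite muln_gt0 k0.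
  by rewrite mulrnBl mulrnA hk mul0rn mulnC mulrnA hk' mul0rn subr0.
- by move=> y [_ /= ->].
- move=> [chi s] [/= [k k0 hk] ->]; split=> /= [n|e e0].
    by exists k => //; rewrite -fun_mulrn hk.
  by exists 0%N => n _; rewrite subrr cnorm0.
have /choice[t ht] : forall n, exists x, forall chi, character chi -> chi x = F chi n.
  by move=> n; apply: (dual_surjective cK (Fh := fun chi => F chi n)) => chi chi'; rewrite FB.
exists t; split.
- by move=> n chi hchi; rewrite ht//; have [h _] := FAd chi; exact: h.
- move=> n chi k hchi k0 hk; rewrite ht// (Fg chi (fun=> chi x))//; split=> //=.
  by exists k.
move=> U U0; have [L [e [hL e0 LU]]] := compact_bohr R hK cK U0.
have [N hN] : exists N, forall n, (N <= n)%N -> forall chi, chi \in L -> cnorm (F chi n - chi x) < e.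
  elim: (L) => [|chi L' [N hN]]; first by exists 0%N.
  have [_ /(_ _ e0)[N' hN']] := FAd chi; exists (maxn N N') => n; rewrite geq_max => /andP[Nn N'n] psi.
  by rewrite inE => /predU1P[->|/(hN n Nn)//]; exact: hN'.
exists N => n Nn; apply: LU => chi chiL; rewrite (hL _ chiL).1 ht; last exact: hL.
exact: hN.
Qed.

Lemma torsion_approx_multiples n (x t : K) : (0 < n)%N ->
  (forall (chi : K -> circle) k, character chi -> (0 < k)%N -> chi *+ k = 0 -> chi t = chi x) ->
  multiples K n (x - t).
Proof.
move=> n0 h; apply: (multiples_annihilator (R := R) hK cK) => chi hchi chin.
by rewrite hchi.1 (h chi n)// subrr.
Qed.

Lemma multiples_closed n : closed (multiples K n).
Proof.
move=> y /closure_sub cy; pose I := {U : set K | nbhs (0 : K) U}.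
pose D (i : I) := [set z : K | sval i (z *+ n - y)].
have [||z _ hz] := @compact_directed K setT I (exist _ setT filterT) D cK.
- move=> [U U0] [V V0]; exists (exist _ (U `&` V) (filterI U0 V0)) => z [Uz Vz].
  by split.
- by move=> [U U0]; have [_ [z _ <-] hz] := cy U U0; exists z.
exists z => //; apply/eqP; rewrite -subr_eq0; apply/eqP; apply: (hausdorff_sep0 K).1 => // U U0.
have [V [V0 VN VU hV]] := nbhs0_add U0; have [V1 [V10 _ V1V hV1]] := nbhs0_muln n V0.
have /closure_sub'/(_ _ V10)[w Dw hw] := hz (exist _ V V0).
have -> : z *+ n - y = (z - w) *+ n + (w *+ n - y) by rewrite mulrnBl; zmodule.
by have [] := hV _ _ (hV1 _ _ hw (leqnn _)) Dw.
Qed.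

Lemma cyclic_multiples_multiples (t : K) m n : (m %| n)%N -> cyclic_multiples t n `<=` multiples K m.
Proof.
move=> /dvdnP[k ->] z hz; apply: multiples_closed; apply: closureS hz => _ [c _ <-].
by exists (t *~ c *+ k) => //; rewrite -mulrnA.
Qed.

Section PrimaryComponents.
Context (t : K) (tt : torsion_valued t).

Lemma torsion_valued_small_fact U : nbhs (0 : K) U ->
  exists N : nat, forall n, (N <= n)%N -> cyclic_multiples t n`! `<=` U.
Proof.
move=> /(torsion_valued_small tt)[N N0 hN]; exists N => n Nn; apply: subset_trans hN.
by apply: cyclic_multiples_dvd; rewrite dvdn_fact// N0.
Qed.

(** The image of [t] under the [p]-adic idempotent, expressed by a congruence at every level
    [n!]. *)
Definition component (p : nat) (y : K) : Prop :=
  forall n, cyclic_multiples t n`! (y - t *+ projector p n).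

Lemma component_exists p : exists y, component p y.
Proof.
pose D n := [set y | cyclic_multiples t n`! (y - t *+ projector p n)].
have cs n := cyclic_multiples_subgroup t n.
have Dle m n : (n <= m)%N -> D m `<=` D n.
  move=> nm y Dy; change (cyclic_multiples t n`! (y - t *+ projector p n)).
  have -> : y - t *+ projector p n = (y - t *+ projector p m) + (t *+ projector p m - t *+ projector p n) by zmodule.
  apply: (subgroupD (cs _)); first by apply: cyclic_multiples_dvd Dy; exact: fact_dvdn.
  by apply: cyclic_multiples_mod; exact: projector_mod.
have [||y _ hy] := @compact_directed K setT nat 0%N D cK.
- move=> m n; exists (maxn m n) => y Dy; split; apply: Dle Dy; [exact: leq_maxl|exact: leq_maxr].
- by move=> n; exists (t *+ projector p n); rewrite // /D /= subrr; exact: (cs _).1.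
exists y => n; apply/closure_sub => U U0; have [V [V0 VN VU hV]] := nbhs0_add U0.
have /closure_sub/(_ _ V0)[z /closure_sub/(_ _ V0)[a Ha Va] Vz] := hy n.
exists a => //; have -> : a - (y - t *+ projector p n) = (a - (z - t *+ projector p n)) + (z - y) by zmodule.
by have [] := hV _ _ Va Vz.
Qed.

Lemma component_ptors p y : component p y -> ptors p y.
Proof.
move=> hy U /torsion_valued_small_fact[n /(_ n (leqnn _)) hn]; exists (logn p n`!) => c; apply: hn.
set q := (p ^ _)%N; have cs := cyclic_multiples_subgroup t n`!.
have -> : y *+ (q * c) = (y - t *+ projector p n) *+ (q * c) + t *+ (projector p n * (q * c)).
  by rewrite mulrnBl -mulrnA subrK.
apply: (subgroupD cs); first exact: (subgroupMn cs).
apply: cyclic_multiples_mulrn; rewrite mulnA dvdn_mulr// -(partnC p (fact_gt0 n)) mulnC.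
by rewrite p_part dvdn_mul// dvdn_projector.
Qed.

Lemma component_multiples p m y : prime p -> component p y -> multiples K (p ^ m) (t - y).
Proof.
move=> pp hy; pose n := (p ^ m)%N; have sM := multiples_subgroup K (p ^ m).
have p0 : (0 < n)%N by rewrite expn_gt0 prime_gt0.
have nn : (n %| n`!)%N by rewrite dvdn_fact// p0 leqnn.
have -> : t - y = - (t *+ projector p n - t *+ 1) - (y - t *+ projector p n) by rewrite mulr1n; zmodule.
apply: (subgroupB sM); last exact: (cyclic_multiples_multiples nn (hy n)).
apply: (subgroupN sM); have [c ->] := mod_mulrn K (projector1 p n).
apply: (@multiples_dvd K (p ^ m)%N _ _ _); last by exists (t *~ c).
have -> : (p ^ m = n`_p)%N by rewrite part_pnat_id// pnatX pnat_id.
by rewrite partn_dvd// fact_gt0.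
Qed.

Lemma component_sum (y : nat -> K) : (forall p, prime p -> component p (y p)) ->
  forall U, nbhs (0 : K) U -> exists N, forall n, (N <= n)%N ->
    U (\sum_(p < n`!.+1 | prime p) y p - t).
Proof.
move=> hy U /torsion_valued_small_fact[N hN]; exists N => n Nn; apply: (hN n Nn).
have cs := cyclic_multiples_subgroup t n`!.
have eS : t *+ (\sum_(p < n`!.+1 | prime p) projector p n) =
    \sum_(p < n`!.+1 | prime p) t *+ projector p n by rewrite sumrMnr.
have -> : \sum_(p < n`!.+1 | prime p) y p - t =
    (t *+ (\sum_(p < n`!.+1 | prime p) projector p n) - t *+ 1) +
    \sum_(p < n`!.+1 | prime p) (y p - t *+ projector p n).
  rewrite sumrB eS mulr1n; set T := \sum_(p < _ | _) (t *+ _); set Y := \sum_(p < _ | _) y p.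
  zmodule.
apply: (subgroupD cs); first by apply: cyclic_multiples_mod; exact: sum_projectors.
by apply: (subgroup_sum cs) => p pp; exact: hy.
Qed.

Lemma component_limit p y : component p y -> forall U, nbhs (0 : K) U -> exists N, forall n, (N <= n)%N ->
  U (t *+ projector p n - y).
Proof.
move=> hy U /torsion_valued_small_fact[N hN]; exists N => n Nn; apply: (hN n Nn).
by rewrite -opprB; apply: (subgroupN (cyclic_multiples_subgroup t n`!)); exact: hy.
Qed.

End PrimaryComponents.

End TorsionInCompact.

(** * The dense subgroup modulo powers of primes *)

Section DenseSubgroup.
Context (R : realType) (K : topologicalZmodType).
Hypotheses (hK : hausdorff_space K) (cK : compact [set: K]).
Context (G : set K) (sG : subgroup G).
Hypothesis seqG : forall (u : nat -> K) (l : K), (forall n, G (u n)) ->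
  (forall U, nbhs (0 : K) U -> exists N, forall n, (N <= n)%N -> U (u n - l)) -> G l.
Hypothesis socle : forall p x, prime p -> x *+ p = 0 -> G x.
Context (k : nat -> nat).
Hypothesis primary : forall p x, prime p -> ptors p x -> G (x *+ p ^ k p).

Local Notation mult p := (multiples K (p ^ (k p).+1)).

Let sM p : subgroup (mult p) := multiples_subgroup K _.

Let ppow0 p i : prime p -> (0 < p ^ i)%N. Proof. by move=> pp; rewrite expn_gt0 prime_gt0. Qed.

Lemma torsion_approx1 x : exists t, torsion_valued R t /\
  forall p i, prime p -> multiples K (p ^ i) (x - t).
Proof.
have [t [tt th _]] := torsion_approx R hK cK x; exists (t 0%N); split=> // p i pp.
by apply: (torsion_approx_multiples hK cK (ppow0 i pp)) => chi j; exact: th.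
Qed.

Lemma ptors_mod p i x : prime p -> exists2 h, ptors p h & multiples K (p ^ i) (x - h).
Proof.
move=> pp; have [t [tt ht]] := torsion_approx1 x; have [y hy] := component_exists cK t p.
exists y; first exact: (component_ptors hK cK tt hy).
have -> : x - y = (x - t) + (t - y) by zmodule.
by apply: (subgroupD (multiples_subgroup K _)); [exact: ht|exact: (component_multiples hK cK _ pp hy)].
Qed.

Lemma ptorsB p (x y : K) : ptors p x -> ptors p y -> ptors p (x - y).
Proof.
move=> tx ty U U0; have [V V0 hV] := nbhs0_sub U0.
have [n hn] := tx V V0; have [n' hn'] := ty V V0; exists (n + n')%N => c; rewrite mulrnBl; apply: hV.
  by rewrite expnD -mulnA.
by rewrite addnC expnD -mulnA.
Qed.

(** Any [z] with [z *+ p ^ (k p).+1 = x] is topologically [p]-torsion along with [x], so [primary]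
    applies to [z]. *)
Lemma ptors_mult p x : prime p -> ptors p x -> mult p x -> G x.
Proof.
move=> pp tx [z _ zx]; have tz : ptors p z.
  move=> U U0; have [n hn] := tx U U0; exists ((k p).+1 + n)%N => c.
  by rewrite expnD -mulnA mulrnA zx.
by rewrite -zx expnSr mulrnA; apply: subgroupMn => //; exact: primary.
Qed.

(** The [p]-component of [t] agrees with [w] modulo [p ^ (k p).+1 K], hence is in [G] by
    [ptors_mult]; and [t] is the limit of a sequence of finite sums of its components. *)
Lemma torsion_valued_in t : torsion_valued R t ->
  (forall p, prime p -> exists w, [/\ G w, ptors p w & mult p (t - w)]) -> G t.
Proof.
move=> tt hw; have /choice[y hy] := component_exists cK t.
have Gy p : prime p -> G (y p).
  move=> pp; have [w [Gw tw mw]] := hw p pp; rewrite -(subrK w (y p)); apply: subgroupD => //.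
  apply: (ptors_mult pp); first by apply: ptorsB => //; exact: (component_ptors hK cK tt (hy p)).
  have -> : y p - w = (t - w) - (t - y p) by zmodule.
  by apply: (subgroupB (sM p)) => //; exact: (component_multiples hK cK _ pp (hy p)).
apply: (seqG (u := fun n => \sum_(p < n`!.+1 | prime p) y p)) => [n|].
  by apply: subgroup_sum => // p pp; exact: Gy.
by apply: (component_sum hK cK tt) => p _; exact: hy.
Qed.

Lemma all_mult_in x : (forall p, prime p -> mult p x) -> G x.
Proof.
move=> hx; have [t [tt th tx]] := torsion_approx R hK cK x.
apply: seqG tx => n; apply: torsion_valued_in => // p pp.
exists 0; split; first exact: sG.1.
  by move=> U U0; exists 0%N => c; rewrite mul0rn; exact: nbhs0_0.
rewrite subr0 -(subKr x (t n)); apply: (subgroupB (sM p)); first exact: hx.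
by apply: (torsion_approx_multiples hK cK (ppow0 _ pp)) => chi j; exact: th.
Qed.

(** A topologically torsion [t] congruent to [g] modulo all prime powers is in [G] by [all_mult_in].
    Its [p]-component is a limit of a sequence of integer multiples of [t]. *)
Lemma primary_rep p g : prime p -> G g -> exists w, [/\ G w, ptors p w & mult p (g - w)].
Proof.
move=> pp Gg; have [t [tt ht]] := torsion_approx1 g; have [y hy] := component_exists cK t p.
have Gt : G t.
  rewrite -(subKr g t); apply: subgroupB => //; apply: all_mult_in => q pq; exact: ht.
exists y; split.
- apply: (seqG (u := fun n => t *+ projector p n)) => [n|]; first exact: subgroupMn.
  exact: (component_limit hK cK tt hy).
- exact: (component_ptors hK cK tt hy).
have -> : g - y = (g - t) + (t - y) by zmodule.
by apply: (subgroupD (sM p)); [exact: ht|exact: (component_multiples hK cK _ pp hy)].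
Qed.

Lemma crt_finite (g : nat -> K) n :
  exists z, forall p, (p < n)%N -> prime p -> mult p (z - g p).
Proof.
elim: n => [|n [z hz]]; first by exists 0.
have [pn|npn] := boolP (prime n); last first.
  exists z => p; rewrite ltnS leq_eqVlt => /predU1P[->|/hz//]; by rewrite (negbTE npn).
pose A := (\prod_(q < n | prime q) q ^ (k q).+1)%N; pose N := (n ^ (k n).+1)%N.
have co : coprime A N.
  rewrite /A; apply: (big_ind (fun a => coprime a N)) => [|a b ca cb|q pq]; first exact: coprime1n.
    by rewrite coprimeMl ca.
  apply: coprimeXl; apply: coprimeXr; rewrite prime_coprime// dvdn_prime2//.
  by rewrite ltn_eqF.
pose e := chinese A N 0 1; exists (z + (g n - z) *+ e) => p; rewrite ltnS leq_eqVlt => /predU1P[->|lt_pn] pp.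
  have [c hc] := mod_mulrn K (chinese_modr co 0 1).
  have -> : z + (g n - z) *+ e - g n = (g n - z) *+ e - (g n - z) *+ 1 by rewrite mulr1n; zmodule.
  by rewrite hc; exists ((g n - z) *~ c).
have -> : z + (g n - z) *+ e - g p = (z - g p) + (g n - z) *+ e by zmodule.
apply: (subgroupD (sM p)); first exact: hz.
apply: (@multiples_dvd K _ e); last by exists (g n - z).
have Ae : (A %| e)%N by apply/eqP; rewrite (chinese_modl co) mod0n.
apply: dvdn_trans Ae; rewrite /A (bigD1 (Ordinal lt_pn))//=.
exact: dvdn_mulr.
Qed.

(** Compactness solves the congruences in [K]. The solution is then replaced by a topologically
    torsion [t] congruent to it, which lies in [G] because every [g p] has a primary representative
    there. *)
Lemma crt_in (g : nat -> K) : (forall p, G (g p)) ->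
  exists2 x, G x & forall p, prime p -> mult p (x - g p).
Proof.
move=> Gg; pose D n := [set z | forall p, (p < n)%N -> prime p -> mult p (z - g p)].
have [||z _ hz] := @compact_directed K setT nat 0%N D cK.
- move=> m n; exists (maxn m n) => z Dz; split=> p lt_p pp; apply: Dz => //; apply: leq_trans lt_p _.
    exact: leq_maxl.
  exact: leq_maxr.
- by move=> n; have [z hz] := crt_finite g n; exists z.
have zg p : prime p -> mult p (z - g p).
  move=> pp; apply: (multiples_closed hK cK); apply/closure_sub => U U0.
  have /closure_sub/(_ _ U0)[w Dw Uw] := hz p.+1; exists (w - g p); first exact: Dw.
  by have -> : w - g p - (z - g p) = w - z by zmodule.
have [t [tt ht]] := torsion_approx1 z.
have tg p : prime p -> mult p (t - g p).
  move=> pp; have -> : t - g p = (z - g p) - (z - t) by zmodule.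
  by apply: (subgroupB (sM p)); [exact: zg|exact: ht].
exists t => //; apply: torsion_valued_in => // p pp; have [w [Gw tw mw]] := primary_rep pp (Gg p).
exists w; split=> //; have -> : t - w = (t - g p) + (g p - w) by zmodule.
by apply: (subgroupD (sM p)) => //; exact: tg.
Qed.

(** Multiply a point of [S] outside [p ^ (k p).+1 K] by the last power of [p] that leaves it
    outside; then [p] times it is [p ^ (k p).+1 z]. Subtracting [p ^ k p z] leaves a [p]-torsion
    point, which is in [G], and modulo [p ^ (k p).+1 K] the term [p ^ k p z] comes from [G] as well.
    The spare factor [p] makes this division possible. *)
Lemma essential_quotient p (S : set K) : prime p -> subgroup S -> mult p `<=` S ->
  (forall g, G g -> S g -> mult p g) -> S `<=` mult p.
Proof.
move=> pp sS MS GS x Sx; apply: contrapT => nx.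
have ex : exists j, `[< mult p (x *+ p ^ j) >] by exists (k p).+1; apply/asboolP; exists x.
case: (ex_minnP ex) => -[|j] /asboolP hj minj; first by apply: nx; rewrite expn0 in hj.
have nx' : ~ mult p (x *+ p ^ j).
  by move=> h; have := minj j; rewrite ltnn => /(_ (asboolT h)).
have [z _ hz] := hj.
pose y := x *+ p ^ j - z *+ p ^ k p.
have Gy : G y.
  apply: (socle pp); rewrite /y mulrnBl -!mulrnA -!expnSr hz subrr//.
have [h th [w _ hw]] := ptors_mod 1 z pp.
have ez : z *+ p ^ k p = h *+ p ^ k p + w *+ p ^ (k p).+1.
  by rewrite -(subrK h z) -hw mulrnDl -mulrnA expn1 -expnS addrC.
have ex' : x *+ p ^ j = (y + h *+ p ^ k p) + w *+ p ^ (k p).+1.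
  by rewrite /y ez; zmodule.
have Mw : mult p (w *+ p ^ (k p).+1) by exists w.
apply: nx'; rewrite ex'; apply: (subgroupD (sM p)) => //; apply: GS.
  by apply: subgroupD => //; exact: primary.
have -> : y + h *+ p ^ k p = x *+ p ^ j - w *+ p ^ (k p).+1 by rewrite ex'; zmodule.
by apply: subgroupB => //; [exact: subgroupMn|exact: MS].
Qed.

End DenseSubgroup.

(** * Minimal quotients and the isomorphism with their product *)

Lemma minprop_minimal (G : topologicalZmodType) : hausdorff_space G -> minprop G -> minimal_group G.
Proof.
move=> hG mG; split=> // -[tau [[addc oppc] hT [le nle]]]; apply: nle => E oE.
pose T : topologicalType := Topological.Pack tau.
have subc (x y : T) (U : set T) : nbhs (((x : G) - (y : G) : G) : T) U ->
    exists V W : set T, [/\ nbhs x V, nbhs y W & forall a b : G, V a -> W b -> U (a - b : G)].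
  move=> /(addc (x, (- (y : G) : G) : T))[[V W] /= [xV yW] VWU].
  exists V, [set b : T | W (- (b : G) : G)]; split=> //; first exact: (oppc y W yW).
  by move=> a b Va Wb; exact: (VWU (a, (- b : G) : T)).
have nbhsTG (x : G) (V : set G) : @nbhs T T x V -> nbhs x V.
  by rewrite !nbhsE => -[A [oA Ax] AV]; exists A => //; split=> //; exact: le.
pose B : set (set G) := [set V | @nbhs T T (0 : G) V].
have gB : group_base B.
  split.
  - by exists setT; exact: (@filterT _ (@nbhs T T (0 : G))).
  - by move=> U V U0 V0; exists (U `&` V) => //; exact: (@filterI _ (@nbhs T T (0 : G))).
  - by move=> U U0; exact: (@nbhs_singleton T).
  move=> U U0; have U0' : nbhs (((0 : G) - (0 : G) : G) : T) U by rewrite subr0.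
  have [V [W [V0 W0 h]]] := subc 0 0 U U0'.
  exists (V `&` W); first exact: (@filterI _ (@nbhs T T (0 : G))).
  by move=> x y [Vx _] [_ Wy]; exact: h.
have sep x : (forall V, B V -> V x) -> x = 0.
  move=> hx; apply/esym; apply: (hT (0 : G) x) => A C A0 xC; exists (0 : G); split.
    exact: (@nbhs_singleton T).
  have xC' : nbhs (((x : G) - (0 : G) : G) : T) C by rewrite subr0.
  have [V [W [V0 W0 h]]] := subc x 0 C xC'.
  by have := h x x (@nbhs_singleton T _ _ V0) (hx W W0); rewrite subrr.
rewrite openE.
move=> x Ex; have Ex' : nbhs (0 : G) [set v | E (v + x)].
  have xE : @nbhs G G x E by apply: (@open_nbhs_nbhs G); split.
  exact: (nbhs_shift (G := G) x E).1 xE.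
have [V V0 VE] := mG B gB (fun V => @nbhsTG 0 V) sep _ Ex'.
have V0' : nbhs (((x : G) - (x : G) : G) : T) V by rewrite subrr.
have [V1 [W [xV1 xW h]]] := subc x x V V0'.
apply: (@filterS _ (@nbhs T T x) _ V1) => // y V1y.
by have := VE _ (h y x V1y (@nbhs_singleton T _ _ xW)); rewrite /= subrK.
Qed.

Lemma additive_continuous (G H : topologicalZmodType) (f : G -> H) :
  (forall x y, f (x - y) = f x - f y) ->
  (forall U, nbhs (0 : H) U -> nbhs (0 : G) [set x | U (f x)]) -> continuous f.
Proof.
move=> fB f0 x A /nbhs_shift /f0 h; apply/nbhs_shift; apply: nbhs0S h => y /=.
have -> // : f y + f x = f (y + x).
by have := fB (y + x) x; rewrite addrK => ->; rewrite subrK.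
Qed.

Lemma has_order_pfactor (G : zmodType) p m (x : G) : prime p -> x *+ p ^ m = 0 ->
  exists j, has_order x (p ^ j).
Proof.
move=> pp xm; have ex : exists j, x *+ p ^ j == 0 by exists m; apply/eqP.
case: (ex_minnP ex) => j /eqP xj minj; exists j; split=> //; first by rewrite expn_gt0 prime_gt0.
move=> n n0 xn; have xd : x *+ gcdn n (p ^ j) = 0.
  case: (egcdnP (p ^ j) n0) => a b e _.
  have : x *+ (a * n) = x *+ (b * p ^ j) + x *+ gcdn n (p ^ j) by rewrite e mulrnDr.
  by rewrite mulnC mulrnA xn mul0rn mulnC mulrnA xj mul0rn add0r.
have /dvdn_pfactor[//|i ij di] : (gcdn n (p ^ j) %| p ^ j)%N by exact: dvdn_gcdr.
have ji : (j <= i)%N by apply: minj; rewrite -di xd.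
have eij : i = j by apply/eqP; rewrite eqn_leq ij ji.
by apply: dvdn_leq => //; rewrite -eij -di dvdn_gcdl.
Qed.

Section QuotientProduct.
Context (G : topologicalZmodType) (I : Type) (N : zmodClosed G) (M : I -> zmodClosed G).
Local Notation Q := (quotient_group N).
Local Notation P := (prod_topology (fun i => quotient_group (M i))).

(** Built from chosen representatives; [qprodE] removes the choice. The inclusions are an argument
    because the additive structure declared below depends on them. *)
Definition qprod (_ : forall i x, x \in N -> x \in M i) (q : Q) : P :=
  fun i => qpi (M i) (sval (cid (qpi_surj q))).

Hypothesis NM : forall i x, x \in N -> x \in M i.

Lemma qprodE x i : qprod NM (qpi N x) i = qpi (M i) x.
Proof.
apply/qpi_eq; apply: NM; apply/qpi_eq.
exact: (svalP (cid (qpi_surj (qpi N x)))).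
Qed.

Lemma qprod_is_additive : zmod_morphism (qprod NM).
Proof.
move=> q r; have [x <-] := qpi_surj q; have [y <-] := qpi_surj r.
apply: functional_extensionality_dep => i.
have e : qpi N x - qpi N y = qpi N (x - y) by rewrite [RHS]raddfB.
have e' : qpi (M i) (x - y) = qpi (M i) x - qpi (M i) y by exact: raddfB.
rewrite e -[RHS]/(qprod NM (qpi N x) i - qprod NM (qpi N y) i) !qprodE; exact: e'.
Qed.

HB.instance Definition _ := GRing.isZmodMorphism.Build Q P (qprod NM) qprod_is_additive.

Lemma qprod_continuous : continuous (qprod NM).
Proof.
move=> q; have FF : Filter (qprod NM x @[x --> q]) by apply: fmap_filter; exact: nbhs_filter.
apply/cvg_sup => i A; rewrite nbhsE => -[_ [[C oC <-] Cq] CA].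
have ci : continuous (fun r : Q => qprod NM r i).
  apply: additive_continuous => [r s|U /qpi_nbhs U0].
    by have := congr1 (fun y : P => y i) (qprod_is_additive r s).
  by apply/qpi_nbhs; apply: nbhs0S U0 => x /=; rewrite qprodE.
have : nbhs q [set r : Q | C (qprod NM r i)] by apply: ci; exact: open_nbhs_nbhs.
by apply: filterS => r Cr; exact: CA.
Qed.

End QuotientProduct.

Section Quotients.
Context (R : realType) (G K : topologicalZmodType) (f : {additive G -> K}).
Hypotheses (df : dense_embedding f) (hK : hausdorff_space K) (cK : compact [set: K]).
Hypothesis seqG : forall (u : nat -> K) (l : K), (forall n, exists g, f g = u n) ->
  (forall U, nbhs (0 : K) U -> exists N, forall n, (N <= n)%N -> U (u n - l)) -> exists g, f g = l.
Hypothesis socle : forall p x, prime p -> x *+ p = 0 -> exists g, f g = x.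
Context (k : nat -> nat).
Hypothesis primary : forall p x, prime p -> ptors p x -> exists g, f g = x *+ p ^ k p.

Local Notation mult p := (multiples K (p ^ (k p).+1)).

Let fB x y : f (x - y) = f x - f y. Proof. exact: raddfB. Qed.
Let f0 : f 0 = 0. Proof. exact: raddf0. Qed.
Let fMn x n : f (x *+ n) = f x *+ n. Proof. exact: raddfMn. Qed.

Let range_subgroup : subgroup [set x | exists g, f g = x].
Proof. by split=> [|_ _ [g <-] [h <-]]; [exists 0|exists (g - h)]. Qed.

Let pulled (p : nat) : set G := [set g | mult p (f g)].
Let pulled_subgroup p : subgroup (pulled p).
Proof.
split; first by rewrite /pulled /= f0; exact: (multiples_subgroup K _).1.
by move=> x y hx hy; rewrite /pulled /= fB; exact: (multiples_subgroup K _).2.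
Qed.

Let core : set G := [set g | forall p, prime p -> mult p (f g)].
Let core_subgroup : subgroup core.
Proof.
by split=> [p _|x y hx hy p pp]; [exact: (pulled_subgroup p).1|apply: (pulled_subgroup p).2; [exact: hx|exact: hy]].
Qed.

Let fnbhs U : nbhs (0 : K) U -> nbhs (0 : G) [set x | U (f x)].
Proof. by have [_ h _ _] := df; exact: h. Qed.
Let fnbhs' U : nbhs (0 : G) U -> exists2 W, nbhs (0 : K) W & forall x, W (f x) -> U x.
Proof. by have [_ _ h _] := df; exact: h. Qed.
Let fdense h W : nbhs (0 : K) W -> exists g, W (h - f g).
Proof. by have [_ _ _ h'] := df; exact: h'. Qed.

Let all_mult x : (forall p, prime p -> mult p x) -> exists2 g, f g = x & core g.
Proof.
move=> hx; have [g fg] := all_mult_in R hK cK range_subgroup seqG primary hx.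
by exists g => // p pp; rewrite fg; exact: hx.
Qed.

(** A cluster point in [K] of the image of a filter lies in every closed group [p ^ (k p).+1 K],
    hence comes from [core]; the embedding carries clustering back to [G]. *)
Lemma core_compact : compact core.
Proof.
move=> F FF Fcore; pose F' : set_system K := [set A | F [set g | A (f g)]].
have FF' : ProperFilter F'.
  have F0 : Filter F'.
    split=> [|A B FA FB|A B AB]; [exact: (@filterT _ F)|exact: (@filterI _ F)|].
    by apply: (@filterS _ F) => g; exact: AB.
  apply: Build_ProperFilter_ex => A FA.
  by have [g hg] := @filter_ex _ F FF _ FA; exists (f g).
have [|x [_ clx]] := cK FF'; first exact: (@filterT _ F).
have [|g fg cg] := @all_mult x.
  move=> p pp; apply: (multiples_closed hK cK) => A xA.
  have Fm : F' (mult p) by apply: (@filterS _ F) Fcore => g; exact.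
  by have := clx _ _ Fm xA.
exists g; split=> // A B FA /nbhs_shift/fnbhs'[W W0 hW].
have FA' : F' (f @` A) by apply: (@filterS _ F) FA => h Ah; exists h.
have [_ [[h Ah <-] Wh]] := clx _ _ FA' (nbhs_subx x W0).
exists h; split=> //; have := hW (h - g); rewrite fB fg => /(_ Wh).
by rewrite /= subrK.
Qed.

Let pulled_closed p : closed (pulled p).
Proof.
move=> g /closure_sub cg; apply: (multiples_closed hK cK); apply/closure_sub => U /fnbhs/cg[a pa].
by rewrite /= fB => Ua; exists (f a).
Qed.

Local Notation B p := (quotient_group (subgroup_pred (pulled_subgroup p))).
Local Notation pi p := (@qpi G (subgroup_pred (pulled_subgroup p)) : G -> B p).

Let pi_eq p x y : pi p x = pi p y <-> mult p (f x - f y).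
Proof. by rewrite qpi_eq -fB; exact: (subgroup_predP (pulled_subgroup p) (x - y)). Qed.

Let piB p x y : pi p (x - y) = pi p x - pi p y. Proof. exact: raddfB. Qed.
Let pi0 p : pi p 0 = 0. Proof. exact: raddf0. Qed.

Let multMn p g : mult p (f (g *+ p ^ (k p).+1)).
Proof. by exists (f g); rewrite ?fMn. Qed.

Let pi_mult p g : pi p (g *+ p ^ (k p).+1) = 0.
Proof. by rewrite -(pi0 p); apply/pi_eq; rewrite f0 subr0; exact: multMn. Qed.

Lemma component_mulrn p (q : B p) : q *+ p ^ (k p).+1 = 0.
Proof.
have [g <-] := qpi_surj q; have <- := pi_mult p g.
by apply/esym; exact: raddfMn.
Qed.

(** [S] collects the points of [K] that the coarser topology cannot separate from zero. It meets [G]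
    only inside [p ^ (k p).+1 K] since that topology is Hausdorff, so [essential_quotient] bounds
    it. By compactness, points of every [W] lying outside [U] would cluster in [S]. *)
Lemma component_minprop p : prime p -> minprop (B p).
Proof.
move=> pp BB gB BN sep U U0; have [[W0 BW0] Bcap B0 Bsub] := gB.
have sM := multiples_subgroup K (p ^ (k p).+1).
pose S : set K := [set x | forall W, BB W -> closure [set f g | g in [set g | W (pi p g)]] x].
have sS : subgroup S.
  split=> [W BW|x y Sx Sy W BW].
    by apply: subset_closure; exists 0; [rewrite /= pi0; exact: B0|exact: f0].
  have [V BV VW] := Bsub W BW; apply/closure_sub' => A A0; have [A' A'0 hA'] := nbhs0_sub A0.
  have /closure_sub'/(_ _ A'0)[_ [g Vg <-] hg] := Sx V BV.
  have /closure_sub'/(_ _ A'0)[_ [h Vh <-] hh] := Sy V BV.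
  exists (f g - f h); first by exists (g - h); rewrite ?fB//= piB; exact: VW.
  have -> : x - y - (f g - f h) = (x - f g) - (y - f h) by zmodule.
  exact: hA'.
have MS : mult p `<=` S.
  move=> _ [z _ <-] W BW; apply/closure_sub' => A A0.
  have [V [V0 _ _ hV]] := nbhs0_muln (p ^ (k p).+1) A0; have [g hg] := fdense z V0.
  exists (f (g *+ p ^ (k p).+1)); first by exists (g *+ p ^ (k p).+1); rewrite //= pi_mult; exact: B0.
  by rewrite fMn -mulrnBl; apply: hV.
have GS x : (exists g, f g = x) -> S x -> mult p x.
  move=> [g <-] Sg; suff : pi p g = pi p 0 by move=> /pi_eq; rewrite f0 subr0.
  rewrite pi0; apply: sep => W BW; have [V BV VW] := Bsub W BW; have [V' BV' V'V] := Bsub V BV.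
  have /qpi_nbhs/fnbhs'[A A0 hA] := BN _ BV'.
  have /closure_sub'/(_ _ A0)[_ [h V'h <-] hh] := Sg V' BV'.
  have Vgh : V' (pi p (g - h)) by apply: hA; rewrite fB.
  have h1 : V (pi p (g - h)) by have := V'V _ _ Vgh (B0 _ BV'); rewrite subr0.
  have h2 : V (0 - pi p h) := V'V _ _ (B0 _ BV') V'h.
  have := VW _ _ h1 h2; rewrite piB.
  by have -> : pi p g - pi p h - (0 - pi p h) = pi p g by zmodule.
have SM := essential_quotient R hK cK range_subgroup socle primary pp sS MS GS.
apply: contrapT => no; pose I := {W : set (B p) | BB W}.
pose D (i : I) : set K := [set f g | g in [set g | sval i (pi p g) /\ ~ U (pi p g)]].
have [||x _ hx] := @compact_directed K setT I (exist _ W0 BW0) D cK.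
- move=> [W BW] [V BV]; have [W' BW' W'WV] := Bcap W V BW BV; exists (exist _ W' BW').
  by move=> _ [g [/= W'g nU] <-]; have [Wg Vg] := W'WV _ W'g; split; exists g.
- move=> [W BW]; apply: contrapT => nx; apply: no; exists W => // q Wq; apply: contrapT => nU.
  by have [g gq] := qpi_surj q; apply: nx; exists (f g) => //; exists g => //=; rewrite gq.
have /SM[z _ zx] : S x.
  by move=> W BW; apply: closureS (hx (exist _ W BW)) => _ [g [Wg _] <-]; exists g.
have /fnbhs'[A A0 hA] := (qpi_nbhs U).1 U0.
have [A1 [A10 _ _ hA1]] := nbhs0_add A0.
have [A2 [A20 _ _ hA2]] := nbhs0_muln (p ^ (k p).+1) A10; have [h hh] := fdense z A20.
have /closure_sub/(_ _ A10)[_ [g [_ nU] <-] hg] := hx (exist _ W0 BW0).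
(* Approximating the root [z] of the cluster point by [f h] gives [g - h *+ p ^ (k p).+1], in the
   class of [g] but close to zero. *)
apply: nU; have -> : pi p g = pi p (g - h *+ p ^ (k p).+1) by rewrite piB pi_mult subr0.
apply: hA; rewrite fB fMn.
have -> : f g - f h *+ p ^ (k p).+1 = (f g - x) + (z - f h) *+ p ^ (k p).+1 by rewrite mulrnBl zx; zmodule.
by have [] := hA1 _ _ hg (hA2 _ _ hh (leqnn _)).
Qed.

Lemma component_hausdorff p : hausdorff_space (B p).
Proof.
apply: quotient_hausdorff.
have -> : [set x : G | x \in subgroup_pred (pulled_subgroup p)] = pulled p.
  by apply/seteqP; split=> x /=; [move/subgroup_predP|move=> h; apply/subgroup_predP].
exact: pulled_closed.
Qed.

Let corep : zmodClosed G := subgroup_pred core_subgroup.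
Let compp (p : prime_type) : zmodClosed G := subgroup_pred (pulled_subgroup (val p)).

Let core_comp p x : x \in corep -> x \in compp p.
Proof. by move=> /subgroup_predP h; apply/subgroup_predP; apply: h; exact: (valP p). Qed.

Local Notation Q := (quotient_group corep).
Local Notation P := (prod_topology (fun p : prime_type => quotient_group (compp p))).
Local Notation phi := (qprod core_comp : Q -> P).

Let phi_inj : injective phi.
Proof.
move=> q r; have [x <-] := qpi_surj q; have [y <-] := qpi_surj r => e.
apply/qpi_eq; apply/subgroup_predP => p pp.
have := congr1 (fun z : P => z (exist _ p pp)) e; rewrite /= !qprodE => /qpi_eq.
by move=> /(subgroup_predP (pulled_subgroup p)).
Qed.

Let phi_surj (y : P) : exists q, phi q = y.
Proof.
have /choice[g hg] : forall n, exists g : G, forall pp : prime n, qpi (compp (exist _ n pp)) g = y (exist _ n pp).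
  move=> n; have [pp|npp] := pselect (prime n); last by exists 0 => pp; case: npp.
  have [g hg] := qpi_surj (y (exist _ n pp)); exists g => pp'.
  by rewrite (bool_irrelevance pp' pp).
have [x [h fh] hx] := crt_in R hK cK range_subgroup seqG primary
  (g := fun n => f (g n)) (fun n => ex_intro _ (g n) erefl).
exists (qpi corep h); apply: functional_extensionality_dep => -[n pp]; rewrite qprodE -hg.
apply/qpi_eq; apply/(subgroup_predP (pulled_subgroup n)).
by rewrite /pulled /= fB fh; exact: hx.
Qed.

(** If no neighbourhood in the product worked, the offending points would cluster in [K] at a point
    of every [p ^ (k p).+1 K], that is, at a point of [core]; modulo [core] they would then come
    close to zero. *)
Let phi_open (U : set Q) : nbhs (0 : Q) U -> nbhs (0 : P) [set y | exists2 q, U q & phi q = y].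
Proof.
move=> U0; suff [A A0 hA] : exists2 A, nbhs (0 : P) A & forall g, A (phi (qpi corep g)) -> U (qpi corep g).
  apply: nbhs0S A0 => y Ay; have [q qy] := phi_surj y; exists q => //.
  by have [g gq] := qpi_surj q; rewrite -gq; apply: hA; rewrite gq qy.
apply: contrapT => no; pose I := {A : set P | nbhs (0 : P) A}.
pose D (i : I) : set K := [set f g | g in [set g | sval i (phi (qpi corep g)) /\ ~ U (qpi corep g)]].
have PT : nbhs (0 : P) setT by exact: (@filterT _ (nbhs (0 : P))).
have [||x _ hx] := @compact_directed K setT I (exist _ setT PT) D cK.
- move=> [A A0] [C C0]; exists (exist _ (A `&` C) (nbhs0I A0 C0)) => _ [g [/= [Ag Cg] nU] <-].
  by split; exists g.
- move=> [A A0]; apply: contrapT => nx; apply: no; exists A => // g Ag; apply: contrapT => nU.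
  by apply: nx; exists (f g) => //; exists g.
have [|g0 fg0 cg0] := @all_mult x.
  move=> p pp; apply: (multiples_closed hK cK); apply/closure_sub => C C0.
  have [V [V0 VN _ hV]] := nbhs0_add C0.
  pose E : set (quotient_group (compp (exist _ p pp))) := [set q | exists2 g, qpi _ g = q & V (f g)].
  have E0 : nbhs 0 E by apply/qpi_nbhs; apply: nbhs0S (fnbhs V0) => g Vg; exists g.
  have AE := prod_proj_nbhs (T := fun p : prime_type => quotient_group (compp p)) E0.
  have /closure_sub/(_ _ V0)[_ [g [/= Eg _] <-] hg] := hx (exist _ _ AE).
  move: Eg; rewrite qprodE => -[h /qpi_eq/(subgroup_predP (pulled_subgroup p)) mh Vh].
  exists (- f (h - g)); first exact: (subgroupN (multiples_subgroup K _)).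
  have -> : - f (h - g) - x = (f g - x) - f h by rewrite fB; zmodule.
  by have [] := hV _ _ hg Vh.
have /fnbhs'[W W0 hW] := (qpi_nbhs U).1 U0.
have /closure_sub/(_ _ W0)[_ [g [_ nU] <-] hg] := hx (exist _ setT PT).
apply: nU; have -> : qpi corep g = qpi corep (g - g0).
  apply/qpi_eq; apply/(subgroup_predP core_subgroup).
  by have -> : g - (g - g0) = g0 by zmodule.
by apply: hW; rewrite fB fg0.
Qed.

Theorem quotient_product : exists N : zmodClosed G, compact [set x : G | x \in N] /\
  exists B : prime_type -> topologicalZmodType,
    (forall p : prime_type, [/\ bounded_group (B p), p_torsion (val p) (B p) & minimal_group (B p)]) /\
    topologically_isomorphic (quotient_group N) (prod_topology B).
Proof.
exists corep; split.
  have -> : [set x : G | x \in corep] = core.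
    by apply/seteqP; split=> x /=; [move/subgroup_predP|move=> h; apply/subgroup_predP].
  exact: core_compact.
exists (fun p => quotient_group (compp p)); split.
  move=> p; have pp := valP p; split.
  - exists (val p ^ (k (val p)).+1)%N; first by rewrite expn_gt0 prime_gt0.
    exact: component_mulrn.
  - by move=> q; apply: (has_order_pfactor pp (component_mulrn q)).
  - by apply: minprop_minimal; [exact: component_hausdorff|exact: component_minprop].
pose psi (y : P) : Q := sval (cid (phi_surj y)).
have psiK y : phi (psi y) = y := svalP (cid (phi_surj y)).
have phiK q : psi (phi q) = q by apply: phi_inj; rewrite psiK.
exists (GRing.Additive.clone _ _ (qprod core_comp) _), psi; split=> //; first exact: qprod_continuous.
apply: additive_continuous => [y z|U U0].
  apply: phi_inj; rewrite psiK; have := qprod_is_additive core_comp (psi y) (psi z).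
  by rewrite !psiK.
by apply: nbhs0S (phi_open U0) => y [q Uq <-]; rewrite /= phiK.
Qed.

End Quotients.

Lemma range_sequentially_closed (G K : topologicalZmodType) (f : {additive G -> K}) :
  dense_embedding f -> hausdorff_space K -> sequentially_complete G ->
  forall (u : nat -> K) (l : K), (forall n, exists g, f g = u n) ->
  (forall U, nbhs (0 : K) U -> exists N, forall n, (N <= n)%N -> U (u n - l)) -> exists g, f g = l.
Proof.
move=> [_ fc fo _] hK sG u l /choice[g hg] ul.
have fB x y : f (x - y) = f x - f y by exact: raddfB.
have [U /fo[W W0 WU]|g0 /cvg0P gg0] := sG g.
  have [V V0 VW] := nbhs0_sub W0; have [N hN] := ul V V0; exists N => m n Nm Nn.
  apply: WU; rewrite fB !hg.
  have -> : u m - u n = (u m - l) - (u n - l) by zmodule.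
  by apply: VW; exact: hN.
exists g0; apply/eqP; rewrite -subr_eq0; apply/eqP; apply: (hausdorff_sep0 K).1 => // U U0.
have [V V0 VU] := nbhs0_sub U0; have [N hN] := ul V V0.
have [N' _ hN'] := gg0 _ (fc V V0).
have -> : f g0 - l = (u (maxn N N') - l) - f (g (maxn N N') - g0) by rewrite fB hg; zmodule.
by apply: VU; [apply: hN; exact: leq_maxl|apply: hN'; exact: leq_maxr].
Qed.

Theorem theoremD (G : topologicalZmodType)
    (G_hausdorff : hausdorff_space G)
    (G_complete : sequentially_complete G)
    (Gomega_minimal : minimal_group (prod_topology (fun _ : nat => G))) :
  exists N : zmodClosed G,
    compact [set x : G | x \in N] /\
    exists B : prime_type -> topologicalZmodType,
      (forall p : prime_type,
         [/\ bounded_group (B p), p_torsion (val p) (B p)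
           & minimal_group (B p)]) /\
      topologically_isomorphic (quotient_group N) (prod_topology B).
Proof.
(* The circle needs a real field, which the statement does not mention; a concrete one is fixed
   here. *)
pose R : realType := Rdefinitions.R.
have mG := minimal_minprop Gomega_minimal.
have df := completion_dense_embedding G_hausdorff.
have hK := @completion_hausdorff G.
have mK := minprop_dense (dense_embedding_power df) mG.
have cK := power_minimal_compact R hK (completion_complete G_hausdorff) mK.
have seqG := range_sequentially_closed df hK G_complete.
have /choice[k hk] : forall p, exists k, prime p -> forall x : completion G, ptors p x ->
    exists g, to_completion g = x *+ p ^ k.
  move=> p; have [pp|npp] := pselect (prime p); last by exists 0%N.
  by have [k hk] := primary_in_range df hK mG seqG pp; exists k.
exact: (quotient_product R df hK cK seqG (fun p x => @socle_in_range _ _ _ df hK mG p x)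
  (fun p x pp => hk p pp x)).
Qed.
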